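(* Assume (A1)–(A5). Then $$W_*:=\sup_{\zeta\in\mathcal A(\mathcal F^2_t)}\inf_{\xi\in\mathcal A_{ac}(\mathcal F^1_t)}N(\xi,\zeta)=\inf_{\xi\in\mathcal A_{ac}(\mathcal F^1_t)}\sup_{\zeta\in\mathcal A(\mathcal F^2_t)}N(\xi,\zeta)=:W^*,$$ and, writing $W$ for this common value, there exists $\zeta^*\in\mathcal A(\mathcal F^2_t)$ with $\inf_{\xi\in\mathcal A_{ac}(\mathcal F^1_t)}N(\xi,\zeta^* )=W$.
   Context: $(\Omega,\mathcal F,\mathbb P)$ complete probability space, filtration $(\mathcal F_t)_{t\in[0,T]}$, $T\in(0,\infty]$, and filtrations $\mathcal F^i_t\subseteq\mathcal F_t$, $i=1,2$. $\mathcal L_b$ = càdlàg $\mathcal B([0,T])\otimes\mathcal F$-measurable processes $X$ with $\mathbb E[\sup_t|X_t|]<\infty$; $X\in\mathcal L_b$ is regular if $\mathbb E[X_\eta-X_{\eta-}\mid\mathcal F_{\eta-}]=0$ a.s. for all predictable $(\mathcal F_t)$-stopping times $\eta$ (for $T=\infty$ also at $\infty$ with $\mathcal F_{\infty-}=\sigma(\cup_t\mathcal F_t)$). For $(\mathcal G_t)\subseteq(\mathcal F_t)$: $\mathcal A^\circ(\mathcal G_t)$ = $(\mathcal G_t)$-adapted processes $\rho$ with, for all $\omega$, $t\mapsto\rho_t(\omega)$ càdlàg non-decreasing, $\rho_{0-}=0$, $\rho_T=1$; $\mathcal A^\circ_{ac}(\mathcal G_t)$ = those $\rho\in\mathcal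 A^\circ(\mathcal G_t)$ with $t\mapsto\rho_t(\omega)$ absolutely continuous on $[0,T)$ for all $\omega$ (a jump at $T$ is allowed). Let $\mathcal S=L^2([0,T]\times\Omega,\mathcal B([0,T])\otimes\mathcal F,\lambda\times\mathbb P)$, $\lambda$ Lebesgue measure. $\mathcal A(\mathcal G_t)$ (resp. $\mathcal A_{ac}(\mathcal G_t)$) is the set of $\rho\in\mathcal S$ equal $(\lambda\times\mathbb P)$-a.e. to some $\hat\rho\in\mathcal A^\circ(\mathcal G_t)$ (resp. $\mathcal A^\circ_{ac}(\mathcal G_t)$), called a càdlàg representative; Lebesgue–Stieltjes integrals with respect to elements of $\mathcal A(\cdot)$ (and expressions involving $\rho_t,\rho_{t-},\Delta\rho_t=\rho_t-\rho_{t-}$) are defined via any càdlàg representative (well defined up to indistinguishability). For $\xi\in\mathcal A(\mathcal F^1_t)$, $\zeta\in\mathcal A(\mathcal F^2_t)$, $$N(\xi,\zeta)=\mathbb E\Big[\int_{[0,T)}f_t(1-\zeta_t)d\xi_t+\int_{[0,T)}g_t(1-\xi_t)d\zeta_t+\sum_{t\in[0,T]}h_t\Delta\xi_t\Delta\zeta_t\Big].$$ Assumptions: (A1) $f,g\in\mathcal L_b$; (A2) $f,g$ are $(\mathcal F_t)$-adapted regular; (A3) $f_t\ge h_t\ge g_t$ for all $t$ a.s.; (A4) $h$ $(\mathcal F_t)$-adapted measurable; (A5) $(\mathcal F_t),(\mathcal F^i_t)$ right-continuous and $\mathcal F^i_0$ contain all $\mathbb P$-null sets. *)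

(* Defs.v *)
(* Time is indexed by extended reals
   t : \bar R with 0 <= t <= T, T : \bar R, 0 < T (T = +oo allowed). *)
From HB Require Import structures.
From mathcomp Require Import all_boot all_order all_algebra.
From mathcomp Require Import all_classical all_reals all_analysis.
From mathcomp Require Import measurable_realfun.
Set Implicit Arguments.
Unset Strict Implicit.
Unset Printing Implicit Defensive.
Import Order.TTheory GRing.Theory Num.Theory.
Import numFieldNormedType.Exports.
Local Open Scope classical_set_scope.
Local Open Scope ring_scope.

Section Defs.
Context {R : realType} {d : measure_display} {Omega : measurableType d}.
Implicit Types (T : \bar R) (F G : \bar R -> set (set Omega)).

(* the time set [0,T] (contains +oo when T = +oo) *)
Definition time T : set (\bar R) := [set t | (0 <= t <= T)%E].

Definition is_filtration T F :=
  [/\ forall t, time T t -> sigma_algebra setT (F t),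
      forall t, time T t -> F t `<=` measurable &
      forall s t, time T s -> time T t -> (s <= t)%E -> F s `<=` F t].

Definition right_continuous_filtration T F :=
  forall t, time T t -> (t < T)%E ->
    F t = \bigcap_(s in [set s | (t < s <= T)%E]) F s.

Definition G_measurable (G : set (set Omega)) (Y : Omega -> R) :=
  forall B : set R, measurable B -> G (Y @^-1` B).

Definition adapted T F (X : \bar R -> Omega -> R) :=
  forall t, time T t -> G_measurable (F t) (X t).

Definition jointly_measurable T (X : \bar R -> Omega -> R) :=
  measurable_fun (time T `*` [set: Omega]) (fun p : \bar R * Omega => X p.1 p.2).

Definition cadlag T (x : \bar R -> R) :=
  (forall t, time T t -> (t < T)%E ->
     x @ within [set s | (t < s)%E] (nbhs t) --> x t) /\
  (forall t, time T t -> (0 < t)%E ->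
     exists l : R, x @ within [set s | (s < t)%E] (nbhs t) --> l).

Definition leftlim (x : \bar R -> R) (t : \bar R) : R :=
  if t == 0%E then x 0%E else lim (x @ within [set s | (s < t)%E] (nbhs t)).

Definition Lb (P : probability Omega R) T (X : \bar R -> Omega -> R) :=
  [/\ jointly_measurable T X,
      forall w, cadlag T (fun t => X t w) &
      P.-integrable setT (fun w => ereal_sup [set (`|X t w|)%:E | t in time T])].

Definition stopping_time T F (tau : Omega -> \bar R) :=
  (forall w, time T (tau w)) /\
  (forall t, time T t -> F t [set w | (tau w <= t)%E]).

Definition predictable_time T F (eta : Omega -> \bar R) :=
  stopping_time T F eta /\
  exists etan : nat -> Omega -> \bar R,
    (forall n, stopping_time T F (etan n)) /\
    forall w, [/\ {homo (fun n => etan n w) : m n / (m <= n)%N >-> (m <= n)%E},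
                  (fun n => etan n w) @ \oo --> eta w &
                  (0 < eta w)%E -> forall n, (etan n w < eta w)%E].

Definition F_minus T F (eta : Omega -> \bar R) : set (set Omega) :=
  <<s [set A | F 0%E A \/
        exists t, time T t /\ exists B, F t B /\ A = B `&` [set w | (t < eta w)%E]] >>.

(* E[Y | G] = 0 a.s., written out for integrable Y *)
Definition condexp_zero (P : probability Omega R) (G : set (set Omega))
    (Y : Omega -> R) :=
  forall A, G A -> (\int[P]_(w in A) (Y w)%:E)%E = 0%E.

Definition regular (P : probability Omega R) T F (X : \bar R -> Omega -> R) :=
  forall eta, predictable_time T F eta ->
    condexp_zero P (F_minus T F eta)
      (fun w => X (eta w) w - leftlim (fun t => X t w) (eta w)).

Definition nondecreasing_on T (x : \bar R -> R) :=
  forall s t, time T s -> time T t -> (s <= t)%E -> x s <= x t.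

Definition A_circ T G (rho : \bar R -> Omega -> R) :=
  adapted T G rho /\
  forall w, [/\ cadlag T (fun t => rho t w), nondecreasing_on T (fun t => rho t w),
                0 <= rho 0%E w & rho T w = 1].

Definition abs_continuous_on (a b : R) (x : R -> R) :=
  forall e : R, 0 < e -> exists2 delta : R, 0 < delta &
    forall (n : nat) (u v : nat -> R),
      (forall k, (k < n)%N -> a <= u k /\ u k <= v k /\ v k <= b) ->
      (forall k, (k.+1 < n)%N -> v k <= u k.+1) ->
      \sum_(k < n) (v k - u k) < delta ->
      \sum_(k < n) `|x (v k) - x (u k)| < e.

Definition A_circ_ac T G (rho : \bar R -> Omega -> R) :=
  A_circ T G rho /\
  forall w (s : R), 0 <= s -> (s%:E < T)%E ->
    abs_continuous_on 0 s (fun r => rho r%:E w).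

Definition cum_path T (x : \bar R -> R) : R -> R :=
  fun r => if r < 0 then 0 else if (r%:E <= T)%E then x r%:E else x T.

Definition cum_of (F : R -> R) : cumulative R R :=
  match pselect (nondecreasing F /\ right_continuous F) with
  | left H => HB.pack_for (cumulative R R) F
      (isCumulative.Build R _ R F (proj1 H) (proj2 H))
  | right _ => idfun
  end.

Definition LS_integral T (x : \bar R -> R) (phi : R -> R) : \bar R :=
  (\int[lebesgue_stieltjes_measure (cum_of (cum_path T x))]_(r in
     [set r : R | (0 <= r)%R /\ (r%:E < T)%E]) (phi r)%:E)%E.

Definition jump (x : \bar R -> R) (t : \bar R) : R :=
  x t - (if t == 0%E then 0 else leftlim x t).

(* sum over t in [0,T] of a (absolutely summable) family *)
Definition time_sum T (a : \bar R -> R) : \bar R :=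
  (esum (time T) (fun t => (Num.max (a t) 0)%:E) -
   esum (time T) (fun t => (Num.max (- a t) 0)%:E))%E.

Definition payoff (P : probability Omega R) T (f g h : \bar R -> Omega -> R)
    (xi zeta : \bar R -> Omega -> R) : \bar R :=
  (\int[P]_w
     (LS_integral T (fun t => xi t w) (fun r => (f r%:E w * (1 - zeta r%:E w))%R) +
      LS_integral T (fun t => zeta t w) (fun r => (g r%:E w * (1 - xi r%:E w))%R) +
      time_sum T (fun t => (h t w * jump (fun s => xi s w) t
                                 * jump (fun s => zeta s w) t)%R)))%E.

End Defs.

(* Main.v *)
(** Replacing the jump of [xi] at 0 by a steep ramp changes the payoff, in the
    limit, by [(g_0 - h_0) xi_0 zeta_0 <= 0], so the minimiser may be
    restricted to strategies with [xi_0 = 0]. For such [xi] the payoff [N xi]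
    is affine and upper semicontinuous on the convex set of strategies [zeta].
    The [zeta] that keep finitely many of the [N xi] above [W_upper - e] form
    a nonempty set, by a finite minimax argument, and near-minimisers of a
    Hilbert norm in these sets form a Cauchy sequence that approaches every
    one of them; its limit is the optimal [zeta].

    For upper semicontinuity, a Lebesgue-Stieltjes integral against [zeta] is
    the mean over a uniform [u] of the integrand at the randomised stopping
    time [inf {t | u <= zeta_t}]. For almost every [u] these stopping times
    converge almost surely along the sequence, and since [g] is regular the
    expectation of [g (1 - xi)] at them converges as well: on the predictable
    event that the limit is approached strictly from the left, the jump of [g]
    has conditional mean zero. At [T] only the sign of [h - g] is available,
    which gives semicontinuity instead of continuity. *)
Require Import Defs.
From HB Require Import structures.
From mathcomp Require Import all_boot all_order all_algebra.
From mathcomp Require Import all_classical all_reals all_analysis.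
From mathcomp Require Import measurable_realfun.
From mathcomp Require Import ring lra.
Set Implicit Arguments.
Unset Strict Implicit.
Unset Printing Implicit Defensive.
Import Order.TTheory GRing.Theory Num.Theory.
Import numFieldNormedType.Exports.
Local Open Scope classical_set_scope.
Local Open Scope ring_scope.

(** * One-sided limits and increasing paths *)

Section Paths.
Context {R : realType}.
Implicit Types (T t s : \bar R) (x : \bar R -> R).

(** The obstacle is compactness: a minimax theorem wants the strategies [zeta] to be compact in a
    topology that makes the payoff upper semicontinuous. Here the Hilbert norm only selects a
    sequence, with distances [16^-n] small enough for almost sure convergence at all rational times;
    the limit is then taken path by path, as for distribution functions. Semicontinuity is asked in
    [zeta] only, hence the optimal strategy on that side. Jumps decide the rest. Absolute continuity
    of [xi] leaves 0 and [T] as the only times of common jumps. Mass of [zeta] that arrives at [T]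
    in the limit exchanges [g_T] for [h_T >= g_T] against the jump of [xi], which raises the payoff.
    Mass that arrives at 0 replaces [f_0 xi_0] by [h_0 xi_0 <= f_0 xi_0], so semicontinuity fails
    when [xi] jumps at 0; the ramp avoids this case. The two integrals need opposite orders of
    exceptional sets. Against [xi] the convergence holds for almost every path, and on it for almost
    every level. Against [zeta] the level is fixed first, since regularity is a statement about
    means. *)

Lemma nbhs_rightP t (P : set (\bar R)) : (0 <= t)%E -> (t < +oo)%E ->
  within [set s | (t < s)%E] (nbhs t) P <->
  exists2 s0, (t < s0)%E & forall s, (t < s)%E -> (s < s0)%E -> P s.
Proof.
case: t => [r r0 _|//|//]; split.
- move=> H; have {H} : nbhs r (fun y : R => (r%:E < y%:E)%E -> P y%:E) by exact: H.
  move=> /nbhs_ballP[e /= e0 He]; exists (r + e)%:E; first by rewrite lte_fin ltrDl.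
  case=> [s|//|//]; rewrite !lte_fin => rs se.
  apply: (He s) => //; rewrite -ball_normE/= ltr0_norm ?subr_lt0// opprB ltrBlDl//.
- move=> [s0 rs0 H]; have := open_ereal_lt' rs0; apply: filterS => s ss0 /= rs.
  exact: H.
Qed.

Lemma nbhs_leftP t (P : set (\bar R)) : (0 < t)%E ->
  within [set s | (s < t)%E] (nbhs t) P <->
  exists2 s0, (0 <= s0 < t)%E & forall s, (s0 < s)%E -> (s < t)%E -> P s.
Proof.
case: t => [r r0|_|//]; split.
- move=> H; have {H} : nbhs r (fun y : R => (y%:E < r%:E)%E -> P y%:E) by exact: H.
  move=> /nbhs_ballP[e /= e0 He]; exists (Num.max 0 (r - e))%:E.
    by rewrite !lee_fin !lte_fin le_max lexx/= gt_max -lte_fin r0 ltrBlDr ltrDl.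
  case=> [s|//|//]; rewrite !lte_fin gt_max => /andP[s0 se] sr.
  apply: (He s) => //; rewrite -ball_normE/= gtr0_norm ?subr_gt0// ltrBlDl -ltrBlDr//.
- move=> [s0 /andP[s00 rs0] H]; have := open_ereal_gt' rs0; apply: filterS => s ss0 /= rs.
  exact: H.
- move=> /= [M [_ HM]]; exists (Num.max 0 M)%:E.
    by rewrite lee_fin le_max lexx/= ltry.
  case=> [s||]; rewrite ?ltxx//; rewrite lte_fin gt_max => /andP[s0 sM] _.
  by apply: HM => /=; rewrite ?lte_fin ?ltry.
- move=> [s0 /andP[s00 rs0] H]; have := open_ereal_gt' rs0; apply: filterS => s ss0 /= rs.
  exact: H.
Qed.

Lemma cvg_rightP t x l : (0 <= t)%E -> (t < +oo)%E ->
  x @ within [set s | (t < s)%E] (nbhs t) --> l <->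
  forall e, 0 < e -> exists2 s0, (t < s0)%E &
    forall s, (t < s)%E -> (s < s0)%E -> `|x s - l| < e.
Proof.
move=> t0 tT; split.
- move=> /cvgrPdist_lt H e /H /nbhs_rightP -/(_ t0 tT)[s0 ts0 Hs]; exists s0 => // s ts ss0.
  by rewrite distrC; exact: Hs.
- move=> H; apply/cvgrPdist_lt => e /H[s0 ts0 Hs]; apply/nbhs_rightP => //; exists s0 => // s ts ss0.
  by rewrite distrC; exact: Hs.
Qed.

Lemma cvg_leftP t x l : (0 < t)%E ->
  x @ within [set s | (s < t)%E] (nbhs t) --> l <->
  forall e, 0 < e -> exists2 s0, (0 <= s0 < t)%E &
    forall s, (s0 < s)%E -> (s < t)%E -> `|x s - l| < e.
Proof.
move=> t0; split.
- move=> /cvgrPdist_lt H e /H /nbhs_leftP -/(_ t0)[s0 ts0 Hs]; exists s0 => // s ts ss0.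
  by rewrite distrC; exact: Hs.
- move=> H; apply/cvgrPdist_lt => e /H[s0 ts0 Hs]; apply/nbhs_leftP => //; exists s0 => // s ts ss0.
  by rewrite distrC; exact: Hs.
Qed.

Lemma within_left_proper t : (0 < t)%E ->
  ProperFilter (within [set s | (s < t)%E] (nbhs t)).
Proof.
move=> t0; apply: Build_ProperFilter_ex => P /nbhs_leftP -/(_ t0)[s0 /andP[_ s0t] H].
have [s /andP[]] : exists s, (s0 < s < t)%E; last by exists s; exact: H.
move: s0t; case: s0 {H} => [a| |]; case: t t0 => [b| |] //.
- by move=> _; rewrite lte_fin => ab; exists ((a + b)/2)%:E; rewrite !lte_fin !midf_lt.
- by move=> _ _; exists (a+1)%:E; rewrite lte_fin ltrDl ltr01 ltry.
- by move=> _ _; exists (b-1)%:E; rewrite lte_fin ltrBlDl ltrDr ltr01 ltNyr.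
- by move=> _ _; exists 0%E; rewrite ltNyr ltry.
Qed.

Lemma leftlim_cvg T x t : cadlag T x -> time T t -> (0 < t)%E ->
  x @ within [set s | (s < t)%E] (nbhs t) --> leftlim x t.
Proof.
move=> [_ H] Tt t0; have [l xl] := H _ Tt t0.
have ? := within_left_proper t0.
by rewrite /leftlim gt_eqF// (cvg_lim _ xl).
Qed.

Lemma leftlim_eq x t l : (0 < t)%E ->
  x @ within [set s | (s < t)%E] (nbhs t) --> l -> leftlim x t = l.
Proof.
move=> t0 xl; have ? := within_left_proper t0.
by rewrite /leftlim gt_eqF// (cvg_lim _ xl).
Qed.

Lemma lte_dense s t : (s < t)%E -> (0 <= s)%E ->
  exists2 r : R, (s < r%:E)%E & (r%:E < t)%E.
Proof.
case: s => [a| |] //; case: t => [b| |] //.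
- by rewrite lte_fin => ab _; exists ((a + b)/2); rewrite !lte_fin !midf_lt.
- by move=> _ _; exists (a+1); rewrite ?lte_fin ?ltrDl ?ltr01 ?ltry.
Qed.

End Paths.

Section IPath.
Context {R : realType}.
Implicit Types (T t s : \bar R) (x : \bar R -> R).

Definition ipath T x :=
  [/\ cadlag T x, nondecreasing_on T x, 0 <= x 0%E & x T = 1].

(** Admitting [T] unconditionally caps the generalised inverse, so it is a time in [[0,T]] for every
    real [u], even above 1. *)
Definition quantile T x (u : R) : \bar R :=
  ereal_inf [set t | time T t /\ (u <= x t \/ t = T)].

Lemma time0 T : (0 < T)%E -> time T 0%E.
Proof. by move=> T0; rewrite /time/= lexx ltW. Qed.

Lemma timeT T : (0 < T)%E -> time T T.
Proof. by move=> T0; rewrite /time/= lexx ltW. Qed.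

Lemma time_le T s t : time T t -> (0 <= s)%E -> (s <= t)%E -> time T s.
Proof. by rewrite /time/= => /andP[_ tT] -> /= /le_trans; apply. Qed.

Lemma ipath_ge0 T x t : (0 < T)%E -> ipath T x -> time T t -> 0 <= x t.
Proof.
move=> T0 [_ nd x0 _] Tt; apply: (le_trans x0); apply: nd => //; first exact: time0.
by case/andP: Tt.
Qed.

Lemma ipath_le1 T x t : (0 < T)%E -> ipath T x -> time T t -> x t <= 1.
Proof.
move=> T0 [_ nd _ <-] Tt; apply: nd => //; first exact: timeT.
by case/andP: Tt.
Qed.

(** The infimum is attained by right-continuity: if [x t < u], the path stays below [u] up to [t]
    and on a right neighbourhood of [t]. *)
Lemma quantile_le T x u t : (0 < T)%E -> ipath T x -> time T t ->
  (quantile T x u <= t)%E <-> (u <= x t \/ t = T).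
Proof.
move=> T0 [[rc _] nd x0 x1] Tt; split; last first.
  by move=> H; apply: ereal_inf_lbound.
have /andP[t0 tT] := Tt.
move=> qt; have [->|tneT] := eqVneq t T; first by right.
have {tneT}tT : (t < T)%E by rewrite lt_neqAle tneT.
left; rewrite leNgt; apply/negP => xu.
have t_oo : (t < +oo)%E by rewrite (lt_le_trans tT)// leey.
have e0 : 0 < u - x t by rewrite subr_gt0.
have /(cvg_rightP _ _ t0 t_oo)/(_ _ e0)[s0 ts0 Hs] := rc _ Tt tT.
have /ereal_inf_lt[s [Ts us] ss0] : (quantile T x u < Order.min s0 T)%E.
  by rewrite (le_lt_trans qt)// lt_min ts0.
move: ss0; rewrite lt_min => /andP[ss0 sT].
have {us}us : u <= x s by case: us => // sE; rewrite sE ltxx in sT.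
have [st|ts] := leP s t.
  by have := nd _ _ Ts Tt st; rewrite leNgt (lt_le_trans xu).
have := Hs s ts ss0; rewrite ger0_norm.
  by rewrite ltrD2r ltNge us.
by rewrite subr_ge0 nd// ltW.
Qed.

Lemma quantile_time T x u : (0 < T)%E -> time T (quantile T x u).
Proof.
move=> T0; apply/andP; split.
  by apply: le_ereal_inf_tmp => s [/andP[]].
by apply: ereal_inf_lbound; split; [exact: timeT|right].
Qed.

Lemma quantile_lt T x u t : (0 < T)%E -> ipath T x -> time T t -> (t < T)%E ->
  (t < quantile T x u)%E = (x t < u).
Proof.
move=> T0 px Tt tT; rewrite !ltNge; congr (~~ _); apply/idP/idP.
  by move=> /(quantile_le u T0 px Tt)[//|tE]; rewrite tE ltxx in tT.
by move=> ux; apply/(quantile_le u T0 px Tt); left.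
Qed.

Lemma quantile_leE T x u t : (0 < T)%E -> ipath T x -> time T t -> (t < T)%E ->
  (quantile T x u <= t)%E = (u <= x t).
Proof. by move=> T0 px Tt tT; rewrite !leNgt quantile_lt. Qed.

(** The supremum [c] of the times up to which the path is bounded belongs to the set because of the
    left limit at [c], and right-continuity would push it further if [c < T]. *)
Lemma cadlag_bounded T x : (0 < T)%E -> cadlag T x ->
  exists M, forall t, time T t -> `|x t| <= M.
Proof.
move=> T0 cx; have [rc ll] := cx.
pose S := [set t | time T t /\ exists M, forall s, (0 <= s)%E -> (s <= t)%E -> `|x s| <= M].
have S0 : S 0%E.
  split; first exact: time0.
  by exists `|x 0%E| => s s0 s0'; have -> : s = 0%E by apply/eqP; rewrite eq_le s0' s0.
pose c := ereal_sup S.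
have c0 : (0 <= c)%E by exact: ereal_sup_ubound.
have cT : (c <= T)%E by apply: ge_ereal_sup => s [/andP[]].
have Tc : time T c by rewrite /time/= c0.
have Sc : S c.
  split=> //.
  have [cE|c_neq] := eqVneq c 0%E; first by case: S0 => _; rewrite cE.
  have cgt0 : (0 < c)%E by rewrite lt_def c_neq.
  have [l /(cvg_leftP _ _ cgt0)/(_ 1 ltr01)[s0 /andP[s00 s0c] Hs]] := ll _ Tc cgt0.
  have [t [Tt [M HM]] s0t] := ereal_sup_gt s0c.
  exists (Num.max (Num.max M (`|l| + 1)) `|x c|) => s s_ge0 sc.
  have [st|ts] := leP s t; first by rewrite !le_max HM.
  have [->|sc'] := eqVneq s c; first by rewrite !le_max lexx orbT.
  rewrite !le_max; apply/orP; left; apply/orP; right.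
  have := Hs s (lt_trans s0t ts); rewrite lt_neqAle sc' sc => /(_ isT) H.
  rewrite -(subrK l (x s)) (le_trans (ler_normD _ _))// addrC lerD2l ltW//.
have [Tc'|cT'] := eqVneq c T.
  by case: Sc => _ [M]; rewrite Tc' => HM; exists M => t /andP[? ?]; apply: HM.
have {}cT' : (c < T)%E by rewrite lt_neqAle cT'.
have c_oo : (c < +oo)%E by rewrite (lt_le_trans cT')// leey.
have /(cvg_rightP _ _ c0 c_oo)/(_ _ ltr01)[s0 cs0 Hs] := rc _ Tc cT'.
have [r cr] : exists2 r : R, (c < r%:E)%E & (r%:E < Order.min s0 T)%E.
  by apply: lte_dense => //; rewrite lt_min cs0.
rewrite lt_min => /andP[rs0 rT].
suff /ereal_sup_ubound : S r%:E by rewrite -/c leNgt cr.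
split; first by rewrite /time/= (le_trans c0) ?ltW.
case: Sc => _ [M HM]; exists (Num.max M (`|x c| + 1)) => s s_ge0 sr.
have [sc|cs] := leP s c; first by rewrite le_max HM.
rewrite le_max; apply/orP; right.
have H := Hs s cs (le_lt_trans sr rs0).
by rewrite -(subrK (x c) (x s)) (le_trans (ler_normD _ _))// addrC lerD2l ltW.
Qed.

End IPath.

(** * Lebesgue-Stieltjes integrals as means over quantiles *)

Section Quantile.
Context {R : realType}.
Implicit Types (T t s : \bar R) (x : \bar R -> R).

(** The level [v] may vary with the point: the same statement then covers one fixed level and joint
    measurability in scenario and level. *)
Lemma measurable_quantile d (S : measurableType d) T (x : S -> \bar R -> R) (v : S -> R) :
  (0 < T)%E -> (forall w, ipath T (x w)) ->
  (forall t, time T t -> measurable_fun setT (x ^~ t)) ->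
  measurable_fun setT v -> measurable_fun setT (fun w => quantile T (x w) (v w)).
Proof.
move=> T0 px mx mv.
apply: (measurability _ (ErealGenOInfty.measurableE R)) => //.
move=> _ [_ [r ->] <-]; rewrite setTI.
have [r0|r0] := ltP r 0.
  rewrite (_ : _ @^-1` _ = setT); first exact: measurableT.
  rewrite -subTset => s _ /=; rewrite in_itv/= andbT.
  have /andP[q0 _] := quantile_time (x s) (v s) T0.
  by rewrite (lt_le_trans _ q0).
have [rT|Tr] := ltP r%:E T; last first.
  rewrite (_ : _ @^-1` _ = set0); first exact: measurable0.
  rewrite -subset0 => s /=; rewrite in_itv/= andbT ltNge.
  have /andP[_ qT] := quantile_time (x s) (v s) T0.
  by rewrite (le_trans qT Tr).
have Tr : time T r%:E by rewrite /time/= lee_fin r0 ltW.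
rewrite (_ : _ @^-1` _ = [set w | x w r%:E < v w]).
  rewrite -[X in measurable X]setTI; exact: measurable_fun_ltr (mx _ Tr) mv _ [set true] _.
by apply/seteqP; split => s /=; rewrite in_itv/= andbT quantile_lt.
Qed.

Definition unif01 : set (measurableTypeR R) -> \bar R :=
  mrestr (@lebesgue_measure R) (measurable_itv `]0, 1]).

HB.instance Definition _ := Measure.on unif01.

Lemma unif01_setT : unif01 setT = 1%E.
Proof.
by rewrite /unif01/= /mrestr setTI lebesgue_measure_itv/= lte_fin ltr01 -EFinB subr0.
Qed.

HB.instance Definition _ := @Measure_isProbability.Build _ _ R unif01 unif01_setT.

Lemma unif01_le a : 0 <= a <= 1 -> unif01 [set u | u <= a] = a%:E.
Proof.
move=> /andP[a0 a1]; rewrite /unif01/= /mrestr.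
rewrite (_ : _ `&` _ = `]0, a]%classic); last first.
  apply/seteqP; split => u /=; rewrite !in_itv/=.
    by move=> [-> /andP[->]].
  by move=> /andP[-> ua]; rewrite ua (le_trans ua).
rewrite lebesgue_measure_itv/= lte_fin.
case: ltP => [_|a0']; first by rewrite -EFinB subr0.
by congr EFin; apply/eqP; rewrite eq_le a0 a0'.
Qed.

Lemma unif01_itvoc a b : 0 <= a -> a <= b -> b <= 1 ->
  unif01 [set u | a < u <= b] = (b - a)%:E.
Proof.
move=> a0 ab b1; rewrite /unif01/= /mrestr.
rewrite (_ : _ `&` _ = `]a, b]%classic); last first.
  apply/seteqP; split => u /=; rewrite !in_itv/=; first by case.
  by move=> /andP[au ub]; rewrite au ub (le_trans ub b1) (le_lt_trans a0 au).
rewrite lebesgue_measure_itv/= lte_fin.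
case: ltP => [_|ba]; first by rewrite -EFinB.
have -> : a = b by apply/eqP; rewrite eq_le ab ba.
by rewrite subrr.
Qed.

Lemma unif01_countable (A : set R) : countable A -> unif01 A = 0%E.
Proof.
move=> cA; rewrite /unif01/= /mrestr; apply: countable_lebesgue_measure0.
exact: sub_countable (subset_card_le (@subIsetl _ _ _)) cA.
Qed.

Lemma ae_unif01 (Q : R -> Prop) : (forall u, 0 < u <= 1 -> Q u) -> {ae unif01, forall u, Q u}.
Proof.
move=> H; exists (~` `]0, 1]%classic); split.
- by apply: measurableC; exact (measurable_itv (Interval (BRight 0) (BRight 1))).
- by rewrite /unif01/= /mrestr setICl measure0.
- by move=> u /= nQ u01; apply: nQ; apply: H; rewrite in_itv in u01.
Qed.

Lemma cum_path_nd T x : (0 < T)%E -> ipath T x -> nondecreasing (cum_path T x).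
Proof.
move=> T0 px a b ab; have [_ nd x0 x1] := px; rewrite /cum_path.
case: (ltP b 0) => b0; first by rewrite (le_lt_trans ab b0).
case: (ltP a 0) => a0.
  case: ifP => bT; last by rewrite x1 ler01.
  by apply: ipath_ge0 px _ => //; rewrite /time/= lee_fin b0.
case: (leP b%:E T) => bT.
  have aT : (a%:E <= T)%E by rewrite (le_trans _ bT)// lee_fin.
  by rewrite aT; apply: nd; rewrite /time/= ?lee_fin ?a0 ?b0.
case: ifP => aT //; apply: nd; rewrite ?/time/= ?lee_fin ?a0 ?aT//.
by rewrite lexx ltW.
Qed.

Lemma cum_path_rc T x : (0 < T)%E -> ipath T x -> right_continuous (cum_path T x).
Proof.
move=> T0 px a; have [[rc _] nd x0 x1] := px.
have [a0|a0] := ltP a 0.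
  rewrite [X in _ --> X](_ : _ = 0); last by rewrite /cum_path a0.
  apply: cvg_near_cst; near=> b.
  by rewrite /cum_path ifT//; near: b; apply: nbhs_right_lt.
have [aT|Ta] := ltP a%:E T; last first.
  rewrite [X in _ --> X](_ : _ = x T); last first.
    rewrite /cum_path ltNge a0/=; case: ifP => // aT; congr x.
    by apply/eqP; rewrite eq_le aT Ta.
  apply: cvg_near_cst; near=> b.
  have ab : a < b by near: b; apply: nbhs_right_gt.
  rewrite /cum_path ltNge (le_trans a0 (ltW ab))/= leNgt ifF//.
  by apply/negbF; rewrite (le_lt_trans Ta)// lte_fin.
have Ta : time T a%:E by rewrite /time/= lee_fin a0 ltW.
apply/cvgrPdist_lt => e e0.
have /(cvg_rightP _ _ _ (ltry a))/(_ _ e0)[|s0 as0 Hs] := rc _ Ta aT; first by rewrite lee_fin.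
have [b0 ab0] : exists2 r : R, (a%:E < r%:E)%E & (r%:E < Order.min s0 T)%E.
  by apply: lte_dense; rewrite ?lee_fin// lt_min as0.
rewrite lt_min => /andP[b0s b0T]; rewrite lte_fin in ab0.
near=> b.
have ab : a < b by near: b; apply: nbhs_right_gt.
have bb0 : b < b0 by near: b; apply: nbhs_right_lt.
rewrite /cum_path !ltNge a0 (le_trans a0 (ltW ab))/= (ltW aT).
rewrite (le_trans _ (ltW b0T)) ?lee_fin ?(ltW bb0)//.
rewrite -ltNge distrC; apply: Hs; rewrite ?lte_fin//.
by rewrite (lt_trans _ b0s)// lte_fin.
Unshelve. all: by end_near. Qed.

Lemma cum_ofE (F : R -> R) : nondecreasing F -> right_continuous F ->
  cum_of F = F :> (R -> R).
Proof. by move=> nF rF; rewrite /cum_of; case: pselect => // -[]. Qed.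

Definition dom T : set R := [set r : R | 0 <= r /\ (r%:E < T)%E].

Lemma measurable_dom T : measurable (dom T : set (measurableTypeR R)).
Proof.
case: T => [b| |].
- rewrite (_ : dom _ = `[0, b[%classic).
    exact (measurable_itv (Interval (BLeft 0) (BLeft b))).
  apply/seteqP; split => r; rewrite /dom/= in_itv/= lte_fin; first by case=> -> ->.
  by move=> /andP[-> ->].
- rewrite (_ : dom _ = `[0, +oo[%classic).
    exact (measurable_itv (Interval (BLeft 0) (BInfty _ false))).
  by apply/seteqP; split => r; rewrite /dom/= in_itv/= andbT ltry; first by case.
- rewrite (_ : dom _ = set0); first exact: measurable0.
  by rewrite -subset0 => r; rewrite /dom/= => -[].
Qed.

Let qmap T x u : R := if quantile T x u == +oo%E then -1 else fine (quantile T x u).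

Let measurable_qmap T x : (0 < T)%E -> ipath T x ->
  measurable_fun (setT : set (measurableTypeR R)) (qmap T x : _ -> measurableTypeR R).
Proof.
move=> T0 px.
have mq : measurable_fun (setT : set (measurableTypeR R)) (fun u : R => quantile T x u).
  by apply: (measurable_quantile (S := measurableTypeR R)) => //; exact: measurable_id.
apply: measurable_fun_ifT => //.
- apply: (measurable_fun_bool true).
  rewrite setTI (_ : _ @^-1` _ = (fun u : R => quantile T x u) @^-1` [set +oo%E]).
    by rewrite -[X in measurable X]setTI; apply: mq.
  by apply/seteqP; split => u /= /eqP.
- exact: measurableT_comp.
Qed.

(** The Galois connection behind inverse sampling. The conjunct [0 <= qmap T x u] discards the value
    that stands for an infinite quantile. *)
Lemma quantile_cum_path T x u r : (0 < T)%E -> ipath T x -> 0 < u <= 1 ->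
  (0 <= qmap T x u <= r) = (u <= cum_path T x r).
Proof.
move=> T0 px /andP[u0 u1]; rewrite /qmap /cum_path.
have /andP[q0 qT] := quantile_time x u T0.
have [r0|r0] := ltP r 0.
  rewrite [RHS]leNgt u0/=; apply/negbTE/negP => /andP[q_ge0 qr].
  by have := le_lt_trans (le_trans q_ge0 qr) r0; rewrite ltxx.
have x1 : x T = 1 by case: px.
have [qE|qE] := eqVneq (quantile T x u) +oo%E.
  have TE : T = +oo%E by apply/eqP; rewrite -leye_eq -qE.
  have Tr : time T r%:E by rewrite /time/= lee_fin r0 TE leey.
  rewrite TE leey; transitivity false; first by rewrite ler0N1.
  apply/esym/negbTE; rewrite -ltNge -(quantile_lt u T0 px)// ?qE ?TE ?ltry//.
have qfin : quantile T x u \is a fin_num.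
  by rewrite ge0_fin_numE// lt_neqAle qE leey.
rewrite fine_ge0//= -lee_fin fineK//.
have [rT|Tr] := leP r%:E T; last by rewrite x1 u1 (le_trans qT)// ltW.
have Tr : time T r%:E by rewrite /time/= lee_fin r0.
apply/idP/idP => [/(quantile_le u T0 px Tr)[//|->]|]; first by rewrite x1.
by move=> ux; apply/(quantile_le u T0 px Tr); left.
Qed.

Definition quant_fun T x (phi : R -> R) (u : R) : R :=
  if (quantile T x u < T)%E then phi (fine (quantile T x u)) else 0.

(* The law of the quantile of a uniform variable is the Lebesgue-Stieltjes
   measure; the (possibly infinite) value [T] is sent to [-1] or [T], outside
   the domain of integration. *)
Lemma LS_integralE T x (phi : R -> R) C : (0 < T)%E -> ipath T x ->
  measurable_fun (dom T) phi -> (forall r, dom T r -> `|phi r| <= C) ->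
  LS_integral T x phi = (\int[unif01]_u (quant_fun T x phi u)%:E)%E.
Proof.
move=> T0 px mphi bphi.
have C0 : 0 <= C by apply: le_trans (bphi 0 _); rewrite ?normr_ge0//; split.
pose X : {RV unif01 >-> measurableTypeR R} :=
  MeasurableFun.Pack (MeasurableFun.Class (isMeasurableFun.Build _ _ _ _ _ (measurable_qmap T0 px))).
(* Half-open intervals determine the measure. Restricting the law to nonnegative reals removes its
   mass at [-1], which the Stieltjes measure does not charge. *)
have LSE A : measurable A -> lebesgue_stieltjes_measure (cum_of (cum_path T x)) A =
    mrestr (distribution unif01 X) (measurable_itv `[0, +oo[) A.
  apply: lebesgue_stieltjes_measure_unique => _ [[a b] _ <-]/=.
  rewrite /lebesgue_stieltjes_measure/= /measure_extension measurable_mu_extE//; last by exists (a, b).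
  have cE := cum_ofE (cum_path_nd T0 px) (cum_path_rc T0 px).
  have [ab|ba] := leP a b; last first.
    by rewrite set_itv_ge ?bnd_simp ?ltNge ?(ltW ba)// /mrestr set0I !measure0.
  transitivity (cum_path T x b - cum_path T x a)%:E.
    have H := wlength_itv_bnd (cum_of (cum_path T x)) false false ab.
    by rewrite [in RHS]cE in H; exact: H.
  rewrite /mrestr /distribution/= /pushforward.
  have ge0 r : 0 <= cum_path T x r.
    have [r0|r0] := ltP r 0; first by rewrite /cum_path r0.
    rewrite /cum_path ltNge r0/=; case: ifP => rT; last by have [_ _ _ ->] := px.
    by rewrite (ipath_ge0 T0 px)// /time/= lee_fin r0.
  have le1 r : cum_path T x r <= 1.
    have [r0|r0] := ltP r 0; first by rewrite /cum_path r0.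
    rewrite /cum_path ltNge r0/=; case: ifP => rT; last by have [_ _ _ ->] := px.
    by rewrite (ipath_le1 T0 px)// /time/= lee_fin r0.
  rewrite -unif01_itvoc ?ge0 ?le1 ?cum_path_nd//.
  rewrite /unif01/= /mrestr; congr lebesgue_measure.
  apply/seteqP; split => u /=; rewrite !in_itv/= andbT => -[H u01]; split => //.
  - move: H => /andP[aX Xb]; move: Xb aX; rewrite -quantile_cum_path// => /andP[q0 qb] aX.
    split => //; rewrite qb andbT ltNge; apply/negP => qa; move: aX.
    by rewrite ltNge -quantile_cum_path// q0 qa.
  - case: H => /andP[aq qb] q0.
    have [{}aq {}qb {}q0] : [/\ a < qmap T x u, qmap T x u <= b & 0 <= qmap T x u] by [].
    rewrite -quantile_cum_path// q0 qb.
    by rewrite ltNge -quantile_cum_path// q0/= andbT -ltNge.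
rewrite /LS_integral -/(dom T).
rewrite (eq_measure_integral (distribution unif01 X)); last first.
  move=> A mA AD; have := LSE A mA; rewrite /mrestr setIidl; first exact.
  by move=> r /AD[r0 _] /=; rewrite in_itv/= r0.
rewrite integral_mkcond integral_distribution.
- apply: eq_integral => u _; rewrite /quant_fun /= /qmap patchE.
  have /andP[q0 qT] := quantile_time x u T0.
  case: (ltP (quantile T x u) T) => qT'.
    have qfin : quantile T x u \is a fin_num.
      by rewrite ge0_fin_numE// (lt_le_trans qT')// leey.
    have -> : (quantile T x u == +oo%E) = false by move: qfin; case: (quantile T x u).
    by rewrite mem_set//; split; rewrite ?fine_ge0// fineK.
  rewrite memNset// => -[]; case: eqP => [_|/eqP qE]; first by rewrite ler0N1.
  have qfin : quantile T x u \is a fin_num.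
    by rewrite ge0_fin_numE// lt_neqAle qE leey.
  by rewrite fineK// ltNge qT' => -[].
- apply/(measurable_restrictT _ (measurable_dom T)).
  exact/measurable_EFinP.
- apply: (@le_integrable _ _ _ _ _ _ _ (cst C%:E)) => //.
  + apply: measurableT_comp; last exact: measurable_qmap.
    by apply/(measurable_restrictT _ (measurable_dom T)); exact/measurable_EFinP.
  + move=> u _ /=; rewrite patchE; case: ifPn => [/set_mem Du|_].
      by rewrite /= lee_fin (le_trans (bphi _ Du))// ler_norm.
    by rewrite abse0 lee_fin normr_ge0.
  + by apply: finite_measure_integrable_cst.
Qed.

End Quantile.

HB.lock Definition LSI {R : realType} (T : \bar R) (x : \bar R -> R) (phi : R -> R) : R :=
  fine (LS_integral T x phi).

Lemma integrable_prod_dominated {R : realType} d (Omega : measurableType d)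
  (P : probability Omega R) (Psi : Omega * measurableTypeR R -> R) (M : Omega -> R) :
  measurable_fun setT Psi -> P.-integrable setT (EFin \o M) ->
  (forall w u, `|Psi (w, u)| <= M w) -> (P \x (unif01 : measure (measurableTypeR R) R))%E.-integrable setT (EFin \o Psi).
Proof.
move=> mPsi iM PsiM.
have mq : measurable_fun setT (EFin \o Psi) by exact/measurable_EFinP.
have [mM _] := integrableP _ _ _ iM.
apply/(@integrable12ltyP _ _ _ _ R P unif01 _ mq).
apply: (le_lt_trans _ (integrableP _ _ _ iM).2).
apply: ge0_le_integral => //.
- by move=> w _; apply: integral_ge0.
- apply: (measurable_fun_fubini_tonelli_F (m2 := unif01) (fun p => `|(Psi p)%:E|%E)) => //.
  exact: measurableT_comp.
- exact: measurableT_comp.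
- move=> w _ /=.
  apply: (@le_trans _ _ (\int[unif01]_u (cst `|M w|%:E u))%E).
    apply: ge0_le_integral => //.
    + apply/measurable_EFinP; apply: measurableT_comp => //.
      exact: (measurableT_comp mPsi (measurable_pair1 w)).
    + by move=> u _ /=; rewrite lee_fin (le_trans (PsiM w u))// ler_norm.
  by rewrite integral_cst//= unif01_setT mule1.
Qed.

(** * Payoff integrals as random variables *)

Section Processes.
Context {R : realType} {d : measure_display} {Omega : measurableType d}.
Implicit Types (T t : \bar R) (x Y : \bar R -> Omega -> R) (M : Omega -> R).

(** Paths and time slices only: adaptedness matters later, when quantiles must be stopping times. *)
Definition rproc T x := (forall w, ipath T (x^~ w)) /\
  (forall t, time T t -> measurable_fun setT (x t)).

Definition bproc T Y M := jointly_measurable T Y /\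
  (forall t w, time T t -> `|Y t w| <= M w).

Lemma measurable_time T : measurable (time T : set (\bar R)).
Proof.
rewrite (_ : time T = `[0%E, T]%classic); first exact: emeasurable_itv.
by apply/seteqP; split => t; rewrite /time/= in_itv.
Qed.

Lemma measurable_quantile_proc T x : (0 < T)%E -> rproc T x ->
  measurable_fun setT (fun p : Omega * measurableTypeR R => quantile T (x^~ p.1) p.2).
Proof.
move=> T0 [px mx].
apply: (measurable_quantile (S := (Omega * measurableTypeR R)%type)
  (x := fun p => x^~ p.1) (v := snd)) => //.
by move=> t Tt; apply: measurableT_comp (mx t Tt) _.
Qed.

Lemma measurable_quantile_fix T x (u : R) : (0 < T)%E -> rproc T x ->
  measurable_fun setT (fun w => quantile T (x^~ w) u).
Proof. by move=> T0 [px mx]; apply: measurable_quantile. Qed.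

(** Before [T] the event [x t w < u] is [t < quantile T (x^~ w) u], a comparison of two measurable
    functions of [(t, w)]; this turns slice measurability into joint measurability. *)
Lemma rproc_jm T x : (0 < T)%E -> rproc T x -> jointly_measurable T x.
Proof.
move=> T0 rx; have [px mx] := rx.
rewrite /jointly_measurable => mD.
apply: (measurability _ (RGenInftyO.measurableE R)) => //.
move=> _ [_ [u ->] <-].
have mlt : measurable [set p : \bar R * Omega | (p.1 < quantile T (x^~ p.2) u)%E].
  rewrite -[X in measurable X]setTI.
  apply: measurable_lte => //.
  exact: measurableT_comp (measurable_quantile_fix u T0 rx) _.
rewrite (_ : _ `&` _ = (time T `*` setT) `&`
  (([set p : \bar R * Omega | (p.1 < quantile T (x^~ p.2) u)%E] `&` [set p | (p.1 < T)%E])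
   `|` ([set p | p.1 = T] `&` [set p | 1 < u]))).
  apply: measurableI => //; apply: measurableU; apply: measurableI => //.
  - by rewrite -[X in measurable X]setTI; apply: measurable_lte.
  - rewrite -[X in measurable X]setTI.
    exact: (measurable_eqe measurableT measurable_fst (measurable_cst T)).
  - by case: (ltP 1 u) => u1; [rewrite (_ : [set _ | _] = setT)|rewrite (_ : [set _ | _] = set0)];
      rewrite // ?u1; apply/seteqP; split.
apply/seteqP; split => -[t w] /= [[Tt _]]; rewrite in_itv/=.
- move=> xu; split => //; have [tT|tT] := ltP t T.
    by left; rewrite quantile_lt.
  have tE : t = T by apply/eqP; rewrite eq_le tT; case/andP: Tt => _ ->.
  by right; split => //; move: xu; rewrite tE; have [_ _ _ ->] := px w.
- case=> [[tq tT]|[tE u1]]; split => //.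
    by rewrite -(quantile_lt u T0 (px w)).
  by rewrite tE; have [_ _ _ ->] := px w.
Qed.

Lemma jm_comp d' (S : measurableType d') T Y (tau : S -> \bar R) (v : S -> Omega) :
  jointly_measurable T Y -> measurable_fun setT tau -> (forall s, time T (tau s)) ->
  measurable_fun setT v -> measurable_fun setT (fun s => Y (tau s) (v s)).
Proof.
move=> mY mtau Ttau mv.
apply: (@measurable_comp _ _ _ _ _ _ (time T `*` setT) (fun p => Y p.1 p.2) setT (fun s => (tau s, v s))) => //.
- by apply: measurableX => //; exact: measurable_time.
- by move=> _ [s _ <-]; split=> /=.
- exact: measurable_fun_pair.
Qed.

Lemma jm_fix T Y t : jointly_measurable T Y -> time T t -> measurable_fun setT (Y t).
Proof. by move=> mY Tt; apply: (jm_comp (S := Omega) (tau := cst t) (v := id) mY (measurable_cst t)) => //; exact: measurable_id. Qed.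

Lemma jm_path T Y w : jointly_measurable T Y ->
  measurable_fun (dom T) (fun r => Y r%:E w).
Proof.
move=> mY.
apply: (@measurable_comp _ _ _ _ _ _ (time T `*` setT) (fun p => Y p.1 p.2) _ (fun r => (r%:E, w))) => //.
- by apply: measurableX => //; exact: measurable_time.
- by move=> _ [r [r0 rT] <-]; split => //; rewrite /time/= lee_fin r0 ltW.
- by apply: measurable_funTS; apply: measurable_fun_pair => //; exact: measurable_EFin.
Qed.

Lemma jmM T Y Y' : jointly_measurable T Y -> jointly_measurable T Y' ->
  jointly_measurable T (fun t w => Y t w * Y' t w).
Proof. by move=> mY mY'; apply: measurable_funM. Qed.

Lemma jm1B T Y : jointly_measurable T Y -> jointly_measurable T (fun t w => 1 - Y t w).
Proof. by move=> mY; apply: measurable_funB. Qed.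

Lemma dom_time T r : dom T r -> time T r%:E.
Proof. by move=> [r0 rT]; rewrite /time/= lee_fin r0 ltW. Qed.

Lemma quant_funE T x Y w u : (0 < T)%E ->
  quant_fun T (x^~ w) (fun r => Y r%:E w) u =
  if (quantile T (x^~ w) u < T)%E then Y (quantile T (x^~ w) u) w else 0.
Proof.
move=> T0; rewrite /quant_fun; case: ifPn => // qT; rewrite fineK//.
have /andP[q0 _] := quantile_time (x^~ w) u T0.
by rewrite ge0_fin_numE// (lt_le_trans qT)// leey.
Qed.

Lemma measurable_quant T x Y : (0 < T)%E -> rproc T x -> jointly_measurable T Y ->
  measurable_fun setT (fun p : Omega * measurableTypeR R =>
    quant_fun T (x^~ p.1) (fun r => Y r%:E p.1) p.2).
Proof.
move=> T0 rx mY.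
under eq_fun do rewrite quant_funE//.
apply: measurable_fun_ifT => //.
- by apply: measurable_fun_lte => //; exact: measurable_quantile_proc.
- apply: (jm_comp (T := T) (tau := fun p : Omega * measurableTypeR R => quantile T (x^~ p.1) p.2) (v := fst)) => //.
  + exact: measurable_quantile_proc.
  + by move=> p; exact: quantile_time.
Qed.

Lemma quant_fun_le T x Y M w u : (0 < T)%E -> bproc T Y M ->
  `|quant_fun T (x^~ w) (fun r => Y r%:E w) u| <= M w.
Proof.
move=> T0 [_ bY]; rewrite quant_funE//; have Tq := quantile_time (x^~ w) u T0.
by case: ifP => _; [exact: bY|rewrite normr0; apply: le_trans (bY _ w Tq); rewrite normr_ge0].
Qed.

Lemma LSIE T x Y M w : (0 < T)%E -> rproc T x -> bproc T Y M ->
  LS_integral T (x^~ w) (fun r => Y r%:E w) =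
  (\int[unif01]_u (quant_fun T (x^~ w) (fun r => Y r%:E w) u)%:E)%E.
Proof.
move=> T0 [px mx] [mY bY]; apply: (LS_integralE (C := M w)) => //.
- exact: jm_path.
- by move=> r Dr; apply: bY; exact: dom_time.
Qed.

Lemma measurable_quant_path T x Y w : (0 < T)%E -> rproc T x -> jointly_measurable T Y ->
  measurable_fun setT (fun u : measurableTypeR R => quant_fun T (x^~ w) (fun r => Y r%:E w) u).
Proof.
move=> T0 rx mY.
apply: (measurableT_comp (measurable_quant T0 rx mY) (g := fun u : measurableTypeR R => (w, u))).
exact: measurable_fun_pair.
Qed.

Lemma integrable_quant_path T x Y M w : (0 < T)%E -> rproc T x -> bproc T Y M ->
  unif01.-integrable setT (fun u => (quant_fun T (x^~ w) (fun r => Y r%:E w) u)%:E).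
Proof.
move=> T0 rx bY; apply: (@le_integrable _ _ _ _ _ _ _ (cst (M w)%:E)) => //.
- by apply/measurable_EFinP; apply: measurable_quant_path => //; case: bY.
- move=> u _ /=; rewrite lee_fin (le_trans (quant_fun_le x w u T0 bY))// ler_norm//.
- exact: finite_measure_integrable_cst.
Qed.

Lemma LSI_fin T x Y M w : (0 < T)%E -> rproc T x -> bproc T Y M ->
  LS_integral T (x^~ w) (fun r => Y r%:E w) =
  (LSI T (x^~ w) (fun r => Y r%:E w))%:E.
Proof.
move=> T0 rx bY; rewrite LSI.unlock fineK// (LSIE w T0 rx bY).
exact: integrable_fin_num (integrable_quant_path w T0 rx bY).
Qed.

Lemma LSI_le T x Y M w : (0 < T)%E -> rproc T x -> bproc T Y M ->
  `|LSI T (x^~ w) (fun r => Y r%:E w)| <= M w.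
Proof.
move=> T0 rx bY; rewrite -lee_fin -abse_EFin -(LSI_fin w T0 rx bY) (LSIE w T0 rx bY).
have Hi := integrable_quant_path w T0 rx bY.
apply: (le_trans (le_abse_integral _ _ _)) => //; first exact: measurable_int Hi.
apply: (@le_trans _ _ (\int[unif01]_u (cst (M w)%:E u))%E).
  apply: ge0_le_integral => //.
  - by apply: measurableT_comp => //; exact: measurable_int Hi.
  - by move=> u _ /=; rewrite lee_fin (quant_fun_le x w u T0 bY).
by rewrite integral_cst//= unif01_setT mule1.
Qed.

Variable P : probability Omega R.

Lemma integrable_quant T x Y M : (0 < T)%E -> rproc T x -> bproc T Y M ->
  P.-integrable setT (EFin \o M) ->
  (P \x (unif01 : measure (measurableTypeR R) R))%E.-integrable setT
   (fun p : Omega * measurableTypeR R => (quant_fun T (x^~ p.1) (fun r => Y r%:E p.1) p.2)%:E).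
Proof.
move=> T0 rx bY iM; apply: (integrable_prod_dominated (measurable_quant T0 rx bY.1) iM) => w u.
exact: quant_fun_le.
Qed.

Lemma measurable_LSI T x Y M : (0 < T)%E -> rproc T x -> bproc T Y M ->
  P.-integrable setT (EFin \o M) ->
  measurable_fun setT (fun w => LSI T (x^~ w) (fun r => Y r%:E w)).
Proof.
move=> T0 rx bY iM; apply/measurable_EFinP.
rewrite [X in measurable_fun _ X](_ : _ = fubini_F (unif01 : measure (measurableTypeR R) R)
  (fun p : Omega * measurableTypeR R => (quant_fun T (x^~ p.1) (fun r => Y r%:E p.1) p.2)%:E)).
  by apply: measurable_fubini_F; exact: integrable_quant iM.
by apply/funext => w /=; rewrite -(LSI_fin w T0 rx bY) (LSIE w T0 rx bY).
Qed.

End Processes.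

(** * Affinity of the Stieltjes integral in the integrator *)

Section Affine.
Context {R : realType}.
Implicit Types (T t : \bar R) (x y : \bar R -> R) (a : R).

Definition mix a x y : \bar R -> R := fun t => a * x t + (1 - a) * y t.

Lemma cadlag_mix T a x y : cadlag T x -> cadlag T y -> cadlag T (mix a x y).
Proof.
move=> [rx lx] [ry ly]; split => t Tt tT.
- by apply: cvgD; apply: cvgMr; [exact: rx|exact: ry].
- have [l1 ?] := lx _ Tt tT; have [l2 ?] := ly _ Tt tT.
  by exists (a * l1 + (1 - a) * l2); apply: cvgD; apply: cvgMr.
Qed.

Lemma ipath_mix T a x y : 0 <= a <= 1 -> ipath T x -> ipath T y -> ipath T (mix a x y).
Proof.
move=> /andP[a0 a1] [cx nx x0 x1] [cy ny y0 y1]; split.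
- exact: cadlag_mix.
- move=> s t Ts Tt st; rewrite lerD// ler_wpM2l// ?subr_ge0//; [exact: nx|exact: ny].
- by rewrite addr_ge0// mulr_ge0// subr_ge0.
- by rewrite /mix x1 y1; ring.
Qed.

Lemma jump_mix T a x y t : cadlag T x -> cadlag T y -> time T t ->
  jump (mix a x y) t = a * jump x t + (1 - a) * jump y t.
Proof.
move=> cx cy Tt; rewrite /jump; have [->|t0] := eqVneq t 0%E; first by rewrite /mix; ring.
have t_gt0 : (0 < t)%E by rewrite lt_def t0; case/andP: Tt.
have -> : leftlim (mix a x y) t = a * leftlim x t + (1 - a) * leftlim y t.
  apply: leftlim_eq => //; apply: cvgD; apply: cvgMr.
    exact: leftlim_cvg cx Tt t_gt0.
  exact: leftlim_cvg cy Tt t_gt0.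
by rewrite /mix; ring.
Qed.

Lemma cum_path_mix T a x y : cum_path T (mix a x y) =
  (fun r => a * cum_path T x r + (1 - a) * cum_path T y r).
Proof.
by apply/funext => r; rewrite /cum_path; case: ifP => // _; [ring|case: ifP].
Qed.

Lemma quant_fun_patch T x (phi : R -> R) u : (0 < T)%E ->
  quant_fun T x phi u =
  if (quantile T x u < T)%E then (phi \_ (dom T)) (fine (quantile T x u)) else 0.
Proof.
move=> T0; rewrite /quant_fun; case: ifPn => // qT; rewrite patchE mem_set//.
have /andP[q0 _] := quantile_time x u T0.
split; first exact: fine_ge0.
by rewrite fineK// ge0_fin_numE// (lt_le_trans qT)// leey.
Qed.

Lemma quant_fun_bound T x (phi : R -> R) C u : (0 < T)%E ->
  (forall r, dom T r -> `|phi r| <= C) -> `|quant_fun T x phi u| <= C.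
Proof.
move=> T0 bphi; have C0 : 0 <= C by apply: le_trans (bphi 0 _); rewrite ?normr_ge0//; split.
rewrite quant_fun_patch//; case: ifP; rewrite ?normr0// => _; rewrite patchE.
by case: ifPn => [/set_mem /bphi//|_]; rewrite normr0.
Qed.

Lemma measurable_quant_fun T x (phi : R -> R) : (0 < T)%E -> ipath T x ->
  measurable_fun (dom T) phi ->
  measurable_fun (setT : set (measurableTypeR R)) (quant_fun T x phi).
Proof.
move=> T0 px mphi.
have mq : measurable_fun (setT : set (measurableTypeR R)) (fun u : R => quantile T x u).
  by apply: (measurable_quantile (S := measurableTypeR R)) => //; exact: measurable_id.
rewrite (_ : quant_fun T x phi = fun u => if (quantile T x u < T)%E
  then (phi \_ (dom T)) (fine (quantile T x u)) else 0); last first.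
  by apply/funext => u; exact: quant_fun_patch.
apply: measurable_fun_ifT => //; first exact: measurable_fun_lte.
apply: (measurableT_comp (f := phi \_ (dom T))).
  by apply/(measurable_restrictT _ (measurable_dom T)).
exact: measurableT_comp.
Qed.

Lemma integrable_quant_fun T x (phi : R -> R) C : (0 < T)%E -> ipath T x ->
  measurable_fun (dom T) phi -> (forall r, dom T r -> `|phi r| <= C) ->
  unif01.-integrable setT (EFin \o quant_fun T x phi).
Proof.
move=> T0 px mphi bphi; apply: (@le_integrable _ _ _ _ _ _ _ (cst C%:E)) => //.
- by apply/measurable_EFinP; exact: measurable_quant_fun.
- by move=> u _ /=; rewrite lee_fin (le_trans (quant_fun_bound x u T0 bphi))// ler_norm.
- exact: finite_measure_integrable_cst.
Qed.

Lemma LS_integral_LSI T x (phi : R -> R) C : (0 < T)%E -> ipath T x ->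
  measurable_fun (dom T) phi -> (forall r, dom T r -> `|phi r| <= C) ->
  LS_integral T x phi = (LSI T x phi)%:E.
Proof.
move=> T0 px mphi bphi; rewrite LSI.unlock fineK// (LS_integralE T0 px mphi bphi).
exact: integrable_fin_num (integrable_quant_fun T0 px mphi bphi).
Qed.

Lemma LSID T x (phi psi : R -> R) C D : (0 < T)%E -> ipath T x ->
  measurable_fun (dom T) phi -> (forall r, dom T r -> `|phi r| <= C) ->
  measurable_fun (dom T) psi -> (forall r, dom T r -> `|psi r| <= D) ->
  LSI T x (fun r => phi r + psi r) = LSI T x phi + LSI T x psi.
Proof.
move=> T0 px mphi bphi mpsi bpsi; apply: EFin_inj; rewrite EFinD.
have ms : measurable_fun (dom T) (fun r => phi r + psi r) by exact: measurable_funD.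
have bs r : dom T r -> `|phi r + psi r| <= C + D.
  by move=> Dr; rewrite (le_trans (ler_normD _ _))// lerD// ?bphi ?bpsi.
rewrite -(LS_integral_LSI T0 px mphi bphi) -(LS_integral_LSI T0 px mpsi bpsi) -(LS_integral_LSI T0 px ms bs).
rewrite (LS_integralE T0 px mphi bphi) (LS_integralE T0 px mpsi bpsi) (LS_integralE T0 px ms bs).
rewrite -integralD//; [|exact: integrable_quant_fun bphi|exact: integrable_quant_fun bpsi].
apply: eq_integral => u _; rewrite /quant_fun -EFinD; congr EFin.
by case: ifP => _; rewrite ?addr0.
Qed.

Lemma ge0_integral_mix d (S : measurableType d) (m m1 m2 : {measure set S -> \bar R})
  (a b : R) (D : set S) (phi : S -> \bar R) : 0 <= a -> 0 <= b -> measurable D ->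
  (forall A, measurable A -> m A = (a%:E * m1 A + b%:E * m2 A)%E) ->
  measurable_fun D phi -> (forall r, D r -> (0 <= phi r)%E) ->
  (\int[m]_(r in D) phi r = a%:E * \int[m1]_(r in D) phi r + b%:E * \int[m2]_(r in D) phi r)%E.
Proof.
move=> a0 b0 mD mE mphi phi0.
transitivity (\int[measure_add (mscale (NngNum a0) m1) (mscale (NngNum b0) m2)]_(r in D) phi r)%E.
  by apply: eq_measure_integral => A mA _; rewrite mE//; exact/esym/measure_addE.
by rewrite ge0_integral_measure_add// !ge0_integral_mscale.
Qed.

(** The quantile is not affine in the path, so the representation by a uniform level is of no help
    here. Affinity is proved for the measures themselves, which are compared on half-open
    intervals. *)
Lemma LS_integral_mix_ge0 T a x y (phi : R -> R) : (0 < T)%E -> 0 <= a <= 1 ->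
  ipath T x -> ipath T y -> measurable_fun (dom T) phi -> (forall r, dom T r -> 0 <= phi r) ->
  LS_integral T (mix a x y) phi =
  (a%:E * LS_integral T x phi + (1 - a)%:E * LS_integral T y phi)%E.
Proof.
move=> T0 /andP[a0 a1] px py mphi phi0.
have a1' : 0 <= 1 - a by rewrite subr_ge0.
have pz : ipath T (mix a x y) by apply: ipath_mix => //; rewrite a0.
have cz := cum_ofE (cum_path_nd T0 pz) (cum_path_rc T0 pz).
have cx := cum_ofE (cum_path_nd T0 px) (cum_path_rc T0 px).
have cy := cum_ofE (cum_path_nd T0 py) (cum_path_rc T0 py).
pose mx : {measure set (measurableTypeR R) -> \bar R} := lebesgue_stieltjes_measure (cum_of (cum_path T x)).
pose my : {measure set (measurableTypeR R) -> \bar R} := lebesgue_stieltjes_measure (cum_of (cum_path T y)).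
have LSE A : measurable A -> lebesgue_stieltjes_measure (cum_of (cum_path T (mix a x y))) A =
    (a%:E * mx A + (1 - a)%:E * my A)%E.
  move=> mA; transitivity (measure_add (mscale (NngNum a0) mx) (mscale (NngNum a1') my) A); last first.
    exact: measure_addE.
  move: A mA.
  apply: lebesgue_stieltjes_measure_unique => _ [[u v] _ <-]/=.
  transitivity (mscale (NngNum a0) mx `]u, v]%classic + mscale (NngNum a1') my `]u, v]%classic)%E;
    last by exact/esym/measure_addE.
  rewrite /mscale /= /mx /my /lebesgue_stieltjes_measure/= /measure_extension.
  rewrite !measurable_mu_extE//; try by exists (u, v).
  have [uv|vu] := leP u v; last first.
    by rewrite set_itv_ge ?bnd_simp ?ltNge ?(ltW vu)// !measure0 !mule0 adde0.
  have Hz := wlength_itv_bnd (cum_of (cum_path T (mix a x y))) false false uv.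
  have Hx := wlength_itv_bnd (cum_of (cum_path T x)) false false uv.
  have Hy := wlength_itv_bnd (cum_of (cum_path T y)) false false uv.
  rewrite [in RHS]cz [in RHS]cum_path_mix in Hz; rewrite [in RHS]cx in Hx; rewrite [in RHS]cy in Hy.
  transitivity (wlength (cum_of (cum_path T (mix a x y))) `]u, v]%classic) => //.
  transitivity (a%:E * wlength (cum_of (cum_path T x)) `]u, v]%classic +
    (1 - a)%:E * wlength (cum_of (cum_path T y)) `]u, v]%classic)%E => //.
  rewrite Hx Hy -!EFinM -EFinD.
  transitivity (a * cum_path T x v + (1 - a) * cum_path T y v -
       (a * cum_path T x u + (1 - a) * cum_path T y u))%:E; first exact: Hz.
  by congr EFin; ring.
apply: (ge0_integral_mix a0 a1' (measurable_dom T) LSE).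
- exact/measurable_EFinP.
- by move=> r /phi0; rewrite lee_fin.
Qed.

Lemma LSI_mix T a x y (phi : R -> R) C : (0 < T)%E -> 0 <= a <= 1 ->
  ipath T x -> ipath T y ->
  measurable_fun (dom T) phi -> (forall r, dom T r -> `|phi r| <= C) ->
  LSI T (mix a x y) phi = a * LSI T x phi + (1 - a) * LSI T y phi.
Proof.
move=> T0 a01 px py mphi bphi.
have C0 : 0 <= C by apply: le_trans (bphi 0 _); rewrite ?normr_ge0//; split.
have pz := ipath_mix a01 px py.
(* shifting by a constant reduces to a nonnegative integrand *)
have mC : measurable_fun (dom T) (fun=> C) by exact: measurable_cst.
have bC r : dom T r -> `|C| <= C by rewrite ger0_norm.
have ms : measurable_fun (dom T) (fun r => phi r + C) by exact: measurable_funD.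
have bs r : dom T r -> `|phi r + C| <= C + C.
  by move=> Dr; rewrite (le_trans (ler_normD _ _))// lerD// ?bphi// ger0_norm.
have pos (psi : R -> R) D : measurable_fun (dom T) psi -> (forall r, dom T r -> `|psi r| <= D) ->
    (forall r, dom T r -> 0 <= psi r) ->
    LSI T (mix a x y) psi = a * LSI T x psi + (1 - a) * LSI T y psi.
  move=> mpsi bpsi psi0.
  have E := LS_integral_mix_ge0 T0 a01 px py mpsi psi0.
  rewrite (LS_integral_LSI T0 px mpsi bpsi) (LS_integral_LSI T0 py mpsi bpsi) (LS_integral_LSI T0 pz mpsi bpsi) in E.
  exact: EFin_inj E.
have := pos _ _ ms bs; rewrite (LSID T0 px mphi bphi mC bC) (LSID T0 py mphi bphi mC bC) (LSID T0 pz mphi bphi mC bC).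
rewrite (pos _ _ mC bC)// => H.
apply: (addIr (a * LSI T x (fun=> C) + (1 - a) * LSI T y (fun=> C))).
rewrite H; first by ring.
by move=> r Dr; have := bphi r Dr; rewrite ler_norml => /andP[+ _]; rewrite -subr_ge0 opprK.
Qed.

End Affine.

(** * Left limits of increasing paths, and deterministic times announcing the horizon *)

Section Paths2.
Context {R : realType}.
Implicit Types (T t s : \bar R) (x : \bar R -> R).

(** Deterministic times increasing to [T] from strictly below, for a finite and for an infinite
    horizon; they make [T] itself a predictable time. *)
Definition announce T (k : nat) : \bar R :=
  if T is r%:E then (r * (1 - k.+1%:R^-1))%:E else k%:R%:E.

Lemma announce_lt T k : (0 < T)%E -> (announce T k < T)%E.
Proof.
case: T => [r| |]//= r0; last by rewrite ltry.
by rewrite lte_fin gtr_pMr ?lte_fin// ltrBlDr ltrDl invr_gt0.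
Qed.

Lemma announce_ge0 T k : (0 < T)%E -> (0 <= announce T k)%E.
Proof.
case: T => [r| |]//= r0.
by rewrite lee_fin mulr_ge0 ?subr_ge0 ?invf_le1 ?ltr0n ?ler1n//; rewrite -lee_fin ltW.
Qed.

Lemma announce_time T k : (0 < T)%E -> time T (announce T k).
Proof. by move=> T0; rewrite /time/= announce_ge0// ltW// announce_lt. Qed.

Lemma announce_le T m n : (0 < T)%E -> (m <= n)%N -> (announce T m <= announce T n)%E.
Proof.
case: T => [r| |]//= r0 mn; last by rewrite lee_fin ler_nat.
rewrite lee_fin ler_wpM2l//; first by rewrite -lee_fin ltW.
by rewrite lerD2l lerN2 lef_pV2 ?posrE ?ltr0n// ler_nat ltnS.
Qed.

Lemma announce_gt T s : (0 < T)%E -> (s < T)%E -> \forall k \near \oo, (s < announce T k)%E.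
Proof.
case: T => [r| |]//=.
- rewrite lte_fin => r0; case: s => [s| |]; rewrite ?lte_fin// => sr; last first.
    by apply: nearW => k; rewrite ltNyr.
  near=> k; rewrite lte_fin mulrBr mulr1 ltrBrDr -ltrBrDl ltr_pdivrMr ?ltr0n//.
  rewrite mulrC -ltr_pdivrMr ?subr_gt0//.
  have : r / (r - s) < k%:R by near: k; exact: nbhs_infty_gtr.
  by move=> /lt_trans; apply; rewrite ltr_nat.
- move=> _; case: s => [s| |]// _; last by apply: nearW => k; rewrite ltNyr.
  by near=> k; rewrite lte_fin; near: k; exact: nbhs_infty_gtr.
Unshelve. all: by end_near. Qed.

Lemma cvg_leftlim_seq T x t (s : nat -> \bar R) : cadlag T x -> time T t -> (0 < t)%E ->
  (forall k, (s k < t)%E) -> (forall s0, (s0 < t)%E -> \forall k \near \oo, (s0 < s k)%E) ->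
  (fun k => x (s k)) @ \oo --> leftlim x t.
Proof.
move=> cx Tt t0 st ss; apply/cvgrPdist_lt => e e0.
have /(cvg_leftP _ _ t0)/(_ _ e0)[s0 /andP[_ s0t] Hs] := leftlim_cvg cx Tt t0.
have := ss _ s0t; apply: filterS => k s0k.
by rewrite distrC; exact: Hs.
Qed.

Lemma leftlim_ge T x t s : (0 < T)%E -> ipath T x -> time T t -> (0 <= s)%E -> (s < t)%E ->
  x s <= leftlim x t.
Proof.
move=> T0 [cx nd _ _] Tt s0 st.
have t0 : (0 < t)%E by exact: le_lt_trans st.
have /(cvg_leftP _ _ t0) H := leftlim_cvg cx Tt t0.
rewrite leNgt; apply/negP => xs.
have e0 : 0 < x s - leftlim x t by rewrite subr_gt0.
have [s0' /andP[s0'0 s0't] Hs] := H _ e0.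
have [r sr rt] : exists2 r : R, (Order.max s s0' < r%:E)%E & (r%:E < t)%E.
  by apply: lte_dense; rewrite ?gt_max ?st// le_max s0.
move: sr; rewrite gt_max => /andP[sr s0r].
have := Hs _ s0r rt; rewrite ltNge => /negP; apply.
rewrite (le_trans _ (ler_norm _))// lerD2r; apply: nd.
- by apply: time_le Tt _ _ => //; exact: ltW.
- by apply: time_le Tt _ _; [rewrite (le_trans s0)// ltW|exact: ltW].
- exact: ltW.
Qed.

Lemma leftlim_le T x t l : (0 < T)%E -> ipath T x -> time T t -> (0 < t)%E ->
  (forall s, (0 <= s)%E -> (s < t)%E -> x s <= l) -> leftlim x t <= l.
Proof.
move=> T0 [cx nd _ _] Tt t0 xl.
have /(cvg_leftP _ _ t0) H := leftlim_cvg cx Tt t0.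
rewrite leNgt; apply/negP => xs.
have e0 : 0 < leftlim x t - l by rewrite subr_gt0.
have [s0' /andP[s0'0 s0't] Hs] := H _ e0.
have [r s0r rt] := lte_dense s0't s0'0.
have r0 : (0 <= r%:E)%E by rewrite (le_trans s0'0)// ltW.
have := Hs _ s0r rt; rewrite distrC ltNge => /negP; apply.
by rewrite (le_trans _ (ler_norm _))// lerD2l lerN2 xl.
Qed.

Lemma leftlim_le_val T x t : (0 < T)%E -> ipath T x -> time T t -> leftlim x t <= x t.
Proof.
move=> T0 px Tt; have [t0|t0] := eqVneq t 0%E; first by rewrite /leftlim t0 eqxx.
have t_gt0 : (0 < t)%E by rewrite lt_def t0; case/andP: Tt.
apply: (leftlim_le T0 px Tt t_gt0) => s s0 st; have [_ nd _ _] := px.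
by apply: (nd _ _ _ Tt (ltW st)); apply: (time_le Tt s0); exact: ltW.
Qed.

Lemma leftlim_ge0 T x t : (0 < T)%E -> ipath T x -> time T t -> 0 <= leftlim x t.
Proof.
move=> T0 px Tt; have [t0|t0] := eqVneq t 0%E.
  by rewrite /leftlim t0 eqxx; case: px.
have t_gt0 : (0 < t)%E by rewrite lt_def t0; case/andP: Tt.
by apply: le_trans (leftlim_ge T0 px Tt (lexx _) t_gt0); case: px.
Qed.

Definition left_continuous_path T x := forall t, (0 < t)%E -> (t < T)%E -> leftlim x t = x t.

(** Absolute continuity on a single interval [[s, t]] gives the left limit at [t]. This is what
    confines the common jumps of two strategies to the times 0 and [T]. *)
Lemma ac_left_continuous T x : cadlag T x ->
  (forall s : R, 0 <= s -> (s%:E < T)%E -> abs_continuous_on 0 s (fun r => x r%:E)) ->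
  left_continuous_path T x.
Proof.
move=> cx ac [r| |]// r0 rT; last by rewrite ltNge leey in rT.
apply: leftlim_eq => //; apply/(cvg_leftP _ _ r0) => e e0.
rewrite lte_fin in r0.
have [delta d0 H] := ac r (ltW r0) rT _ e0.
exists (Num.max 0 (r - delta))%:E.
  by rewrite lee_fin lte_fin le_max lexx/= gt_max r0 ltrBlDr ltrDl.
case=> [s| |]//; rewrite !lte_fin gt_max => /andP[s0 sr] srr.
have := H 1%N (fun=> s) (fun=> r); rewrite !big_ord_recl !big_ord0 !addr0 distrC; apply => //.
- by move=> k _; rewrite ltW// lexx ltW.
- by rewrite ltrBlDl -ltrBlDr.
Qed.

End Paths2.

(** * The expected payoff *)

Section Payoff.
Context {R : realType} {d : measure_display} {Omega : measurableType d}.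
Variable P : probability Omega R.
Implicit Types (T t : \bar R) (x xi zeta f g h : \bar R -> Omega -> R).

(** Integrability makes the supremum finite only almost surely; boundedness of cadlag paths makes it
    finite at every [w], so its real part dominates everywhere. *)
Lemma Lb_bproc T f : (0 < T)%E -> Lb P T f ->
  exists M, bproc T f M /\ P.-integrable setT (EFin \o M).
Proof.
move=> T0 [jf cf iS].
pose S w := ereal_sup [set (`|f t w|)%:E | t in time T].
have S_fin w : S w \is a fin_num.
  have [B HB] := cadlag_bounded T0 (cf w).
  rewrite ge0_fin_numE; last first.
    apply: (@le_trans _ _ (`|f 0%E w|)%:E); first by rewrite lee_fin.
    by apply: ereal_sup_ubound; exists 0%E => //; exact: time0.
  apply: (@le_lt_trans _ _ B%:E); last exact: ltry.
  by apply: ge_ereal_sup => _ [t Tt <-]; rewrite lee_fin HB.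
exists (fine \o S); split.
  split => // t w Tt; rewrite -lee_fin /= fineK//.
  by apply: ereal_sup_ubound; exists t.
by apply: eq_integrable iS => // w _; rewrite /= fineK.
Qed.

Lemma A_circ_rproc T F xi : is_filtration T F -> A_circ T F xi -> rproc T xi.
Proof.
move=> [_ Fm _] [ax px]; split => // t Tt mD B mB.
by rewrite setTI; apply: (Fm _ Tt); exact: ax.
Qed.

Lemma time_sum_ends T (a : \bar R -> R) : (0 < T)%E ->
  (forall t, (0 < t)%E -> (t < T)%E -> a t = 0) ->
  time_sum T a = (a 0%E + a T)%:E.
Proof.
move=> T0 a0.
have aux (b : \bar R -> R) : (forall t, 0 <= b t) -> (forall t, (0 < t)%E -> (t < T)%E -> b t = 0) ->
    esum (time T) (fun t => (b t)%:E) = (b 0%E + b T)%:E.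
  move=> b_ge0 b0.
  rewrite (esumID [set 0%E; T]); last by move=> t _; rewrite lee_fin.
  rewrite [X in (_ + X)%E](_ : _ = 0%E) ?adde0; last first.
    apply: esum1 => t [/= /andP[t0 tT] /not_orP[tn0 tnT]].
    by rewrite b0// lt_neqAle ?t0 ?tT andbT; apply/eqP => // E; apply: tn0.
  rewrite setIidr; last by move=> t [->|->]; [exact: time0|exact: timeT].
  rewrite esum_fset; last 2 first.
  - by [].
  - by move=> t _; rewrite lee_fin.
  rewrite fsbigU//=; last first.
    by move=> t [/= -> T0']; move: T0; rewrite -T0' ltxx.
  by rewrite !fsbig_set1 EFinD.
rewrite /time_sum !aux.
- rewrite -EFinB; congr EFin.
  have E (r : R) : Num.max r 0 - Num.max (- r) 0 = r.
    by have [r0|r0] := leP r 0; have [r0'|r0'] := leP (- r) 0; lra.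
  by rewrite -[in RHS](E (a 0%E)) -[in RHS](E (a T)); ring.
- by move=> t; rewrite le_max lexx orbT.
- by move=> t t0 tT; rewrite a0// oppr0 maxxx.
- by move=> t; rewrite le_max lexx orbT.
- by move=> t t0 tT; rewrite a0// maxxx.
Qed.

(** The payoff in one scenario when [xi] has no jump inside []0, T[]. At 0 a jump is the value
    itself, every path being 0 just before. *)
Definition payoff_path T f g h xi zeta (w : Omega) : R :=
  LSI T (xi^~ w) (fun r => f r%:E w * (1 - zeta r%:E w)) +
  LSI T (zeta^~ w) (fun r => g r%:E w * (1 - xi r%:E w)) +
  (h 0%E w * xi 0%E w * zeta 0%E w +
   h T w * jump (xi^~ w) T * jump (zeta^~ w) T).

Lemma rproc01 T x t w : (0 < T)%E -> rproc T x -> time T t -> 0 <= x t w <= 1.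
Proof.
by move=> T0 [px _] Tt; rewrite (ipath_ge0 T0 (px w)) // (ipath_le1 T0 (px w)).
Qed.

Lemma bproc_stop T f M zeta : (0 < T)%E -> bproc T f M -> rproc T zeta ->
  bproc T (fun t w => f t w * (1 - zeta t w)) M.
Proof.
move=> T0 [jf bf] rz; split.
  by apply: jmM => //; apply: jm1B; exact: rproc_jm.
move=> t w Tt; have /andP[z0 z1] := rproc01 w T0 rz Tt.
rewrite normrM (le_trans _ (bf t w Tt))// ler_piMr// ler_norml; apply/andP; split; lra.
Qed.

Lemma payoff_integrandE T f g h xi zeta Mf Mg w : (0 < T)%E ->
  bproc T f Mf -> bproc T g Mg -> rproc T xi -> rproc T zeta ->
  left_continuous_path T (xi^~ w) ->
  (LS_integral T (xi^~ w) (fun r => (f r%:E w * (1 - zeta r%:E w))%R) +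
   LS_integral T (zeta^~ w) (fun r => (g r%:E w * (1 - xi r%:E w))%R) +
   time_sum T (fun t => (h t w * jump (fun s => xi s w) t * jump (fun s => zeta s w) t)%R))%E =
  (payoff_path T f g h xi zeta w)%:E.
Proof.
move=> T0 bf bg rx rz lx.
rewrite (LSI_fin w T0 rx (bproc_stop T0 bf rz)) (LSI_fin w T0 rz (bproc_stop T0 bg rx)).
rewrite time_sum_ends//.
  by rewrite -!EFinD /payoff_path /jump eqxx !subr0.
by move=> t t0 tT; rewrite /jump gt_eqF// lx// subrr mulr0 mul0r.
Qed.

Lemma jump01 T x w : (0 < T)%E -> rproc T x -> 0 <= jump (x^~ w) T <= 1.
Proof.
move=> T0 [px _]; rewrite /jump gt_eqF//.
have := leftlim_le_val T0 (px w) (timeT T0).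
have := leftlim_ge0 T0 (px w) (timeT T0).
have [_ _ _ ->] := px w.
by move=> *; apply/andP; split; lra.
Qed.

Lemma measurable_leftlim T x : (0 < T)%E -> rproc T x ->
  measurable_fun setT (fun w => leftlim (x^~ w) T).
Proof.
move=> T0 [px mx].
apply: (@measurable_fun_cvg _ _ _ _ (fun k w => x (announce T k) w)).
  by move=> k; apply: mx; exact: announce_time.
move=> w _; have [cx _ _ _] := px w; apply: (cvg_leftlim_seq cx) => //.
- exact: timeT.
- by move=> k; exact: announce_lt.
- by move=> s sT; exact: announce_gt.
Qed.

Lemma measurable_jump T x : (0 < T)%E -> rproc T x ->
  measurable_fun setT (fun w => jump (x^~ w) T).
Proof.
move=> T0 rx; have [px mx] := rx; rewrite /jump gt_eqF//.
by apply: measurable_funB; [apply: mx; exact: timeT|exact: measurable_leftlim].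
Qed.

Lemma measurable_payoff_path T f g h xi zeta Mf Mg : (0 < T)%E ->
  bproc T f Mf -> bproc T g Mg -> P.-integrable setT (EFin \o Mf) -> P.-integrable setT (EFin \o Mg) ->
  measurable_fun setT (h 0%E) -> measurable_fun setT (h T) ->
  rproc T xi -> rproc T zeta -> measurable_fun setT (payoff_path T f g h xi zeta).
Proof.
move=> T0 bf bg iMf iMg mh0 mhT rx rz; have [_ mx] := rx; have [_ mz] := rz.
rewrite /payoff_path; apply: measurable_funD; first apply: measurable_funD.
- exact: (measurable_LSI T0 rx (bproc_stop T0 bf rz) iMf).
- exact: (measurable_LSI T0 rz (bproc_stop T0 bg rx) iMg).
- apply: measurable_funD; apply: measurable_funM; try apply: measurable_funM => //.
  + by apply: mx; exact: time0.
  + by apply: mz; exact: time0.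
  + exact: measurable_jump.
  + exact: measurable_jump.
Qed.

(** The constant 3 counts [Mf + Mg] once for the two integrals together and once for each jump term,
    [h] being squeezed between [g] and [f]. *)
Lemma payoff_path_le T f g h xi zeta Mf Mg w : (0 < T)%E ->
  bproc T f Mf -> bproc T g Mg -> rproc T xi -> rproc T zeta ->
  (forall t, time T t -> h t w <= f t w /\ g t w <= h t w) ->
  `|payoff_path T f g h xi zeta w| <= 3 * (Mf w + Mg w).
Proof.
move=> T0 bf bg rx rz fgh.
have H t : time T t -> `|h t w| <= Mf w + Mg w.
  move=> Tt; have [hf gh] := fgh _ Tt.
  have := bf.2 t w Tt; have := bg.2 t w Tt; rewrite !ler_norml.
  move=> /andP[g1 g2] /andP[f1 f2].
  have : 0 <= Mg w by lra. have : 0 <= Mf w by lra.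
  by move=> *; apply/andP; split; lra.
have P01 (a b c : R) : 0 <= b <= 1 -> 0 <= c <= 1 -> `|a * b * c| <= `|a|.
  move=> /andP[b0 b1] /andP[c0 c1].
  rewrite !normrM (ger0_norm b0) (ger0_norm c0) -mulrA ler_piMr//.
  by rewrite mulr_ile1.
rewrite /payoff_path.
have h1 := LSI_le w T0 rx (bproc_stop T0 bf rz).
have h2 := LSI_le w T0 rz (bproc_stop T0 bg rx).
have h3 := le_trans (P01 (h 0%E w) _ _ (rproc01 w T0 rx (time0 T0)) (rproc01 w T0 rz (time0 T0))) (H _ (time0 T0)).
have h4 := le_trans (P01 (h T w) _ _ (jump01 w T0 rx) (jump01 w T0 rz)) (H _ (timeT T0)).
rewrite (le_trans (ler_normD _ _))//.
have := ler_normD (LSI T (xi^~ w) (fun r => f r%:E w * (1 - zeta r%:E w)))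
  (LSI T (zeta^~ w) (fun r => g r%:E w * (1 - xi r%:E w))).
have := ler_normD (h 0%E w * xi 0%E w * zeta 0%E w) (h T w * jump (xi^~ w) T * jump (zeta^~ w) T).
move: h1 h2 h3 h4; set A := LSI _ _ _; set B := LSI _ _ _; set C := _ * zeta _ _; set D := _ * _ * _.
move=> *; lra.
Qed.

End Payoff.

Section PayoffAffine.
Context {R : realType} {d : measure_display} {Omega : measurableType d}.
Implicit Types (T t : \bar R) (x xi zeta f g h : \bar R -> Omega -> R).

Lemma LSIZ T (x : \bar R -> R) (phi : R -> R) C a : (0 < T)%E -> ipath T x ->
  measurable_fun (dom T) phi -> (forall r, dom T r -> `|phi r| <= C) ->
  LSI T x (fun r => a * phi r) = a * LSI T x phi.
Proof.
move=> T0 px mphi bphi; apply: EFin_inj; rewrite EFinM.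
have ms : measurable_fun (dom T) (fun r => a * phi r) by exact: measurable_funM.
have bs r : dom T r -> `|a * phi r| <= `|a| * C.
  by move=> Dr; rewrite normrM ler_wpM2l// bphi.
rewrite -(LS_integral_LSI T0 px mphi bphi) -(LS_integral_LSI T0 px ms bs).
rewrite (LS_integralE T0 px mphi bphi) (LS_integralE T0 px ms bs).
rewrite -integralZl//; last exact: integrable_quant_fun bphi.
apply: eq_integral => u _; rewrite /quant_fun -EFinM; congr EFin.
by case: ifP => _; rewrite ?mulr0.
Qed.

Lemma LSI_lin T (x : \bar R -> R) (phi psi : R -> R) C D a b : (0 < T)%E -> ipath T x ->
  measurable_fun (dom T) phi -> (forall r, dom T r -> `|phi r| <= C) ->
  measurable_fun (dom T) psi -> (forall r, dom T r -> `|psi r| <= D) ->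
  LSI T x (fun r => a * phi r + b * psi r) = a * LSI T x phi + b * LSI T x psi.
Proof.
move=> T0 px mphi bphi mpsi bpsi.
rewrite (@LSID _ T x (fun r => a * phi r) (fun r => b * psi r) (`|a| * C) (`|b| * D))//.
- by rewrite (LSIZ a T0 px mphi bphi) (LSIZ b T0 px mpsi bpsi).
- exact: measurable_funM.
- by move=> r Dr; rewrite normrM ler_wpM2l// bphi.
- exact: measurable_funM.
- by move=> r Dr; rewrite normrM ler_wpM2l// bpsi.
Qed.

Definition pmix (a : R) x xi : \bar R -> Omega -> R :=
  fun t w => a * x t w + (1 - a) * xi t w.

Lemma rproc_pmix T a x xi : 0 <= a <= 1 -> rproc T x -> rproc T xi -> rproc T (pmix a x xi).
Proof.
move=> a01 [px mx] [pxi mxi]; split.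
  by move=> w; exact: (ipath_mix a01 (px w) (pxi w)).
by move=> t Tt; apply: measurable_funD; apply: measurable_funM => //; [exact: mx|exact: mxi].
Qed.

Lemma bproc_path T f M w : bproc T f M ->
  measurable_fun (dom T) (fun r => f r%:E w) /\ (forall r, dom T r -> `|f r%:E w| <= M w).
Proof.
move=> [jf bf]; split; first exact: jm_path.
by move=> r Dr; apply: bf; exact: dom_time.
Qed.

Let LSI_mix_proc T a x xi f M w : (0 < T)%E -> 0 <= a <= 1 -> rproc T x -> rproc T xi ->
  bproc T f M ->
  LSI T ((pmix a x xi)^~ w) (fun r => f r%:E w) =
  a * LSI T (x^~ w) (fun r => f r%:E w) + (1 - a) * LSI T (xi^~ w) (fun r => f r%:E w).
Proof.
move=> T0 a01 [px _] [pxi _] /bproc_path -/(_ w)[mf bf].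
exact: (LSI_mix T0 a01 (px w) (pxi w) mf bf).
Qed.

Let LSI_stop_mix T a x xi zeta f M w : (0 < T)%E -> 0 <= a <= 1 -> rproc T x -> rproc T xi ->
  rproc T zeta -> bproc T f M ->
  LSI T (zeta^~ w) (fun r => f r%:E w * (1 - pmix a x xi r%:E w)) =
  a * LSI T (zeta^~ w) (fun r => f r%:E w * (1 - x r%:E w)) +
  (1 - a) * LSI T (zeta^~ w) (fun r => f r%:E w * (1 - xi r%:E w)).
Proof.
move=> T0 a01 rx rxi [pz _] bf.
have [m1 b1] := bproc_path w (bproc_stop T0 bf rx).
have [m2 b2] := bproc_path w (bproc_stop T0 bf rxi).
rewrite -(LSI_lin a (1 - a) T0 (pz w) m1 b1 m2 b2); congr LSI.
by apply/funext => r; rewrite /pmix; ring.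
Qed.

Lemma payoff_path_mixl T f g h a x xi zeta Mf Mg w : (0 < T)%E -> 0 <= a <= 1 ->
  bproc T f Mf -> bproc T g Mg -> rproc T x -> rproc T xi -> rproc T zeta ->
  payoff_path T f g h (pmix a x xi) zeta w =
  a * payoff_path T f g h x zeta w + (1 - a) * payoff_path T f g h xi zeta w.
Proof.
move=> T0 a01 bf bg rx rxi rz; rewrite /payoff_path.
rewrite (LSI_mix_proc w T0 a01 rx rxi (bproc_stop T0 bf rz)).
rewrite (LSI_stop_mix w T0 a01 rx rxi rz bg).
have [px _] := rx; have [pxi _] := rxi; have [cx _ _ _] := px w; have [cxi _ _ _] := pxi w.
rewrite (jump_mix a cx cxi (timeT T0)) /pmix.
by ring.
Qed.

Lemma payoff_path_mixr T f g h a x xi zeta Mf Mg w : (0 < T)%E -> 0 <= a <= 1 ->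
  bproc T f Mf -> bproc T g Mg -> rproc T x -> rproc T xi -> rproc T zeta ->
  payoff_path T f g h zeta (pmix a x xi) w =
  a * payoff_path T f g h zeta x w + (1 - a) * payoff_path T f g h zeta xi w.
Proof.
move=> T0 a01 bf bg rx rxi rz; rewrite /payoff_path.
rewrite (LSI_mix_proc w T0 a01 rx rxi (bproc_stop T0 bg rz)).
rewrite (LSI_stop_mix w T0 a01 rx rxi rz bf).
have [px _] := rx; have [pxi _] := rxi; have [cx _ _ _] := px w; have [cxi _ _ _] := pxi w.
rewrite (jump_mix a cx cxi (timeT T0)) /pmix.
by ring.
Qed.

End PayoffAffine.

Section ExpectedPayoff.
Context {R : realType} {d : measure_display} {Omega : measurableType d}.
Variables (P : probability Omega R) (T : \bar R) (f g h : \bar R -> Omega -> R) (Mf Mg : Omega -> R).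
Hypotheses (T0 : (0 < T)%E) (bf : bproc T f Mf) (bg : bproc T g Mg)
  (iMf : P.-integrable setT (EFin \o Mf)) (iMg : P.-integrable setT (EFin \o Mg))
  (mh0 : measurable_fun setT (h 0%E)) (mhT : measurable_fun setT (h T))
  (fgh : {ae P, forall w t, time T t -> f t w >= h t w /\ h t w >= g t w}).
Implicit Types (x xi zeta : \bar R -> Omega -> R) (a : R).

Definition lc_proc xi := rproc T xi /\ forall w, left_continuous_path T (xi^~ w).

Definition payoffR xi zeta : R := \int[P]_w payoff_path T f g h xi zeta w.

Lemma integrable_bound : P.-integrable setT (EFin \o (fun w => 3 * (Mf w + Mg w))).
Proof.
have H : P.-integrable setT (fun w => (3%:E * ((Mf w)%:E + (Mg w)%:E))%E).
  by apply: integrableZl => //; exact: integrableD.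
by apply: eq_integrable H => // w _; rewrite /= EFinM EFinD.
Qed.

(** The exceptional set comes from the order of [f], [g], [h] alone, so it is common to all pairs
    and in particular to all members of a sequence of strategies. *)
Lemma ae_payoff_path_le : {ae P, forall w, forall xi zeta, rproc T xi -> rproc T zeta ->
  `|payoff_path T f g h xi zeta w| <= 3 * (Mf w + Mg w)}.
Proof.
move: fgh; apply: filterS => w H xi zeta rx rz.
by apply: (payoff_path_le T0 bf bg rx rz) => t /H[].
Qed.

Lemma integrable_payoff_path xi zeta : rproc T xi -> rproc T zeta ->
  P.-integrable setT (EFin \o payoff_path T f g h xi zeta).
Proof.
move=> rx rz.
have mp := measurable_payoff_path T0 bf bg iMf iMg mh0 mhT rx rz.
apply/integrableP; split; first exact/measurable_EFinP.
have /integrableP[mB] := integrable_bound; apply: le_lt_trans.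
apply: ae_ge0_le_integral => //.
- by apply: measurableT_comp => //; exact/measurable_EFinP.
- exact: measurableT_comp.
- move: ae_payoff_path_le; apply: filterS => w H _ /=.
  by rewrite lee_fin (le_trans (H _ _ rx rz))// ler_norm.
Qed.

Lemma payoffE xi zeta : lc_proc xi -> rproc T zeta ->
  payoff P T f g h xi zeta = (payoffR xi zeta)%:E.
Proof.
move=> [rx lx] rz; rewrite /payoffR /Rintegral fineK; last first.
  exact: integrable_fin_num (integrable_payoff_path rx rz).
rewrite /payoff; apply: eq_integral => w _.
exact: payoff_integrandE bf bg rx rz (lx w).
Qed.

Lemma payoffR_mixl a x xi zeta : 0 <= a <= 1 -> rproc T x -> rproc T xi -> rproc T zeta ->
  payoffR (pmix a x xi) zeta = a * payoffR x zeta + (1 - a) * payoffR xi zeta.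
Proof.
move=> a01 rx rxi rz; rewrite /payoffR.
have i1 := integrable_payoff_path rx rz; have i2 := integrable_payoff_path rxi rz.
rewrite -!RintegralZl// -RintegralD//.
- by apply: eq_Rintegral => w _; exact: payoff_path_mixl bf bg rx rxi rz.
- exact: (integrableZl _ a i1).
- exact: (integrableZl _ (1 - a) i2).
Qed.

Lemma payoffR_mixr a x xi zeta : 0 <= a <= 1 -> rproc T x -> rproc T xi -> rproc T zeta ->
  payoffR zeta (pmix a x xi) = a * payoffR zeta x + (1 - a) * payoffR zeta xi.
Proof.
move=> a01 rx rxi rz; rewrite /payoffR.
have i1 := integrable_payoff_path rz rx; have i2 := integrable_payoff_path rz rxi.
rewrite -!RintegralZl// -RintegralD//.
- by apply: eq_Rintegral => w _; exact: payoff_path_mixr bf bg rx rxi rz.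
- exact: (integrableZl _ a i1).
- exact: (integrableZl _ (1 - a) i2).
Qed.

Lemma payoffR_le xi zeta : rproc T xi -> rproc T zeta ->
  `|payoffR xi zeta| <= \int[P]_w (3 * (Mf w + Mg w)).
Proof.
move=> rx rz; apply: (le_trans (le_normr_Rintegral _ (integrable_payoff_path rx rz))) => //.
rewrite -lee_fin /Rintegral !fineK; last 2 first.
- exact: integrable_fin_num integrable_bound.
- by have := integrable_fin_num measurableT (integrable_abse (integrable_payoff_path rx rz)).
apply: ae_ge0_le_integral => //.
- by apply: measurableT_comp => //; apply: measurableT_comp => //;
    exact: measurable_payoff_path T0 bf bg iMf iMg mh0 mhT rx rz.
- move=> w _; rewrite lee_fin mulr_ge0// addr_ge0//.
    by apply: le_trans (bf.2 0%E w (time0 T0)).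
  by apply: le_trans (bg.2 0%E w (time0 T0)).
- by have /integrableP[] := integrable_bound.
- by move: ae_payoff_path_le; apply: filterS => w H _; rewrite lee_fin H.
Qed.

End ExpectedPayoff.

(** * Finite minimax and selection of a minimal-norm sequence *)

Section Minimax.
Context {R : realType}.

(* Minimising the sum of the squares of the deficits [c - e/2 - N i y]: at a
   near-minimiser the deficits are, up to scaling, the weights that
   contradict the hypothesis. *)
Lemma finite_affine_minimax (Y : Type) (A : set Y) (mixY : R -> Y -> Y -> Y) n
  (N : 'I_n -> Y -> R) (B c : R) (y0 : Y) : A y0 ->
  (forall a y y', 0 <= a <= 1 -> A y -> A y' -> A (mixY a y y') /\
     forall i, N i (mixY a y y') = a * N i y + (1 - a) * N i y') ->
  (forall i y, A y -> `|N i y| <= B) ->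
  (forall p : 'I_n -> R, (forall i, 0 <= p i) -> \sum_i p i = 1 ->
     forall e, 0 < e -> exists2 y, A y & c - e < \sum_i p i * N i y) ->
  forall e, 0 < e -> exists2 y, A y & forall i, c - e < N i y.
Proof.
move=> Ay0 Amix NB Np e e0.
pose dl := c - e / 2; pose p y i := Num.max (dl - N i y) 0.
pose phi y := \sum_i (p y i) ^+ 2.
have p0 y i : 0 <= p y i by rewrite /p le_max lexx orbT.
have phi0 y : 0 <= phi y by apply: sumr_ge0 => i _; exact: sqr_ge0.
pose S := [set phi y | y in A].
have S0 : S !=set0 by exists (phi y0); exists y0.
have lS : has_lbound S by exists 0 => _ [y _ <-].
pose m := inf S.
have m_le y : A y -> m <= phi y by move=> Ay; apply: ge_inf => //; exists y.
have m_lt z : m < z -> exists2 y, A y & phi y < z.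
  by move=> mz; have [_ [y Ay <-] yz] := inf_lt S0 mz; exists y.
suff m0 : m <= 0.
  have : m < (e / 2) ^+ 2 by apply: le_lt_trans m0 _; rewrite exprn_gt0// divr_gt0.
  move=> /m_lt[y Ay phiy]; exists y => // i.
  have pe : p y i < e / 2.
    rewrite -(@ltr_pXn2r _ 2)// ?nnegrE ?divr_ge0 ?(ltW e0)//.
    apply: le_lt_trans phiy; rewrite /phi (bigD1 i)//= lerDl.
    by apply: sumr_ge0 => j _; exact: sqr_ge0.
  have : dl - N i y <= p y i by rewrite /p le_max lexx.
  by rewrite /dl in pe *; lra.
rewrite leNgt; apply/negP => m_gt0.
(* [K] bounds the sum of the squared increments of the [N i] between two points of [A]; the added 1
   keeps it positive. The step length [th] satisfies [th * K <= m], so the quadratic cost [th^2 K]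
   of the move is at most [th * m], half of its linear gain. *)
pose K := n%:R * (2 * B) ^+ 2 + 1.
have K0 : 0 < K by rewrite ltr_pwDr// mulr_ge0 ?sqr_ge0.
pose th := Num.min (1 / 2) (m / K).
have th0 : 0 < th by rewrite /th lt_min divr_gt0// divr_gt0.
have th1 : th <= 1 / 2 by rewrite /th ge_min lexx.
have thK : th * K <= m by rewrite -ler_pdivlMr// /th ge_min lexx orbT.
(* The tolerance [th * m / 2] is below the net decrease [th * m] obtained in the end, which puts
   [phi] below its infimum. *)
have /m_lt[y Ay phiy] : m < m + th * m / 2 by rewrite ltrDl divr_gt0// mulr_gt0.
pose s := \sum_i p y i.
have s0 : 0 < s.
  rewrite lt_def sumr_ge0 ?andbT//; apply/negP => /eqP s0.
  have : phi y = 0.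
    have p_eq0 i : p y i = 0 by move/eqP: s0; rewrite psumr_eq0// => /allP/(_ i (mem_index_enum i))/eqP.
    by rewrite /phi big1// => i _; rewrite p_eq0 expr0n.
  by have := m_le y Ay; lra.
have [y' Ay' Hy'] : exists2 y', A y' & c - e / 2 < \sum_i (p y i / s) * N i y'.
  apply: Np; last by rewrite divr_gt0.
  - by move=> i; rewrite divr_ge0// ltW.
  - by rewrite -mulr_suml divff// gt_eqF.
pose x i := N i y' - N i y.
(* Where the deficit [p y i] is positive it equals [dl - N i y], and the choice of [y'] makes the
   weighted mean of [N i y'] exceed [dl]. *)
have px : phi y <= \sum_i p y i * x i.
  have -> : \sum_i p y i * x i = \sum_i p y i * N i y' - \sum_i p y i * N i y.
    by rewrite -sumrB; apply: eq_bigr => i _; rewrite /x mulrBr.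
  have H1 : s * dl <= \sum_i p y i * N i y'.
    move: Hy'; rewrite -/dl => /ltW; rewrite -(ler_pM2l s0) mulr_sumr => /le_trans; apply.
    apply: ler_sum => i _; rewrite mulrA mulrCA divff ?gt_eqF// mulr1//.
  rewrite lerBrDr; apply: le_trans H1; rewrite /phi /s mulr_suml -big_split/=.
  apply: ler_sum => i _; rewrite expr2 -mulrDr.
  have [->|pn0] := eqVneq (p y i) 0; first by rewrite !mul0r.
  by rewrite ler_wpM2l//; move: pn0; rewrite /p; case: (leP (dl - N i y) 0) => [_|_ _]; rewrite ?eqxx// subrK lexx.
have [Ayt Nyt] := Amix (1 - th) y y' ltac:(lra) Ay Ay'.
have phit : phi (mixY (1 - th) y y') <= phi y - 2 * th * (\sum_i p y i * x i) + th ^+ 2 * K.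
  have sx : \sum_i x i ^+ 2 <= K.
    apply: (@le_trans _ _ (\sum_(i < n) (2 * B) ^+ 2)).
      apply: ler_sum => i _; rewrite -(ger0_norm (sqr_ge0 (x i))) normrX lerXn2r ?nnegrE//.
        have := NB i y Ay; have := normr_ge0 (N i y); lra.
      rewrite /x (le_trans (ler_normB _ _))//; have := NB i y Ay; have := NB i y' Ay'; lra.
    rewrite sumr_const card_ord -[leLHS]mulr_natl /K; lra.
  apply: (@le_trans _ _ (\sum_i (p y i - th * x i) ^+ 2)).
    apply: ler_sum => i _.
    have H : p (mixY (1 - th) y y') i <= `|p y i - th * x i|.
      rewrite {1}/p Nyt ge_max normr_ge0 andbT; apply: le_trans (ler_norm _).
      have : dl - N i y <= p y i by rewrite /p le_max lexx.
      by rewrite /x; lra.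
    by rewrite -[leRHS](ger0_norm (sqr_ge0 _)) normrX lerXn2r ?nnegrE.
  apply: (@le_trans _ _ (phi y - 2 * th * (\sum_i p y i * x i) + th ^+ 2 * \sum_i x i ^+ 2)).
    rewrite /phi !mulr_sumr -sumrB -big_split/=; apply: ler_sum => i _.
    by rewrite le_eqVlt; apply/orP; left; apply/eqP; ring.
  by rewrite lerD2l ler_wpM2l// sqr_ge0.
have := m_le _ Ayt; move: phit px phiy thK.
set a := phi (mixY _ _ _); set b := phi y; set q := \sum_i _ => H1 H2 H3 H4 H5.
have : th * (th * K) <= th * m by rewrite ler_wpM2l// ltW.
have : th * b <= th * q by rewrite ler_wpM2l// ltW.
have : th * m <= th * b by rewrite ler_wpM2l// ?(ltW th0)//; exact: m_le.
have : 0 < th * m by rewrite mulr_gt0.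
by rewrite expr2 in H1; nra.
Qed.

(* A directed family of bounded convex sets in a (semi-)Hilbert space: the
   near-minimisers of the squared norm [J] form a Cauchy sequence, and every
   set of the family comes arbitrarily close to it. *)
Lemma min_norm_selection (X Y : Type) (XX : set X) (A : set Y) (mid : Y -> Y -> Y)
  (J : Y -> R) (D : Y -> Y -> R) (N : X -> Y -> R) (c : R) :
  (forall y, A y -> 0 <= J y <= 1) ->
  (forall y y', A y -> A y' -> D y y' = 2 * J y + 2 * J y' - 4 * J (mid y y')) ->
  (forall y y', A y -> A y' -> A (mid y y')) ->
  (forall x y y', XX x -> A y -> A y' -> N x (mid y y') = (N x y + N x y') / 2) ->
  (forall n (s : 'I_n -> X) e, (forall i, XX (s i)) -> 0 < e ->
     exists2 y, A y & forall i, c - e < N (s i) y) ->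
  exists u : nat -> Y, [/\ forall n, A (u n),
    forall n k, (n <= k)%N -> D (u n) (u k) <= 16 ^- n &
    forall x, XX x -> exists v : nat -> Y, forall n,
      [/\ A (v n), c - n.+1%:R^-1 < N x (v n) & D (u n) (v n) <= 16 ^- n]].
Proof.
move=> J01 DE Amid Nmid ne.
(* The directed family is indexed by a finite set of constraints and a tolerance [1/(k+1)]; the sets
   shrink when either index grows. *)
pose C (S : set X) (k : nat) := [set y | A y /\ forall x, S x -> c - k.+1%:R^-1 < N x y].
pose fin (S : set X) := exists n (s : 'I_n -> X), S = range s /\ S `<=` XX.
have Cne S k : fin S -> C S k !=set0.
  move=> [n [s [SE SX]]].
  have sX i : XX (s i) by apply: SX; rewrite SE; exists i.
  have k0 : 0 < k.+1%:R^-1 :> R by rewrite invr_gt0.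
  have [y Ay Hy] := ne n s _ sX k0.
  by exists y; split => // x; rewrite SE => -[i _ <-].
have Csub S S' k k' : S `<=` S' -> (k <= k')%N -> C S' k' `<=` C S k.
  move=> SS kk y [Ay Hy]; split => // x /SS /Hy; apply: le_lt_trans.
  by rewrite lerD2l lerN2 lef_pV2 ?posrE// ler_nat ltnS.
have Cmid S k y y' : S `<=` XX -> C S k y -> C S k y' -> C S k (mid y y').
  move=> SX [Ay Hy] [Ay' Hy']; split; first exact: Amid.
  move=> x Sx; rewrite Nmid//; last exact: SX.
  by move: (Hy _ Sx) (Hy' _ Sx); set q := k.+1%:R^-1; lra.
have finU S S' : fin S -> fin S' -> fin (S `|` S').
  move=> [n [s [-> sX]]] [n' [s' [-> sX']]]; exists (n + n')%N.
  exists (fun i => match fintype.split i with inl j => s j | inr j => s' j end); split; last first.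
    by move=> x [/sX|/sX'].
  apply/seteqP; split => x.
  - case=> -[i _ <-]; [exists (unsplit (inl i))|exists (unsplit (inr i))] => //; by rewrite unsplitK.
  - by case=> i _ <-; case: (fintype.split i) => j; [left|right]; exists j.
have fin0 : fin set0.
  exists 0%N; exists (fun i : 'I_0 => match notF (ltn_ord i) return X with end).
  by split => //; apply/seteqP; split => // x [[]].
have fin1 x : XX x -> fin [set x].
  move=> Xx; exists 1%N; exists (fun=> x); split; last by move=> _ ->.
  by apply/seteqP; split => [_ ->|_ [i _ <-]//]; exists ord0.
pose m S k := inf (J @` C S k).
have lbJ S k : has_lbound (J @` C S k) by exists 0 => _ [y [Ay _] <-]; case/andP: (J01 _ Ay).
have infJ S k : fin S -> has_inf (J @` C S k).
  by move=> fS; split => //; have [y Cy] := Cne S k fS; exists (J y); exists y.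
have m_le S k y : C S k y -> m S k <= J y by move=> Cy; apply: ge_inf => //; exists y.
have m_lt S k z : fin S -> m S k < z -> exists2 y, C S k y & J y < z.
  by move=> fS mz; have [_ [y Cy <-] yz] := inf_lt (infJ S k fS).1 mz; exists y.
have m_mono S S' k k' : fin S' -> S `<=` S' -> (k <= k')%N -> m S k <= m S' k'.
  move=> fS' SS kk; apply: lb_le_inf; first by case: (infJ S' k' fS').
  by move=> _ [y Cy <-]; apply: m_le; exact: Csub Cy.
pose E := [set r | exists S k, fin S /\ r = m S k].
have E0 : E !=set0 by exists (m set0 0%N); exists set0, 0%N.
have m_le1 S k : fin S -> m S k <= 1.
  move=> fS; have [y Cy] := Cne S k fS; apply: le_trans (m_le _ _ _ Cy) _.
  by case/andP: (J01 y Cy.1).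
have supE : has_sup E by split => //; exists 1 => _ [S [k [fS ->]]]; exact: m_le1.
(* The minimal squared norm grows along the directed family and is at most 1. Any index whose
   minimum is close to the supremum [M] forces all later near-minimisers together. *)
pose M := sup E.
have m_leM S k : fin S -> m S k <= M by move=> fS; apply: ub_le_sup; [case: supE|exists S, k].
(* Two points of squared norm below [M + dl], whose midpoint has squared norm above [M - dl], are at
   squared distance at most [8 dl] by the parallelogram identity. *)
pose dl n : R := 16 ^- n / 8.
have dl0 n : 0 < dl n by rewrite divr_gt0// invr_gt0 exprn_gt0.
have dlS n k : (n <= k)%N -> dl k <= dl n.
  by move=> nk; rewrite ler_pM2r ?invr_gt0// lef_pV2 ?posrE ?exprn_gt0// ler_weXn2l// ler1n.
have /choice[Sk HSk] n : exists Sk : set X * nat, fin Sk.1 /\ M - dl n < m Sk.1 Sk.2.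
  have Md : M - dl n < sup E by rewrite ltrBlDr ltrDl.
  have [_ [S [k [fS ->]]] HM] := sup_gt E0 Md.
  by exists (S, k).
(* Unions and sums make the chosen indices monotone in [n]. The extra summand [n] in [k'] forces the
   tolerance below [1/(n+1)]. *)
pose S' n := \bigcup_(i in `I_n.+1) (Sk i).1.
pose k' n := (n + \sum_(i < n.+1) (Sk i).2)%N.
have fS' n : fin (S' n).
  by rewrite /S' bigcup_mkord; elim/big_ind: _ => // i _; case: (HSk i).
have S'S n k : (n <= k)%N -> S' n `<=` S' k.
  move=> nk x [i /= ilt Hx]; exists i => //=.
  exact: leq_trans ilt _.
have k'k n k : (n <= k)%N -> (k' n <= k' k)%N.
  move=> nk; rewrite /k' leq_add// (big_ord_widen k.+1 (fun i => (Sk i).2))//.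
  by rewrite [leqRHS](bigID (fun i : 'I_k.+1 => (i < n.+1)%N))/= leq_addr.
have mS' n : M - dl n < m (S' n) (k' n).
  have [fn Hn] := HSk n; apply: lt_le_trans Hn _; apply: m_mono => //.
    by move=> x Hx; exists n => //=.
  by rewrite /k' big_ord_recr/=; exact: leq_trans (leq_addl _ _) (leq_addl _ _).
have fX S : fin S -> S `<=` XX by case=> n [s []].
have /choice[u Hu] n : exists y, C (S' n) (k' n) y /\ J y < M + dl n.
  have [||y Cy Jy] := m_lt (S' n) (k' n) (M + dl n); [exact: fS'| |by exists y].
  by rewrite (le_lt_trans (m_leM _ _ (fS' n)))// ltrDl.
have close n y : C (S' n) (k' n) y -> J y < M + dl n -> D (u n) y <= 16 ^- n.
  move=> Cy Jy; have [Cu Ju] := Hu n; rewrite DE; [|exact: Cu.1|exact: Cy.1].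
  have := m_le _ _ _ (Cmid _ _ _ _ (fX _ (fS' n)) Cu Cy); have := mS' n.
  rewrite (_ : 16 ^- n = 8 * dl n); first by lra.
  by rewrite /dl mulrC divfK.
exists u; split.
- by move=> n; case: (Hu n) => -[].
- move=> n k nk; have [Ck Jk] := Hu k; apply: close.
    exact: (Csub _ _ _ _ (S'S _ _ nk) (k'k _ _ nk)) Ck.
  by apply: lt_le_trans Jk _; rewrite lerD2l dlS.
- move=> x Xx.
  (* Adding the constraint [x] shrinks the set but cannot raise its minimal norm above [M], so a
     near-minimiser of the smaller set is still close to [u n]. *)
  have fx n : fin ([set x] `|` S' n) by apply: finU; [exact: fin1|].
  have /choice[v Hv] n : exists y, C ([set x] `|` S' n) (k' n) y /\ J y < M + dl n.
    have [||y Cy Jy] := m_lt ([set x] `|` S' n) (k' n) (M + dl n); [exact: fx| |by exists y].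
    by rewrite (le_lt_trans (m_leM _ _ (fx n)))// ltrDl.
  exists v => n; have [Cv Jv] := Hv n; split; first by case: Cv.
    case: Cv => _ /(_ x); move=> /(_ (or_introl erefl)); apply: le_lt_trans.
    by rewrite lerD2l lerN2 lef_pV2 ?posrE// ler_nat ltnS leq_addr.
  by apply: close => //; apply: Csub Cv => // z; right.
Qed.

End Minimax.

(** * Limits of sequences of strategies *)

Section LimitPath.
Context {R : realType}.
Implicit Types (T t s : \bar R) (x : \bar R -> R).

(** Codes of no rational in [[0, T[] are sent to 0, so every index names a time strictly before
    [T]. *)
Definition rat_time T (k : nat) : \bar R :=
  if unpickle k is Some r then
    if (0 <= (ratr r : R)%:E)%E && ((ratr r : R)%:E < T)%E then (ratr r)%:E else 0%E
  else 0%E.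

Lemma rat_time_lt T k : (0 < T)%E -> (rat_time T k < T)%E.
Proof. by rewrite /rat_time => T0; case: unpickle => // r; case: ifP => // /andP[]. Qed.

Lemma rat_time_ge0 T k : (0 < T)%E -> (0 <= rat_time T k)%E.
Proof. by rewrite /rat_time => T0; case: unpickle => // r; case: ifP => // /andP[]. Qed.

Lemma rat_time_time T k : (0 < T)%E -> time T (rat_time T k).
Proof. by move=> T0; rewrite /time/= rat_time_ge0// ltW// rat_time_lt. Qed.

Lemma rat_time_dense T s t : (0 <= s)%E -> (s < t)%E -> (t <= T)%E ->
  exists k, (s < rat_time T k)%E /\ (rat_time T k < t)%E.
Proof.
move=> s0 st tT; have [r1 sr1 r1t] := lte_dense st s0.
have r10 : (0 <= r1%:E)%E by rewrite (le_trans s0)// ltW.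
have [r2 r12 r2t] := lte_dense r1t r10.
rewrite lte_fin in r12.
have [q] := rat_in_itvoo r12; rewrite in_itv/= => /andP[r1q qr2].
exists (pickle q); rewrite /rat_time pickleK.
have q0 : (0 <= (ratr q : R)%:E)%E by rewrite (le_trans r10)// lee_fin ltW.
have qt : ((ratr q : R)%:E < t)%E by rewrite (lt_trans _ r2t)// lte_fin.
rewrite q0 (lt_le_trans qt tT)/= qt; split => //.
by rewrite (lt_trans sr1)// lte_fin.
Qed.

Lemma nondecreasing_left_cvg T x t : (0 < T)%E -> nondecreasing_on T x -> time T t -> (0 < t)%E ->
  exists l : R, x @ within [set s | (s < t)%E] (nbhs t) --> l.
Proof.
move=> T0 nd Tt t0; pose S := [set x s | s in [set s | (0 <= s)%E /\ (s < t)%E]].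
have Ts s : (0 <= s)%E -> (s < t)%E -> time T s.
  by move=> s0 st; apply: time_le Tt s0 _; exact: ltW.
have S0 : S !=set0 by exists (x 0%E); exists 0%E.
have uS : has_ubound S.
  by exists (x t) => _ [s [s0 st] <-]; apply: nd => //; [exact: Ts|exact: ltW].
exists (sup S); apply/(cvg_leftP _ _ t0) => e e0.
have Se : sup S - e < sup S by rewrite ltrBlDr ltrDl.
have [_ [s [s0 st] <-] Hs] := sup_gt S0 Se.
exists s; first by rewrite s0.
move=> r sr rt; have r0 : (0 <= r)%E by rewrite (le_trans s0)// ltW.
have : x r <= sup S by apply: ub_le_sup => //; exists r.
have : x s <= x r by apply: nd; [exact: Ts|exact: Ts|exact: ltW].
by move=> h1 h2; rewrite ltr_norml; apply/andP; split; lra.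
Qed.

(** Right limits along rational times. The value 1 is imposed at [T]: mass not yet used at the
    rational times becomes a jump there. *)
Definition regularize T (z : nat -> R) : \bar R -> R :=
  fun t => if (t < T)%E then inf [set z k | k in [set k | (t < rat_time T k)%E]] else 1.

Section Regularize.
Variables (T : \bar R) (z : nat -> R).
Hypotheses (T0 : (0 < T)%E) (z01 : forall k, 0 <= z k <= 1)
  (zmono : forall j k, (rat_time T j <= rat_time T k)%E -> z j <= z k).

Let S t := [set z k | k in [set k | (t < rat_time T k)%E]].

Let S_ne t : (0 <= t)%E -> (t < T)%E -> S t !=set0.
Proof.
move=> t0 tT; have [k [tk _]] := rat_time_dense t0 tT (lexx T).
by exists (z k); exists k.
Qed.

Let S_lb t : has_lbound (S t).
Proof. by exists 0 => _ [k _ <-]; case/andP: (z01 k). Qed.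

Lemma regularize_le t k : (t < rat_time T k)%E -> regularize T z t <= z k.
Proof.
move=> tk; rewrite /regularize (lt_trans tk)// ?rat_time_lt//.
by apply: ge_inf; [exact: S_lb|exists k].
Qed.

Lemma regularize_lt t a : (0 <= t)%E -> (t < T)%E -> regularize T z t < a ->
  exists2 k, (t < rat_time T k)%E & z k < a.
Proof.
move=> t0 tT; rewrite /regularize tT => H.
by have [_ [k tk <-] zk] := inf_lt (S_ne t0 tT) H; exists k.
Qed.

Lemma regularize01 t : (0 <= t)%E -> 0 <= regularize T z t <= 1.
Proof.
move=> t0; have [tT|tT] := ltP t T; last by rewrite /regularize ltNge tT/= ler01 lexx.
apply/andP; split.
  rewrite /regularize tT; apply: lb_le_inf; first exact: S_ne.
  by move=> _ [j tj <-]; case/andP: (z01 j).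
have [k [tk _]] := rat_time_dense t0 tT (lexx T).
by apply: le_trans (regularize_le tk) _; case/andP: (z01 k).
Qed.

Lemma ipath_regularize : ipath T (regularize T z).
Proof.
have nd : nondecreasing_on T (regularize T z).
  move=> s t Ts Tt st; have /andP[s0 _] := Ts; have /andP[t0 _] := Tt.
  have [tT|tT] := ltP t T; last first.
    rewrite [leRHS]/regularize ltNge tT/=.
    by case/andP: (regularize01 s0).
  have sT := le_lt_trans st tT.
  rewrite /regularize sT tT; apply: lb_le_inf; first exact: S_ne.
  by move=> _ [k tk <-]; apply: ge_inf; [exact: S_lb|exists k => //=; exact: le_lt_trans tk].
split => //.
- split; last by move=> t Tt t0; apply: nondecreasing_left_cvg nd Tt t0.
  move=> t Tt tT; have /andP[t0 _] := Tt.
  have t_oo : (t < +oo)%E by rewrite (lt_le_trans tT)// leey.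
  apply/(cvg_rightP _ _ t0 t_oo) => e e0.
  have /(regularize_lt t0 tT)[k tk zk] : regularize T z t < regularize T z t + e by rewrite ltrDl.
  exists (rat_time T k) => // s ts sk.
  have s0 : (0 <= s)%E by rewrite (le_trans t0)// ltW.
  have sT : (s < T)%E by rewrite (lt_trans sk)// rat_time_lt.
  have : regularize T z t <= regularize T z s.
    by apply: nd => //; [rewrite /time/= s0 ltW|exact: ltW].
  have := regularize_le sk.
  by move=> h1 h2; rewrite ltr_norml; apply/andP; split; lra.
- by case/andP: (regularize01 (lexx 0%E)).
- by rewrite /regularize ltxx.
Qed.

End Regularize.

(** The two halves of weak convergence of distribution functions: [limsup y_n(t) <= x(t)], and
    [liminf y_n(t) >= x(s)] for every [s < t]. They are kept apart because only the lower half is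
    used at [T]. *)
Definition weak_upper T (y : nat -> \bar R -> R) x := forall t e, time T t -> (t < T)%E -> 0 < e ->
  \forall n \near \oo, y n t < x t + e.

Definition weak_lower T (y : nat -> \bar R -> R) x := forall s t e, time T t -> (0 <= s)%E -> (s < t)%E ->
  0 < e -> \forall n \near \oo, x s - e < y n t.

Lemma regularize_weak T (z : nat -> R) (y : nat -> \bar R -> R) : (0 < T)%E ->
  (forall k, 0 <= z k <= 1) ->
  (forall j k, (rat_time T j <= rat_time T k)%E -> z j <= z k) ->
  (forall n, ipath T (y n)) ->
  (forall k, (fun n => y n (rat_time T k)) @ \oo --> z k) ->
  weak_upper T y (regularize T z) /\ weak_lower T y (regularize T z).
Proof.
move=> T0 z01 zmono py yz; split.
- move=> t e Tt tT e0; have /andP[t0 _] := Tt.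
  have /(regularize_lt t0 tT)[k tk zk] : regularize T z t < regularize T z t + e by rewrite ltrDl.
  have /cvgrPdist_lt/(_ (regularize T z t + e - z k)) := yz k.
  rewrite subr_gt0 => /(_ zk); apply: filterS => n.
  rewrite distrC => /(le_lt_trans (ler_norm _)) H.
  have : y n t <= y n (rat_time T k).
    by case: (py n) => _ nd _ _; apply: nd => //; [exact: rat_time_time|exact: ltW].
  by lra.
- move=> s t e Tt s0 st e0; have /andP[t0 tT] := Tt.
  have [k [sk kt]] := rat_time_dense s0 st tT.
  have /cvgrPdist_lt/(_ e e0) := yz k; apply: filterS => n.
  move=> /(le_lt_trans (ler_norm _)) H.
  have : y n (rat_time T k) <= y n t.
    by case: (py n) => _ nd _ _; apply: nd => //; [exact: rat_time_time|exact: ltW].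
  by have := regularize_le T0 z01 sk; lra.
Qed.

Lemma weak_cvg T (y : nat -> \bar R -> R) x t : (0 < T)%E -> ipath T x ->
  weak_upper T y x -> weak_lower T y x -> (0 < t)%E -> (t < T)%E -> leftlim x t = x t ->
  (fun n => y n t) @ \oo --> x t.
Proof.
move=> T0 px yU yL t0 tT xt.
have Tt : time T t by rewrite /time/= !ltW.
apply/cvgrPdist_lt => e e0.
have [cx _ _ _] := px.
have /(cvg_leftP _ _ t0)/(_ (e / 2))[|s0 /andP[s00 s0t] Hs] := leftlim_cvg cx Tt t0; first by rewrite divr_gt0.
have [s s0s st] := lte_dense s0t s00.
have s_ge0 : (0 <= s%:E)%E by rewrite (le_trans s00)// ltW.
have := Hs _ s0s st; rewrite xt distrC => /(le_lt_trans (ler_norm _)) Hst.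
have e20 : 0 < e / 2 by rewrite divr_gt0.
near=> n.
have H1 : y n t < x t + e by near: n; exact: yU.
have H2 : x s%:E - e / 2 < y n t by near: n; exact: yL.
by rewrite ltr_norml; apply/andP; split; lra.
Unshelve. all: by end_near. Qed.

(** Necessarily one-sided: mass that [y n] places ever closer to [T] becomes a jump of [x] at [T],
    so the left limit may drop in the limit. *)
Lemma weak_leftlim T (y : nat -> \bar R -> R) x e : (0 < T)%E -> ipath T x ->
  (forall n, ipath T (y n)) ->
  weak_lower T y x -> 0 < e -> \forall n \near \oo, leftlim x T - e < leftlim (y n) T.
Proof.
move=> T0 px py yL e0; have [cx _ _ _] := px.
have e20 : 0 < e / 2 by rewrite divr_gt0.
have /(cvg_leftP _ _ T0)/(_ (e / 2) e20)[s0 /andP[s00 s0t] Hs] := leftlim_cvg cx (timeT T0) T0.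
have [s s0s sT] := lte_dense s0t s00.
have s_ge0 : (0 <= s%:E)%E by rewrite (le_trans s00)// ltW.
have := Hs _ s0s sT; rewrite distrC => /(le_lt_trans (ler_norm _)) Hst.
have [t st tT] := lte_dense sT s_ge0.
have t0 : (0 <= t%:E)%E by rewrite (le_trans s_ge0)// ltW.
have Tt : time T t%:E by rewrite /time/= t0 ltW.
have := yL s%:E t%:E (e / 2) Tt s_ge0 st e20; apply: filterS => n Hn.
by have := leftlim_ge T0 (py n) (timeT T0) t0 tT; lra.
Qed.

End LimitPath.

(** * Adaptedness of the limit process *)

Section LimitProcess.
Context {R : realType} {d : measure_display} {Omega : measurableType d}.
Implicit Types (T t s : \bar R) (x : \bar R -> Omega -> R).

Lemma G_measurableP (G : set (set Omega)) (Y : Omega -> R) : sigma_algebra setT G ->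
  G_measurable G Y <-> measurable_fun setT (Y : g_sigma_algebraType G -> R).
Proof.
move=> sG; have GE : G.-sigma.-measurable = G by exact: sigma_algebra_id.
split.
- move=> mY _ B mB; rewrite setTI; suff : G.-sigma.-measurable (Y @^-1` B) by [].
  by rewrite GE; exact: mY.
- move=> mY B mB; rewrite -GE -[X in _.-sigma.-measurable X]setTI.
  exact: mY.
Qed.

Lemma G_measurable_lt (G : set (set Omega)) (Y : Omega -> R) : sigma_algebra setT G ->
  (forall a : R, G [set w | Y w < a]) -> G_measurable G Y.
Proof.
move=> sG H; apply/(G_measurableP _ sG).
have GE : G.-sigma.-measurable = G by exact: sigma_algebra_id.
apply: (measurability _ (RGenInftyO.measurableE R)) => //.
move=> _ [_ [u ->] <-]; rewrite setTI.
suff : G.-sigma.-measurable (Y @^-1` `]-oo, u[%classic) by [].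
rewrite GE (_ : _ @^-1` _ = [set w | Y w < u]); first exact: H.
by apply/seteqP; split => w /=; rewrite in_itv.
Qed.

Lemma sigma_algebra_cup (G : set (set Omega)) (A : nat -> set Omega) : sigma_algebra setT G ->
  (forall k, G (A k)) -> G (\bigcup_k A k).
Proof. by move=> [_ _ GU] GA; apply: GU. Qed.

Lemma sigma_algebra_setC (G : set (set Omega)) (A : set Omega) : sigma_algebra setT G ->
  G A -> G (~` A).
Proof. by move=> [_ GD _] GA; rewrite -setTD; exact: GD. Qed.

Lemma sigma_algebra_setT (G : set (set Omega)) : sigma_algebra setT G -> G setT.
Proof. by move=> sG; rewrite -setC0; apply: sigma_algebra_setC => //; case: sG. Qed.

Lemma sigma_algebra_setU (G : set (set Omega)) (A B : set Omega) : sigma_algebra setT G ->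
  G A -> G B -> G (A `|` B).
Proof.
move=> sG GA GB; rewrite -bigcup2E; apply: sigma_algebra_cup => // -[|[|k]]//=.
by case: sG.
Qed.

Lemma sigma_algebra_setI (G : set (set Omega)) (A B : set Omega) : sigma_algebra setT G ->
  G A -> G B -> G (A `&` B).
Proof.
move=> sG GA GB; rewrite -[A]setCK -[B]setCK -setCU.
by apply: sigma_algebra_setC => //; apply: sigma_algebra_setU => //; exact: sigma_algebra_setC.
Qed.

Lemma sigma_algebra_cap (G : set (set Omega)) (A : nat -> set Omega) : sigma_algebra setT G ->
  (forall k, G (A k)) -> G (\bigcap_k A k).
Proof.
move=> sG GA; rewrite -[X in G X]setCK setC_bigcap; apply: sigma_algebra_setC => //.
by apply: sigma_algebra_cup => // k; exact: sigma_algebra_setC.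
Qed.

Lemma right_continuous_mem T (F : \bar R -> set (set Omega)) t A :
  right_continuous_filtration T F -> time T t -> (t < T)%E ->
  (forall s, (t < s)%E -> (s <= T)%E -> F s A) -> F t A.
Proof. by move=> rF Tt tT H; rewrite (rF t Tt tT) => s /= /andP[ts sT]; exact: H. Qed.

Variables (T : \bar R) (F : \bar R -> set (set Omega)).
Hypotheses (T0 : (0 < T)%E) (filF : is_filtration T F) (rcF : right_continuous_filtration T F).

(** A limit superior exists at every [w] and keeps monotonicity and measurability; the limit process
    is therefore a strategy at every [w], including those where nothing converges. *)
Definition rat_limit (u : nat -> \bar R -> Omega -> R) (w : Omega) (k : nat) : R :=
  limn_sup (fun n => u n (rat_time T k) w).

Definition limit_proc (u : nat -> \bar R -> Omega -> R) : \bar R -> Omega -> R :=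
  fun t w => regularize T (rat_limit u w) t.

Variable u : nat -> \bar R -> Omega -> R.
Hypothesis Au : forall n, A_circ T F (u n).

Let u01 n t w : time T t -> 0 <= u n t w <= 1.
Proof.
by move=> Tt; have [_ pu] := Au n; rewrite (ipath_ge0 T0 (pu w))// (ipath_le1 T0 (pu w)).
Qed.

Let ub k w : has_ubound (range (fun n => u n (rat_time T k) w)).
Proof. by exists 1 => _ [n _ <-]; case/andP: (u01 n w (rat_time_time k T0)). Qed.

Let lb k w : has_lbound (range (fun n => u n (rat_time T k) w)).
Proof. by exists 0 => _ [n _ <-]; case/andP: (u01 n w (rat_time_time k T0)). Qed.

Let supsE k w : rat_limit u w k = inf (range (sups (fun n => u n (rat_time T k) w))).
Proof.
rewrite /rat_limit /limn_sup.
by apply/cvg_lim => //; apply: cvg_sups_inf; [exact: ub|exact: lb].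
Qed.

Let sups01 k w n : 0 <= sups (fun n => u n (rat_time T k) w) n <= 1.
Proof.
have H m := u01 m w (rat_time_time k T0).
apply/andP; split.
  apply: (@le_trans _ _ (u n (rat_time T k) w)); first by case/andP: (H n).
  by apply: ub_le_sup; [exact: has_ubound_sdrop|exists n => /=].
apply: ge_sup; first by exists (u n (rat_time T k) w); exists n => /=.
by move=> _ [m _ <-]; case/andP: (H m).
Qed.

Lemma rat_limit01 w k : 0 <= rat_limit u w k <= 1.
Proof.
rewrite supsE; apply/andP; split.
  apply: lb_le_inf; first by exists (sups (fun n => u n (rat_time T k) w) 0%N); exists 0%N.
  by move=> _ [n _ <-]; case/andP: (sups01 k w n).
apply: (@le_trans _ _ (sups (fun n => u n (rat_time T k) w) 0%N)).
  apply: ge_inf; last by exists 0%N.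
  by exists 0 => _ [n _ <-]; case/andP: (sups01 k w n).
by case/andP: (sups01 k w 0%N).
Qed.

Lemma rat_limit_mono w j k : (rat_time T j <= rat_time T k)%E -> rat_limit u w j <= rat_limit u w k.
Proof.
move=> jk; rewrite !supsE; apply: lb_le_inf.
  by exists (sups (fun n => u n (rat_time T k) w) 0%N); exists 0%N.
move=> _ [n _ <-]; apply: (@le_trans _ _ (sups (fun n => u n (rat_time T j) w) n)).
  apply: ge_inf; last by exists n.
  by exists 0 => _ [m _ <-]; case/andP: (sups01 j w m).
apply: ge_sup; first by exists (u n (rat_time T j) w); exists n => /=.
move=> _ [m nm <-]; apply: (@le_trans _ _ (u m (rat_time T k) w)).
  have [_ pu] := Au m; have [_ nd _ _] := pu w.
  by apply: nd => //; exact: rat_time_time.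
by apply: ub_le_sup; [exact: has_ubound_sdrop|exists m].
Qed.

Lemma rat_limit_measurable k : G_measurable (F (rat_time T k)) (fun w => rat_limit u w k).
Proof.
have [sF _ _] := filF; have sG := sF _ (rat_time_time k T0).
apply/(G_measurableP _ sG); apply: measurable_fun_limn_sup.
- by move=> w _; exact: ub.
- by move=> w _; exact: lb.
- move=> n; apply/(G_measurableP _ sG); have [au _] := Au n.
  by apply: au; exact: rat_time_time.
Qed.

Lemma limit_proc_A_circ : A_circ T F (limit_proc u).
Proof.
have [sF _ Fmono] := filF.
split; last first.
  by move=> w; have := ipath_regularize T0 (rat_limit01 w).
move=> t Tt; have sG := sF _ Tt.
have /andP[t0 tT] := Tt.
move: tT; rewrite le_eqVlt => /predU1P[tE|tT].
  have -> : limit_proc u t = cst 1.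
    by apply/funext => w; rewrite /limit_proc /regularize tE ltxx.
  by apply/(G_measurableP _ sG); exact: measurable_cst.
apply: G_measurable_lt => // a.
(* The value at [t] is an infimum over later rational times, known only just after [t]. By
   monotonicity the rational times in []t, s[] suffice, for each [s > t]. *)
apply: (right_continuous_mem rcF) => // s ts sT.
have Ts : time T s by rewrite /time/= sT (le_trans t0)// ltW.
rewrite (_ : [set w | _] = \bigcup_k (if (t < rat_time T k)%E && (rat_time T k < s)%E
   then [set w | rat_limit u w k < a] else set0)).
  apply: sigma_algebra_cup; first exact: sF.
  move=> k; case: ifPn => [/andP[tk ks]|_]; last by case: (sF _ Ts).
  apply: (Fmono (rat_time T k) s); [exact: rat_time_time|by []|exact: ltW|].
  rewrite (_ : [set w | _] = (fun w => rat_limit u w k) @^-1` `]-oo, a[%classic).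
    by apply: rat_limit_measurable; exact: measurable_itv.
  by apply/seteqP; split => w /=; rewrite in_itv.
apply/seteqP; split => w /=.
- move=> /(regularize_lt t0 tT)[j tj zj].
  have tm : (t < Order.min (rat_time T j) s)%E by rewrite lt_min tj ts.
  have mT : (Order.min (rat_time T j) s <= T)%E by rewrite ge_min sT orbT.
  have [k [tk kjs]] := rat_time_dense t0 tm mT; move: kjs; rewrite lt_min => /andP[kj ks].
  exists k => //; rewrite tk ks /=; apply: le_lt_trans zj.
  by apply: rat_limit_mono; exact: ltW.
- move=> [k _]; case: ifP => // /andP[tk _] /=; apply: le_lt_trans.
  exact: (regularize_le T0 (rat_limit01 w)).
Qed.

End LimitProcess.

(** * A Hilbert norm on strategies and fast almost sure convergence *)

Section SquareNorm.
Context {R : realType} {d : measure_display} {Omega : measurableType d}.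
Variables (P : probability Omega R) (T : \bar R).
Hypothesis T0 : (0 < T)%E.
Implicit Types (x y : \bar R -> Omega -> R).

(** Markov's inequality at the level [4^-n] turns the mean [16^-n] into a probability [4^-n], and
    Borel-Cantelli concludes. *)
Lemma fast_small_ae (X : nat -> Omega -> R) : (forall n w, 0 <= X n w) ->
  (forall n, measurable_fun setT (X n)) ->
  (forall n, (\int[P]_w (X n w)%:E <= (16 ^- n)%:E)%E) ->
  {ae P, forall w, \forall n \near \oo, X n w <= 4 ^- n}.
Proof.
move=> X0 mX iX; pose A n := [set w | 4 ^- n < X n w].
have mA n : measurable (A n).
  rewrite -[X in measurable X]setTI /A.
  have := measurable_fun_ltr (measurable_cst (4 ^- n : R)) (mX n) measurableT (Y := [set true]).
  by apply.
have PA n : (P (A n) <= (4 ^- n)%:E)%E.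
  have H : ((4 ^- n)%:E * P (A n) <= (16 ^- n)%:E)%E.
    apply: le_trans (iX n).
    rewrite -(setIT (A n)) -integral_indic// -ge0_integralZl//; last by apply/measurable_EFinP; exact: measurable_indic.
    apply: ge0_le_integral => //.
    - by apply: measurable_funeM; apply/measurable_EFinP; exact: measurable_indic.
    - exact/measurable_EFinP.
    - move=> w _; rewrite -EFinM lee_fin indicE.
      case: (boolP (w \in A n)) => [/set_mem|_]; last by rewrite mulr0.
      by rewrite mulr1 => /ltW.
  have p4 : 0 < 4 ^- n :> R by rewrite invr_gt0 exprn_gt0.
  rewrite -(@lee_pmul2l _ (4 ^- n)%:E)//.
  apply: le_trans H _; rewrite -EFinM lee_fin -invfM -exprMn.
  by rewrite (_ : 4 * 4 = 16)//; ring.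
have H : P (lim_sup_set A) = 0%E.
  apply: lim_sup_set_cvg0 => //.
  apply: (@le_lt_trans _ _ 2%:E); last by rewrite ltry.
  apply: lime_le; first by apply: is_cvg_nneseries.
  (* The slack [2 * 4^-n] makes the bound on the partial sums inductive. *)
  apply: nearW => n; apply: (@le_trans _ _ (2 - 2 * 4 ^- n)%:E); last first.
    by rewrite lee_fin lerBlDr lerDl mulr_ge0// invr_ge0 exprn_ge0.
  elim: n => [|n IH].
    by rewrite big_geq// lee_fin expr0 invr1; lra.
  rewrite big_nat_recr//= (le_trans (leeD IH (PA n)))//.
  rewrite -EFinD lee_fin exprS invfM.
  have : 0 <= 4 ^- n :> R by rewrite invr_ge0 exprn_ge0.
  by move=> ?; lra.
exists (lim_sup_set A); split => //.
  by apply: bigcap_measurable => // n _; apply: bigcup_measurable.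
move=> w /= nw n _; apply: contrapT => nA; apply: nw.
exists n => // j /= nj; rewrite leNgt; apply/negP => Xj; apply: nA.
by exists j.
Qed.

(** Adding the geometric tail [2 C 2^-n] makes the sequence nonincreasing and subtracting it makes
    it nondecreasing; the tail vanishes. *)
Lemma geometric_is_cvg (a : nat -> R) C : (\forall n \near \oo, `|a n.+1 - a n| <= C * 2 ^- n) ->
  cvgn a.
Proof.
move=> [N _ aC].
have C0 : 0 <= C.
  have /= := le_trans (normr_ge0 _) (aC N (leqnn N)).
  by rewrite pmulr_lge0// invr_gt0 exprn_gt0.
pose b n := a (n + N)%N + 2 * C * 2 ^- (n + N).
pose c n := a (n + N)%N - 2 * C * 2 ^- (n + N).
have h n : 2 ^- n.+1 = 2 ^- n / 2 :> R by rewrite exprS invfM mulrC.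
have step n : a (n + N)%N - C * 2 ^- (n + N) <= a (n.+1 + N)%N <= a (n + N)%N + C * 2 ^- (n + N).
  have := aC (n + N)%N (leq_addl _ _); rewrite /= -addSn ler_norml.
  by move=> /andP[h1 h2]; apply/andP; split; lra.
have bn : nonincreasing_seq b.
  apply/nonincreasing_seqP => n; rewrite /b addSn h -addSn.
  by have /andP[_] := step n; lra.
have cn : nondecreasing_seq c.
  apply/nondecreasing_seqP => n; rewrite /c addSn h -addSn.
  by have /andP[+ _] := step n; lra.
have bc n : c n <= b n.
  rewrite /b /c; have : 0 <= C * 2 ^- (n + N) by rewrite mulr_ge0// invr_ge0 exprn_ge0.
  by lra.
have cb : cvgn b.
  apply: nonincreasing_is_cvgn => //; exists (c 0%N) => _ [n _ <-].
  by apply: le_trans (bc n); exact: cn.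
have c2 : (fun n : nat => 2 * C * 2 ^- (n + N)) @ \oo --> 2 * C * 0.
  apply: cvgMr; rewrite (cvg_shiftn N (fun n => 2 ^- n : R)).
  under eq_fun do rewrite -exprVn.
  by apply: cvg_expr; rewrite ger0_norm ?invr_ge0// invf_lt1// ltr1n.
apply/cvg_ex; have /cvg_ex[l bl] := cb; exists (l - 2 * C * 0).
rewrite -(cvg_shiftn N) /=.
rewrite (_ : (fun n => a (n + N)%N) = (fun n => b n - 2 * C * 2 ^- (n + N))); first exact: cvgB.
by apply/funext => n; rewrite /b addrK.
Qed.

(** A weighted sum over rational times in place of an integral over time: the weights add up to 1
    whatever the horizon, and a small norm controls the path at each rational time directly. *)
Definition sqnorm x (w : Omega) : R :=
  limn (series (fun k => 2 ^- k.+1 * (x (rat_time T k) w) ^+ 2)).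

Let bnd x := forall t w, time T t -> `|x t w| <= 1.

Let half_sum n : \sum_(0 <= k < n) 2 ^- k.+1 <= 1 :> R.
Proof.
suff -> : \sum_(0 <= k < n) 2 ^- k.+1 = 1 - 2 ^- n :> R.
  by rewrite gerBl invr_ge0 exprn_ge0.
elim: n => [|n IH]; first by rewrite big_geq// expr0 invr1 subrr.
by rewrite big_nat_recr//= IH exprS invfM; lra.
Qed.

Let term_ge0 x w k : 0 <= 2 ^- k.+1 * (x (rat_time T k) w) ^+ 2.
Proof. by rewrite mulr_ge0// ?sqr_ge0// invr_ge0 exprn_ge0. Qed.

Let psum_le1 x w n : bnd x -> series (fun k => 2 ^- k.+1 * (x (rat_time T k) w) ^+ 2) n <= 1.
Proof.
move=> bx; apply: le_trans (half_sum n); rewrite /series/=.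
apply: ler_sum => k _; rewrite ler_piMr// ?invr_ge0 ?exprn_ge0//.
by rewrite -(ger0_norm (sqr_ge0 _)) normrX exprn_ile1// bx//; exact: rat_time_time.
Qed.

Let psum_nd x w : nondecreasing_seq (series (fun k => 2 ^- k.+1 * (x (rat_time T k) w) ^+ 2)).
Proof.
by apply/nondecreasing_seqP => n; rewrite /series/= big_nat_recr//= lerDl term_ge0.
Qed.

Lemma sqnorm_cvg x w : bnd x ->
  series (fun k => 2 ^- k.+1 * (x (rat_time T k) w) ^+ 2) @ \oo --> sqnorm x w.
Proof.
move=> bx; apply: nondecreasing_is_cvgn; first exact: psum_nd.
by exists 1 => _ [n _ <-]; exact: psum_le1.
Qed.

Lemma sqnorm01 x w : bnd x -> 0 <= sqnorm x w <= 1.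
Proof.
move=> bx; have H := sqnorm_cvg bx (w := w); apply/andP; split.
- apply: (limr_ge (cvgP _ H)); apply: nearW => n.
  by rewrite /series/= sumr_ge0// => k _; exact: term_ge0.
- by apply: (limr_le (cvgP _ H)); apply: nearW => n; exact: psum_le1.
Qed.

Lemma sqnorm_ge_term x w k : bnd x -> 2 ^- k.+1 * (x (rat_time T k) w) ^+ 2 <= sqnorm x w.
Proof.
move=> bx; have H := sqnorm_cvg bx (w := w).
apply: (limr_ge (cvgP _ H)); near=> n.
have kn : (k < n)%N by near: n; exact: nbhs_infty_gt.
apply: le_trans (psum_nd x w kn).
rewrite /series/= big_nat_recr//= lerDr sumr_ge0// => j _; exact: term_ge0.
Unshelve. all: by end_near. Qed.

Lemma sqnorm_parallelogram x y w : bnd x -> bnd y -> bnd (fun t w => x t w - y t w) ->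
  bnd (pmix (1 / 2) x y) ->
  sqnorm (fun t w => x t w - y t w) w = 2 * sqnorm x w + 2 * sqnorm y w - 4 * sqnorm (pmix (1 / 2) x y) w.
Proof.
move=> bx by_ bd bm.
have cx := sqnorm_cvg bx (w := w); have cy := sqnorm_cvg by_ (w := w).
have cd := sqnorm_cvg bd (w := w); have cm := sqnorm_cvg bm (w := w).
apply: (cvg_unique _ cd) => //.
suff -> : series (fun k => 2 ^- k.+1 * (x (rat_time T k) w - y (rat_time T k) w) ^+ 2) = fun n =>
  2 * series (fun k => 2 ^- k.+1 * (x (rat_time T k) w) ^+ 2) n +
  2 * series (fun k => 2 ^- k.+1 * (y (rat_time T k) w) ^+ 2) n -
  4 * series (fun k => 2 ^- k.+1 * (pmix (1 / 2) x y (rat_time T k) w) ^+ 2) n.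
  by apply: cvgB; [apply: cvgD|]; apply: cvgMr.
apply/funext => n; rewrite /= /series/= !mulr_sumr -big_split/= -sumrB.
by apply: eq_bigr => k _; rewrite /pmix; field.
Qed.

Lemma measurable_sqnorm x : bnd x -> (forall t, time T t -> measurable_fun setT (x t)) ->
  measurable_fun setT (sqnorm x).
Proof.
move=> bx mx; apply: (@measurable_fun_cvg _ _ _ _
  (fun n w => series (fun k => 2 ^- k.+1 * (x (rat_time T k) w) ^+ 2) n)).
- move=> n; rewrite /series/=; apply: measurable_sum => k.
  by apply: measurable_funM => //; apply: measurable_funX; apply: mx; exact: rat_time_time.
- by move=> w _; exact: sqnorm_cvg.
Qed.

End SquareNorm.

Section Selection.
Context {R : realType} {d : measure_display} {Omega : measurableType d}.
Variables (P : probability Omega R) (T : \bar R) (F : \bar R -> set (set Omega)).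
Hypotheses (T0 : (0 < T)%E) (filF : is_filtration T F).
Implicit Types (x y : \bar R -> Omega -> R).

Definition sqdist x y : R := \int[P]_w sqnorm T (fun t w => x t w - y t w) w.

Let diff1 x y t w : rproc T x -> rproc T y -> time T t -> `|x t w - y t w| <= 1.
Proof.
move=> rx ry Tt; have /andP[x0 x1] := rproc01 w T0 rx Tt; have /andP[y0 y1] := rproc01 w T0 ry Tt.
by rewrite ler_norml; apply/andP; split; lra.
Qed.

Let rproc_norm1 x t w : rproc T x -> time T t -> `|x t w| <= 1.
Proof. by move=> rx Tt; have /andP[x0 x1] := rproc01 w T0 rx Tt; rewrite ger0_norm. Qed.

Let measurable_sqdiff x y : rproc T x -> rproc T y ->
  measurable_fun setT (sqnorm T (fun t w => x t w - y t w)).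
Proof.
move=> rx ry; apply: measurable_sqnorm => //; first by move=> t w; exact: diff1.
by move=> t Tt; apply: measurable_funB; [exact: rx.2|exact: ry.2].
Qed.

Let integrable01 (X : Omega -> R) : measurable_fun setT X -> (forall w, 0 <= X w <= 1) ->
  P.-integrable setT (EFin \o X).
Proof.
move=> mX X01; apply: (@le_integrable _ _ _ _ _ _ _ (cst 1%E)) => //.
- exact/measurable_EFinP.
- move=> w _ /=; rewrite lee_fin normr1; have /andP[X0 X1] := X01 w.
  by rewrite ger0_norm.
- exact: finite_measure_integrable_cst.
Qed.

Let integrable_sqdiff x y : rproc T x -> rproc T y ->
  P.-integrable setT (EFin \o sqnorm T (fun t w => x t w - y t w)).
Proof.
move=> rx ry; apply: integrable01; first exact: measurable_sqdiff.
by move=> w; apply: sqnorm01 => // t w' Tt; exact: diff1.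
Qed.

Let integrable_sq x : rproc T x -> P.-integrable setT (EFin \o sqnorm T x).
Proof.
move=> rx; apply: integrable01.
  by apply: measurable_sqnorm => //; [move=> t w; exact: rproc_norm1|exact: rx.2].
by move=> w; apply: sqnorm01 => // t w' Tt; exact: rproc_norm1.
Qed.

Definition sqexp x : R := \int[P]_w sqnorm T x w.

Lemma sqexp01 x : rproc T x -> 0 <= sqexp x <= 1.
Proof.
move=> rx; have b w : 0 <= sqnorm T x w <= 1 by apply: sqnorm01 => // t w' Tt; exact: rproc_norm1.
apply/andP; split.
  by apply: Rintegral_ge0 => w _; case/andP: (b w).
have -> : 1 = \int[P]_w (cst 1 w) :> R.
  by rewrite Rintegral_cst// [X in fine X](_ : _ = 1%E) ?mulr1//; exact: (probability_setT P).
apply: le_Rintegral => //; [exact: integrable_sq|exact: finite_measure_integrable_cst|].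
by move=> w _; case/andP: (b w).
Qed.

Lemma sqdistE x y : rproc T x -> rproc T y ->
  sqdist x y = 2 * sqexp x + 2 * sqexp y - 4 * sqexp (pmix (1 / 2) x y).
Proof.
move=> rx ry.
have rm : rproc T (pmix (1 / 2) x y) by apply: rproc_pmix => //; lra.
have i1 := integrable_sq rx; have i2 := integrable_sq ry; have i3 := integrable_sq rm.
have j1 : P.-integrable setT (EFin \o (fun w => 2 * sqnorm T x w)) := integrableZl measurableT 2 i1.
have j2 : P.-integrable setT (EFin \o (fun w => 2 * sqnorm T y w)) := integrableZl measurableT 2 i2.
have j3 : P.-integrable setT (EFin \o (fun w => 4 * sqnorm T (pmix (1 / 2) x y) w)) :=
  integrableZl measurableT 4 i3.
have j12 : P.-integrable setT (EFin \o (fun w => 2 * sqnorm T x w + 2 * sqnorm T y w)) :=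
  integrableD measurableT j1 j2.
rewrite /sqdist /sqexp.
transitivity (\int[P]_w (2 * sqnorm T x w + 2 * sqnorm T y w - 4 * sqnorm T (pmix (1 / 2) x y) w)).
  apply: eq_Rintegral => w _; apply: sqnorm_parallelogram => //.
  - by move=> t w' Tt; exact: rproc_norm1.
  - by move=> t w' Tt; exact: rproc_norm1.
  - by move=> t w' Tt; exact: diff1.
  - by move=> t w' Tt; exact: rproc_norm1.
by rewrite RintegralB// RintegralD// !RintegralZl.
Qed.

(** Isolating the term [k] costs its inverse weight [2^(k+1)], which is at least 1 and so also
    bounds its own square root; the square root of [4^-n] is [2^-n]. *)
Let sqdist_small (x y : nat -> \bar R -> Omega -> R) :
  (forall n, rproc T (x n)) -> (forall n, rproc T (y n)) -> (forall n, sqdist (x n) (y n) <= 16 ^- n) ->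
  {ae P, forall w, forall k, \forall n \near \oo,
    `|x n (rat_time T k) w - y n (rat_time T k) w| <= 2 ^+ k.+1 * 2 ^- n}.
Proof.
move=> rx ry xy.
have := @fast_small_ae _ _ _ P (fun n => sqnorm T (fun t w => x n t w - y n t w)) _ _ _.
have b n w : 0 <= sqnorm T (fun t w => x n t w - y n t w) w <= 1.
  by apply: sqnorm01 => // t w' Tt; exact: diff1.
move=> /(_ (fun n w => proj1 (andP (b n w)))) /(_ (fun n => measurable_sqdiff (rx n) (ry n))).
case.
  move=> n; rewrite -(fineK (integrable_fin_num measurableT (integrable_sqdiff (rx n) (ry n)))) lee_fin.
  exact: xy.
move=> N [mN PN HN]; exists N; split => // w /= Hw; apply: HN => /= H; apply: Hw => k.
move: H; apply: filterS => n Hn.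
have := @sqnorm_ge_term _ _ _ T T0 (fun t w => x n t w - y n t w) w k _.
move=> /(_ (fun t w' Tt => diff1 w' (rx n) (ry n) Tt)) => H.
have {}H := le_trans H Hn.
set D := x n _ w - _ in H *.
have p0 (m : nat) : 0 < 2 ^- m :> R by rewrite invr_gt0 exprn_gt0.
have q1 : 1 <= 2 ^+ k.+1 :> R by rewrite exprn_ege1// ler1n.
rewrite -(@ler_pXn2r _ 2)// ?nnegrE// ?mulr_ge0 ?invr_ge0 ?exprn_ge0//.
rewrite -normrX ger0_norm ?sqr_ge0//.
have H2 : D ^+ 2 <= 2 ^+ k.+1 * 4 ^- n.
  by rewrite -ler_pdivrMl ?exprn_gt0.
apply: le_trans H2 _; rewrite exprMn expr2 -mulrA ler_wpM2l ?exprn_ge0//.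
have -> : (2 ^- n) ^+ 2 = 4 ^- n :> R by rewrite exprVn -exprM mulnC exprM (_ : 2 ^+ 2 = 4)//; ring.
by rewrite ler_peMl// invr_ge0 exprn_ge0.
Qed.

(** The sequence [v] may be tuned to one opponent. Staying close to [u], it inherits the limit built
    from [u] alone; this is how a single strategy becomes good against every opponent. *)
Lemma selection_limit (u v : nat -> \bar R -> Omega -> R) :
  (forall n, A_circ T F (u n)) -> (forall n, A_circ T F (v n)) ->
  (forall n, sqdist (u n) (u n.+1) <= 16 ^- n) ->
  (forall n, sqdist (u n) (v n) <= 16 ^- n) ->
  {ae P, forall w, weak_upper T (fun n => (v n)^~ w) ((limit_proc T u)^~ w) /\
                   weak_lower T (fun n => (v n)^~ w) ((limit_proc T u)^~ w)}.
Proof.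
move=> Au Av uu uv.
have ru n := A_circ_rproc filF (Au n); have rv n := A_circ_rproc filF (Av n).
have H1 := sqdist_small ru (fun n => ru n.+1) uu.
have H2 := sqdist_small ru rv uv.
move: H1 H2; apply: filterS2 => w Hu Hv.
apply: (regularize_weak T0 (rat_limit01 T0 Au w) (@rat_limit_mono _ _ _ _ _ T0 _ Au w)).
  by move=> n; case: (rv n).
move=> k.
have cu : cvgn (fun n => u n (rat_time T k) w).
  apply: (@geometric_is_cvg _ _ (2 ^+ k.+1)); move: (Hu k); apply: filterS => n.
  by rewrite distrC.
have c1 : (fun n => u n (rat_time T k) w) @ \oo --> rat_limit T u w k.
  by rewrite /rat_limit cvg_limn_supE.
have c0 : (fun n => u n (rat_time T k) w - v n (rat_time T k) w) @ \oo --> 0.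
  apply/norm_cvg0P.
  have g0 : (fun n : nat => 2 ^+ k.+1 * 2 ^- n : R) @ \oo --> (2 ^+ k.+1 * 0 : R).
    apply: cvgMr; under eq_fun do rewrite -exprVn.
    by apply: cvg_expr; rewrite ger0_norm ?invr_ge0// invf_lt1// ltr1n.
  rewrite mulr0 in g0.
  apply: (squeeze_cvgr _ (cvg_cst 0) g0).
  by move: (Hv k); apply: filterS => n H; rewrite normr_ge0.
rewrite (_ : (fun n => v n (rat_time T k) w) =
  (fun n => u n (rat_time T k) w - (u n (rat_time T k) w - v n (rat_time T k) w))).
  by rewrite -[rat_limit T u w k]subr0; exact: cvgB.
by apply/funext => n; rewrite opprB addrC subrK.
Qed.

End Selection.

(** * Stopping times and regularity *)

Section StoppingTimes.
Context {R : realType} {d : measure_display} {Omega : measurableType d}.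
Variables (T : \bar R) (F : \bar R -> set (set Omega)).
Hypotheses (T0 : (0 < T)%E) (filF : is_filtration T F) (rcF : right_continuous_filtration T F).

Let sF t : time T t -> sigma_algebra setT (F t).
Proof. by case: filF => + _ _; apply. Qed.

Let F_mono s t : time T s -> time T t -> (s <= t)%E -> F s `<=` F t.
Proof. by case: filF => _ _; apply. Qed.

Let e := rat_time T.
Let Te k : time T (e k). Proof. exact: rat_time_time. Qed.

Lemma stopping_time_time tau w : stopping_time T F tau -> time T (tau w).
Proof. by case. Qed.

Lemma stopping_time_le (tau : Omega -> \bar R) : (forall w, time T (tau w)) ->
  (forall t, time T t -> (t < T)%E -> F t [set w | (tau w <= t)%E]) -> stopping_time T F tau.
Proof.
move=> Ttau H; split => // t Tt; have /andP[t0 tT] := Tt.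
move: tT; rewrite le_eqVlt => /predU1P[tE|tT]; last exact: H.
rewrite (_ : [set w | _] = setT); first by apply: sigma_algebra_setT; apply: sF.
by apply/seteqP; split => // w _ /=; rewrite tE; case/andP: (Ttau w).
Qed.

Lemma stopping_time_gt tau t : stopping_time T F tau -> time T t -> F t [set w | (t < tau w)%E].
Proof.
move=> [_ H] Tt; rewrite (_ : [set w | _] = ~` [set w | (tau w <= t)%E]).
  by apply: sigma_algebra_setC; [exact: sF|exact: H].
by apply/seteqP; split => w /=; rewrite ltNge => /negP.
Qed.

Lemma stopping_time_lt tau t : stopping_time T F tau -> time T t -> F t [set w | (tau w < t)%E].
Proof.
move=> [Ttau H] Tt; have /andP[t0 tT] := Tt.
rewrite (_ : [set w | _] = \bigcup_k (if (e k < t)%E then [set w | (tau w <= e k)%E] else set0)).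
  apply: sigma_algebra_cup; first exact: sF.
  move=> k; case: ifPn => [kt|_]; last by case: (sF Tt).
  by apply: (@F_mono (e k) t) => //; [exact: ltW|exact: H].
apply/seteqP; split => w /=.
- move=> wt; have /andP[w0 _] := Ttau w.
  have [k [wk kt]] := rat_time_dense w0 wt tT.
  by exists k => //; rewrite kt; exact: ltW.
- by move=> [k _]; case: ifPn => // kt /= wk; exact: le_lt_trans kt.
Qed.

Lemma measurable_stopping_time tau : stopping_time T F tau -> measurable_fun setT tau.
Proof.
move=> st; have [_ Fm _] := filF.
apply: (measurability _ (ErealGenOInfty.measurableE R)) => //.
move=> _ [_ [r ->] <-]; rewrite setTI.
have [r0|r0] := ltP r 0.
  rewrite (_ : _ @^-1` _ = setT); first exact: measurableT.
  rewrite -subTset => w _ /=; rewrite in_itv/= andbT.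
  by have /andP[q0 _] := st.1 w; rewrite (lt_le_trans _ q0).
have [rT|Tr] := ltP r%:E T; last first.
  rewrite (_ : _ @^-1` _ = set0); first exact: measurable0.
  rewrite -subset0 => w /=; rewrite in_itv/= andbT ltNge.
  by have /andP[_ qT] := st.1 w; rewrite (le_trans qT Tr).
have Tr : time T r%:E by rewrite /time/= lee_fin r0 ltW.
apply: (Fm _ Tr); rewrite (_ : _ @^-1` _ = [set w | (r%:E < tau w)%E]).
  exact: stopping_time_gt.
by apply/seteqP; split => w /=; rewrite in_itv/= andbT.
Qed.

Variable tau : nat -> Omega -> \bar R.
Hypothesis st_tau : forall n, stopping_time T F (tau n).

Definition inf_tail n (w : Omega) : \bar R := ereal_inf [set tau m w | m in [set m | (n <= m)%N]].
Definition lim_inf_st (w : Omega) : \bar R := ereal_sup [set inf_tail n w | n in setT].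

Lemma inf_tail_le n m w : (n <= m)%N -> (inf_tail n w <= tau m w)%E.
Proof. by move=> nm; apply: ereal_inf_lbound; exists m. Qed.

Lemma inf_tail_mono n m w : (n <= m)%N -> (inf_tail n w <= inf_tail m w)%E.
Proof.
move=> nm; apply: le_ereal_inf_tmp => _ [j /= mj <-]; apply: inf_tail_le.
exact: leq_trans mj.
Qed.

Lemma inf_tail_le_lim n w : (inf_tail n w <= lim_inf_st w)%E.
Proof. by apply: ereal_sup_ubound; exists n. Qed.

Lemma inf_tail_time n w : time T (inf_tail n w).
Proof.
apply/andP; split.
  by apply: le_ereal_inf_tmp => _ [j _ <-]; case/andP: ((st_tau j).1 w).
by apply: le_trans (inf_tail_le w (leqnn n)) _; case/andP: ((st_tau n).1 w).
Qed.

Lemma lim_inf_time w : time T (lim_inf_st w).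
Proof.
apply/andP; split.
  by apply: le_trans (inf_tail_le_lim 0 w); case/andP: (inf_tail_time 0 w).
by apply: ge_ereal_sup => _ [n _ <-]; case/andP: (inf_tail_time n w).
Qed.

Lemma inf_tail_stopping n : stopping_time T F (inf_tail n).
Proof.
apply: stopping_time_le => [w|t Tt tT]; first exact: inf_tail_time.
have /andP[t0 _] := Tt.
(* That an infimum of infinitely many stopping times is at most [t] is visible only just after [t]:
   some [tau m] must fall below each rational time in []t, s[]. *)
apply: (right_continuous_mem rcF) => // s ts sT.
have Ts : time T s by rewrite /time/= sT (le_trans t0)// ltW.
rewrite (_ : [set w | _] = \bigcap_k (if (t < e k)%E && (e k < s)%E then
    \bigcup_m (if (n <= m)%N then [set w | (tau m w < e k)%E] else set0) else setT)).
  apply: sigma_algebra_cap; first exact: sF.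
  move=> k; case: ifPn => [/andP[tk ks]|_]; last by apply: sigma_algebra_setT; apply: sF.
  apply: sigma_algebra_cup; first exact: sF.
  move=> m; case: ifPn => _; last by case: (sF Ts).
  by apply: (@F_mono (e k) s) => //; [exact: ltW|exact: stopping_time_lt].
apply/seteqP; split => w /=.
- move=> wt k _; case: ifPn => // /andP[tk ks].
  have /ereal_inf_lt[_ [m /= nm <-] mk] := le_lt_trans wt tk.
  by exists m => //; rewrite nm.
- move=> H; rewrite leNgt; apply/negP => tw.
  have tm : (t < Order.min (inf_tail n w) s)%E by rewrite lt_min tw ts.
  have mT : (Order.min (inf_tail n w) s <= T)%E by rewrite ge_min sT orbT.
  have [k [tk kjs]] := rat_time_dense t0 tm mT; move: kjs; rewrite lt_min => /andP[kw ks].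
  have := H k I; rewrite -/(e k) in tk kw ks *; rewrite tk ks /= => -[m _]; case: ifPn => // nm /= mk.
  by have := lt_trans kw (le_lt_trans (inf_tail_le w nm) mk); rewrite ltxx.
Qed.

Lemma lim_inf_stopping : stopping_time T F lim_inf_st.
Proof.
split => [w|t Tt]; first exact: lim_inf_time.
rewrite (_ : [set w | _] = \bigcap_n [set w | (inf_tail n w <= t)%E]).
  by apply: sigma_algebra_cap; [exact: sF|move=> n; exact: (inf_tail_stopping n).2].
apply/seteqP; split => w /=.
- by move=> wt n _; apply: le_trans (inf_tail_le_lim n w) wt.
- by move=> H; apply: ge_ereal_sup => _ [n _ <-]; exact: H.
Qed.

(** On this event the tail infima themselves announce the limit; off it some tail infimum equals the
    limit, and no later [tau m] comes before it. *)
Definition left_approached (w : Omega) := forall n, (inf_tail n w < lim_inf_st w)%E.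

(* The limit where it is approached strictly from the left; [T] elsewhere,
   so that [T] can be announced deterministically. *)
Definition pred_lim (w : Omega) : \bar R := if `[< left_approached w >] then lim_inf_st w else T.

(** Once a tail infimum attains the limit, the path is switched to the announcing times of [T]. The
    minimum keeps every term strictly below [T]. *)
Definition pred_lim_seq n (w : Omega) : \bar R :=
  Order.min (if (inf_tail n w < lim_inf_st w)%E then inf_tail n w else T) (announce T n).

(** A rational time between the two makes the strict inequality a countable union of events, each
    decided at its own time. The same events serve for [F t] and for the sigma-algebra just before
    [pred_lim]. *)
Let inf_tail_left n : exists A : nat -> set Omega,
  (forall k, F (e k) (A k)) /\
  (forall k w, A k w -> (inf_tail n w <= e k)%E /\ (e k < lim_inf_st w)%E) /\
  forall w, (inf_tail n w < lim_inf_st w)%E -> exists k, A k w.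
Proof.
exists (fun k => [set w | (inf_tail n w <= e k)%E] `&` [set w | (e k < lim_inf_st w)%E]); split.
  move=> k; apply: sigma_algebra_setI; first exact: sF.
    exact: (inf_tail_stopping n).2.
  by apply: stopping_time_gt; [exact: lim_inf_stopping|].
split => // w wl; have /andP[w0 _] := inf_tail_time n w; have /andP[_ wT] := lim_inf_time w.
have [k [wk kl]] := rat_time_dense w0 wl wT.
by exists k; split => //=; exact: ltW.
Qed.

(** If the limit exceeds [t], the strict inequality is automatic; otherwise a rational witness
    between the two times is at most [t]. *)
Let strict_le_mem n t : time T t ->
  F t [set w | (inf_tail n w < lim_inf_st w)%E /\ (inf_tail n w <= t)%E].
Proof.
move=> Tt; have [A [FA [A1 A2]]] := inf_tail_left n.
rewrite (_ : [set w | _] =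
  ([set w | (inf_tail n w <= t)%E] `&` [set w | (t < lim_inf_st w)%E]) `|`
  \bigcup_k (if (e k <= t)%E then A k else set0)).
  apply: sigma_algebra_setU; first exact: sF.
    apply: sigma_algebra_setI; [exact: sF|exact: (inf_tail_stopping n).2|].
    by apply: stopping_time_gt => //; exact: lim_inf_stopping.
  apply: sigma_algebra_cup; first exact: sF.
  move=> k; case: ifPn => kt; last by case: (sF Tt).
  by apply: (@F_mono (e k) t).
apply/seteqP; split => w /=.
- move=> [wl wt]; have [tl|lt] := ltP t (lim_inf_st w); first by left.
  right; have [k Ak] := A2 w wl; exists k => //.
  by have [_ kl] := A1 k w Ak; rewrite (le_trans (ltW kl) lt).
- case=> [[wt tl]|[k _]]; first by split => //; exact: le_lt_trans tl.
  by case: ifPn => // kt /A1[wk kl]; split; [exact: le_lt_trans kl|exact: le_trans kt].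
Qed.

Lemma pred_lim_seq_stopping n : stopping_time T F (pred_lim_seq n).
Proof.
apply: stopping_time_le => [w|t Tt tT].
  rewrite /pred_lim_seq; apply/andP; split; last by rewrite ge_min (ltW (announce_lt n T0)) orbT.
  rewrite le_min announce_ge0// andbT; case: ifP => _; last exact: ltW.
  by case/andP: (inf_tail_time n w).
rewrite (_ : [set w | _] =
  [set w | (inf_tail n w < lim_inf_st w)%E /\ (inf_tail n w <= t)%E] `|`
  (if (announce T n <= t)%E then setT else set0)).
  apply: sigma_algebra_setU; [exact: sF|exact: strict_le_mem|].
  by case: ifP => _; [by apply: sigma_algebra_setT; apply: sF|case: (sF Tt)].
apply/seteqP; split => w /=; rewrite /pred_lim_seq ge_min.
- case/orP => [|H]; last by right; rewrite H.
  by case: ifP => [wl wt|_]; [left|rewrite leNgt tT].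
- by case=> [[-> ->]//|]; case: ifP => // _; rewrite orbT.
Qed.

Lemma pred_lim_time w : time T (pred_lim w).
Proof. by rewrite /pred_lim; case: ifP => _; [exact: lim_inf_time|exact: timeT]. Qed.

Lemma lim_inf_le_pred w : (lim_inf_st w <= pred_lim w)%E.
Proof. by rewrite /pred_lim; case: ifP => // _; case/andP: (lim_inf_time w). Qed.

Lemma pred_lim_stopping : stopping_time T F pred_lim.
Proof.
apply: stopping_time_le => [w|t Tt tT]; first exact: pred_lim_time.
rewrite (_ : [set w | _] = [set w | (lim_inf_st w <= t)%E] `&`
  \bigcap_n [set w | (inf_tail n w < lim_inf_st w)%E /\ (inf_tail n w <= t)%E]).
  apply: sigma_algebra_setI; [exact: sF|exact: lim_inf_stopping.2|].
  by apply: sigma_algebra_cap; [exact: sF|move=> n; exact: strict_le_mem].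
apply/seteqP; split => w /=; rewrite /pred_lim.
- case: asboolP => [wB lt|_]; last by rewrite leNgt tT.
  by split => // n _; split; [exact: wB|exact: le_trans (inf_tail_le_lim n w) lt].
- move=> [lt H]; case: asboolP => // wB; exfalso; apply: wB => n.
  by have [] := H n I.
Qed.

Lemma pred_lim_gt0 w : (0 < pred_lim w)%E.
Proof.
rewrite /pred_lim; case: asboolP => // wB.
by apply: le_lt_trans (wB 0%N); case/andP: (inf_tail_time 0 w).
Qed.

Lemma pred_lim_seq_lt n w : (pred_lim_seq n w < pred_lim w)%E.
Proof.
rewrite /pred_lim_seq /pred_lim gt_min; case: asboolP => [wB|_]; first by rewrite wB wB.
by rewrite announce_lt// orbT.
Qed.

Lemma pred_lim_seq_gt w s : (s < pred_lim w)%E -> \forall n \near \oo, (s < pred_lim_seq n w)%E.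
Proof.
rewrite /pred_lim; case: asboolP => [wB sl|wB sT].
- have /ereal_sup_gt[_ [n0 _ <-] sn0] := sl.
  have sT : (s < T)%E by rewrite (lt_le_trans sl)//; case/andP: (lim_inf_time w).
  near=> n; rewrite /pred_lim_seq lt_min wB; apply/andP; split.
    apply: lt_le_trans sn0 _; apply: inf_tail_mono; near: n; exact: nbhs_infty_ge.
  by near: n; exact: announce_gt.
- have [n0 /negP Hn0] : exists n, ~ (inf_tail n w < lim_inf_st w)%E by exact/existsNP.
  near=> n; rewrite /pred_lim_seq.
  have n0n : (n0 <= n)%N by near: n; exact: nbhs_infty_ge.
  rewrite ifN; last by apply: contra Hn0; apply: le_lt_trans; exact: inf_tail_mono.
  by rewrite lt_min sT /=; near: n; exact: announce_gt.
Unshelve. all: by end_near. Qed.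

Lemma pred_lim_predictable : predictable_time T F pred_lim.
Proof.
split; first exact: pred_lim_stopping.
exists pred_lim_seq; split; first exact: pred_lim_seq_stopping.
move=> w; have mono : {homo (fun n => pred_lim_seq n w) : m n / (m <= n)%N >-> (m <= n)%E}.
  move=> m n mn; rewrite /pred_lim_seq.
  case: (ltP (inf_tail n w) (lim_inf_st w)) => wl.
    rewrite (le_lt_trans (inf_tail_mono w mn) wl) le_min !ge_min.
    by rewrite inf_tail_mono// announce_le// orbT.
  rewrite [leRHS](min_idPr _); last by rewrite ltW// announce_lt.
  by rewrite ge_min announce_le// orbT.
split => //; last by move=> _ n; exact: pred_lim_seq_lt.
have -> : pred_lim w = ereal_sup (range (fun n => pred_lim_seq n w)).
  apply/eqP; rewrite eq_le; apply/andP; split; last first.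
    by apply: ge_ereal_sup => _ [n _ <-]; apply: ltW; exact: pred_lim_seq_lt.
  rewrite leNgt; apply/negP => H.
  have [n _ Hn] := pred_lim_seq_gt H.
  have := Hn n (leqnn n); rewrite /= ltNge => /negP; apply.
  by apply: ereal_sup_ubound; exists n.
exact: ereal_nondecreasing_cvgn.
Qed.

Let G := F_minus T F pred_lim.

Lemma F_minus_sigma : sigma_algebra setT G.
Proof. exact: smallest_sigma_algebra. Qed.

Lemma F_minus_mem t A : time T t -> F t A -> G (A `&` [set w | (t < pred_lim w)%E]).
Proof.
move=> Tt FA; apply: sub_sigma_algebra; right; exists t; split => //; exists A.
by split.
Qed.

Lemma F_minus_measurable A : G A -> measurable A.
Proof.
apply: smallest_sub; first exact: sigma_algebra_measurable.
have [_ Fm _] := filF.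
move=> B [FB|[t [Tt [C [FC ->]]]]]; first by apply: (Fm 0%E) => //; exact: time0.
apply: measurableI; first exact: (Fm t).
by apply: (Fm t) => //; apply: stopping_time_gt => //; exact: pred_lim_stopping.
Qed.

(** Each strict inequality is witnessed at a rational time below the limit, hence strictly before
    [pred_lim]. Regularity can therefore be applied on this event. *)
Lemma left_approached_mem : G left_approached.
Proof.
rewrite (_ : left_approached = \bigcap_n [set w | (inf_tail n w < lim_inf_st w)%E]); last first.
  by apply/seteqP; split => w H; [move=> n _; exact: H|move=> n; exact: H].
apply: sigma_algebra_cap; first exact: F_minus_sigma.
move=> n; have [A [FA [A1 A2]]] := inf_tail_left n.
rewrite (_ : [set w | _] = \bigcup_k (A k `&` [set w | (e k < pred_lim w)%E])).
  by apply: sigma_algebra_cup; [exact: F_minus_sigma|move=> k; exact: F_minus_mem].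
apply/seteqP; split => w /=.
- move=> /A2[k Ak]; exists k => //; split => //=.
  by have [_ kl] := A1 k w Ak; exact: lt_le_trans (lim_inf_le_pred w).
- by move=> [k _ [/A1[wk kl] _]]; exact: le_lt_trans kl.
Qed.

Lemma before_lim_mem m : G [set w | (tau m w < lim_inf_st w)%E].
Proof.
rewrite (_ : [set w | _] = \bigcup_k (([set w | (tau m w <= e k)%E] `&` [set w | (e k < lim_inf_st w)%E])
   `&` [set w | (e k < pred_lim w)%E])).
  apply: sigma_algebra_cup; first exact: F_minus_sigma.
  move=> k; apply: F_minus_mem => //; apply: sigma_algebra_setI; first exact: sF.
    exact: (st_tau m).2.
  by apply: stopping_time_gt => //; exact: lim_inf_stopping.
apply/seteqP; split => w /=.
- move=> wl; have /andP[w0 _] := (st_tau m).1 w; have /andP[_ lT] := lim_inf_time w.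
  have [k [wk kl]] := rat_time_dense w0 wl lT; exists k => //; split.
    by split => //=; exact: ltW.
  by exact: lt_le_trans (lim_inf_le_pred w).
- by move=> [k _ [[wk kl] _]]; exact: le_lt_trans kl.
Qed.

End StoppingTimes.

(** * Vanishing conditional means against bounded weights *)

Section WeightedCondexp.
Context {R : realType} {d : measure_display} {Omega : measurableType d}.
Variable P : probability Omega R.

Lemma integrable_prod_dom (H : Omega * measurableTypeR R -> R) (M : Omega -> R) :
  measurable_fun setT H -> (forall p, `|H p| <= M p.1) -> P.-integrable setT (EFin \o M) ->
  (P \x (unif01 : measure (measurableTypeR R) R))%E.-integrable setT (EFin \o H).
Proof.
move=> mH HM iM.
have mH' : measurable_fun setT (EFin \o H) by exact/measurable_EFinP.
have [mM _] := integrableP _ _ _ iM.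
apply/(@integrable12ltyP _ _ _ _ R P unif01 _ mH').
apply: (le_lt_trans _ (integrableP _ _ _ iM).2).
apply: ge0_le_integral => //.
- by move=> w _; apply: integral_ge0.
- apply: (measurable_fun_fubini_tonelli_F (m2 := unif01) (fun p => `|(H p)%:E|%E)) => //.
  exact: measurableT_comp.
- exact: measurableT_comp.
- move=> w _ /=.
  apply: (@le_trans _ _ (\int[unif01]_u (cst `|M w|%:E u))%E).
    apply: ge0_le_integral => //.
    + apply/measurable_EFinP; apply: measurableT_comp => //.
      exact: (measurableT_comp mH (measurable_fun_pair (measurable_cst w) (@measurable_id _ _ setT))).
    + by move=> u _ /=; rewrite lee_fin (le_trans (HM _))// ler_norm.
  by rewrite integral_cst//= unif01_setT mule1.
Qed.

(* Layer-cake: [Z w] is the probability that a uniform variable is below [Z w]. *)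
Lemma condexp_zero_weight (G : set (set Omega)) (X Z : Omega -> R) (A : set Omega) :
  sigma_algebra setT G -> (forall B, G B -> measurable B) ->
  condexp_zero P G X -> P.-integrable setT (EFin \o X) -> G A ->
  (forall w, 0 <= Z w <= 1) -> (forall a : R, G [set w | Z w < a]) ->
  (\int[P]_w (X w * \1_A w * Z w)%:E = 0)%E.
Proof.
move=> sG mG X0 iX GA Z01 GZ.
have mA := mG _ GA.
have /integrableP[mX _] := iX; have {}mX : measurable_fun setT X by exact/measurable_EFinP.
have mZ : measurable_fun setT Z.
  apply: (measurability _ (RGenInftyO.measurableE R)) => //.
  move=> _ [_ [u ->] <-]; rewrite setTI (_ : _ @^-1` _ = [set w | Z w < u]); first exact: mG.
  by apply/seteqP; split => w /=; rewrite in_itv.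
pose H (p : Omega * measurableTypeR R) : R := X p.1 * \1_A p.1 * (if (p.2 : R) <= Z p.1 then 1 else 0).
have mH : measurable_fun setT H.
  apply: measurable_funM; first apply: measurable_funM.
  - exact: measurableT_comp mX _.
  - by apply: (measurableT_comp (f := \1_A : Omega -> R)); [exact: measurable_indic|exact: measurable_fst].
  - apply: measurable_fun_ifT => //.
    by apply: measurable_fun_ler; [exact: measurable_snd|exact: measurableT_comp mZ _].
have HX p : `|H p| <= `|X p.1|.
  rewrite /H !normrM -mulrA ler_piMr// mulr_ile1//.
    by rewrite indicE; case: (_ \in _); rewrite ?normr1 ?normr0.
  by case: ifP => _; rewrite ?normr1 ?normr0.
have iH : (P \x (unif01 : measure (measurableTypeR R) R))%E.-integrable setT (EFin \o H).
  by apply: (integrable_prod_dom mH HX); exact: (integrable_abse iX).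
transitivity (\int[P]_w fubini_F (unif01 : measure (measurableTypeR R) R) (EFin \o H) w)%E.
  apply: eq_integral => w _; rewrite /fubini_F /H /=.
  transitivity (\int[unif01]_u ((X w * \1_A w)%:E * (\1_[set u : R | u <= Z w] u)%:E))%E; last first.
    apply: eq_integral => u _; rewrite -EFinM [X in (_ * X)%:E = _]indicE; case: leP => uZ; first by rewrite mem_set.
    by rewrite memNset//=; apply/negP; rewrite -ltNge.
  have mU : measurable ([set u : R | u <= Z w] : set (measurableTypeR R)).
    rewrite (_ : [set u : R | u <= Z w] = `]-oo, Z w]%classic).
      exact (measurable_itv (Interval (BInfty _ true) (BRight (Z w)))).
    by apply/seteqP; split => u /=; rewrite in_itv.
  rewrite integralZl//; last exact: integrable_indic.
  by rewrite integral_indic// setIT EFinM; congr (_ * _)%E; apply/esym; exact: unif01_le.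
rewrite (integral12_prod_meas1 iH) -(integral21_prod_meas1 iH).
(* At a fixed level [u] the weight is the indicator of [u <= Z], an event of [G], and the hypothesis
   applies to its intersection with [A]. *)
apply: integral0_eq => u _; rewrite /fubini_G /H /=.
rewrite -(X0 (A `&` [set w | u <= Z w])); last first.
  apply: sigma_algebra_setI => //.
  rewrite (_ : [set w | u <= Z w] = ~` [set w | Z w < u]).
    exact: sigma_algebra_setC.
  by apply/seteqP; split => w /=; rewrite leNgt => /negP.
rewrite [RHS]integral_mkcond; apply: eq_integral => w _.
rewrite patchE indicE in_setI; case: (w \in A); rewrite ?mulr0 ?mul0r//= mulr1.
case: leP => uZ; first by rewrite mem_set// mulr1.
by rewrite memNset ?mulr0//=; apply/negP; rewrite -ltNge.
Qed.

End WeightedCondexp.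

(** * Expectations of a regular process along converging stopping times *)

Section RegularConvergence.
Context {R : realType} {d : measure_display} {Omega : measurableType d}.
Variables (P : probability Omega R) (T : \bar R) (F : \bar R -> set (set Omega)).
Hypotheses (T0 : (0 < T)%E) (filF : is_filtration T F) (rcF : right_continuous_filtration T F).
Variables (g c : \bar R -> Omega -> R) (Mg : Omega -> R).
Hypotheses (cg : forall w, cadlag T (g^~ w)) (bg : bproc T g Mg) (iMg : P.-integrable setT (EFin \o Mg))
  (rg : regular P T F g).
(** The factor [c] stands for the mass the opponent has left. It is continuous, so every jump of
    [g c] is a jump of [g]. *)
Hypotheses (jc : jointly_measurable T c) (c01 : forall t w, time T t -> 0 <= c t w <= 1)
  (c_mono : forall s t w, time T s -> time T t -> (s <= t)%E -> c t w <= c s w)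
  (c_right : forall t w, time T t -> (t < T)%E ->
     (c^~ w) @ within [set s | (t < s)%E] (nbhs t) --> c t w)
  (c_left : forall t w, time T t -> (0 < t)%E ->
     (c^~ w) @ within [set s | (s < t)%E] (nbhs t) --> c t w)
  (c_adapted : forall k (a : R), F (rat_time T k) [set w | c (rat_time T k) w < a]).
Variable tau : nat -> Omega -> \bar R.
Hypothesis st_tau : forall n, stopping_time T F (tau n).

Let sig := lim_inf_st tau.
Let eta := pred_lim T tau.
Let etan := pred_lim_seq T tau.
Let st_sig := lim_inf_stopping T0 filF rcF st_tau.
Let st_eta := pred_lim_stopping T0 filF rcF st_tau.
Let Y t w := g t w * c t w.

Let jY : jointly_measurable T Y.
Proof. by apply: jmM => //; case: bg. Qed.

Let Y_le t w : time T t -> `|Y t w| <= Mg w.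
Proof.
move=> Tt; have /andP[c0 c1] := c01 w Tt.
by rewrite /Y normrM (le_trans _ (bg.2 t w Tt))// ler_piMr// ger0_norm.
Qed.

Let measurable_at (X : \bar R -> Omega -> R) (rho : Omega -> \bar R) : jointly_measurable T X ->
  stopping_time T F rho -> measurable_fun setT (fun w => X (rho w) w).
Proof.
move=> jX sr; apply: (jm_comp jX); last exact: measurable_id.
- exact: measurable_stopping_time sr.
- by move=> w; case: sr.
Qed.

Let Xjump w := g (eta w) w - leftlim (g^~ w) (eta w).

Let etan_time n w : time T (etan n w).
Proof. by have [+ _] := pred_lim_seq_stopping T0 filF rcF st_tau n; apply. Qed.

Let leftlim_g w : (fun n => g (etan n w) w) @ \oo --> leftlim (g^~ w) (eta w).
Proof.
apply: (cvg_leftlim_seq (cg w)).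
- exact: pred_lim_time.
- exact: pred_lim_gt0.
- by move=> n; exact: pred_lim_seq_lt.
- by move=> s; exact: pred_lim_seq_gt.
Qed.

Let mX : measurable_fun setT Xjump.
Proof.
apply: measurable_funB; first by apply: measurable_at => //; case: bg.
apply: (@measurable_fun_cvg _ _ _ _ (fun n w => g (etan n w) w)).
- move=> n; apply: measurable_at; first by case: bg.
  exact: pred_lim_seq_stopping.
- by move=> w _; exact: leftlim_g.
Qed.

Let X_le w : `|Xjump w| <= 2 * Mg w.
Proof.
have h1 : `|g (eta w) w| <= Mg w by apply: bg.2; exact: pred_lim_time.
have h2 : `|leftlim (g^~ w) (eta w)| <= Mg w.
  have H : (fun n => `|g (etan n w) w|) @ \oo --> `|leftlim (g^~ w) (eta w)|.
    by apply: cvg_norm; exact: leftlim_g.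
  rewrite -(cvg_lim _ H)//; apply: limr_le; first exact: cvgP H.
  apply: nearW => n; apply: bg.2; exact: etan_time.
by have := ler_normB (g (eta w) w) (leftlim (g^~ w) (eta w)); rewrite /Xjump; lra.
Qed.

Let iX : P.-integrable setT (EFin \o Xjump).
Proof.
have H : P.-integrable setT (fun w => (2%:E * (Mg w)%:E)%E) by exact: integrableZl.
apply: (le_integrable _ _ _ H) => //; first exact/measurable_EFinP.
by move=> w _; rewrite /= lee_fin (le_trans (X_le w))// ler_norm.
Qed.

Let Bm m : set Omega := left_approached tau `&` [set w | (tau m w < sig w)%E].

Let G_Bm m : F_minus T F eta (Bm m).
Proof.
apply: (sigma_algebra_setI (F_minus_sigma T F tau)).
  exact: (left_approached_mem T0 filF rcF st_tau).
exact: (before_lim_mem T0 filF rcF st_tau).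
Qed.

(** Since [c] is nonincreasing and left-continuous, it is below [a] at [eta] exactly when it is so
    at some rational time before [eta]: the weight is known just before the jump. *)
Let c_eta_mem (a : R) : F_minus T F eta [set w | c (eta w) w < a].
Proof.
rewrite (_ : [set w | _] = \bigcup_k ([set w | c (rat_time T k) w < a] `&`
   [set w | (rat_time T k < eta w)%E])).
  apply: (sigma_algebra_cup (F_minus_sigma T F tau)).
  by move=> k; apply: F_minus_mem => //; exact: rat_time_time.
apply/seteqP; split => w /=.
- move=> ca; have Teta := pred_lim_time T0 st_tau w.
  have eta0 := pred_lim_gt0 T0 st_tau w.
  have ea : 0 < a - c (eta w) w by rewrite subr_gt0.
  have /(cvg_leftP _ _ eta0)/(_ _ ea)[s0 /andP[s00 s0e] Hs] := @c_left _ w Teta eta0.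
  have [k [sk ke]] := rat_time_dense s00 s0e (proj2 (andP Teta)).
  exists k => //; split => //=.
  by have := le_lt_trans (ler_norm _) (Hs _ sk ke); lra.
- move=> [k _ [ca ke]]; apply: le_lt_trans ca; apply: c_mono.
  + exact: rat_time_time.
  + exact: pred_lim_time.
  + exact: ltW.
Qed.

Let zero_weight m : (\int[P]_w (Xjump w * \1_(Bm m) w * c (eta w) w)%:E = 0)%E.
Proof.
apply: (condexp_zero_weight (F_minus_sigma T F tau) (F_minus_measurable T0 filF rcF st_tau)
  (rg (pred_lim_predictable T0 filF rcF st_tau)) iX (G_Bm m) _ c_eta_mem).
by move=> w; apply: c01; exact: (pred_lim_time T0 st_tau).
Qed.

(** A compensated error. When [tau m] lies strictly before the limit, [Y (tau m)] tends to the left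
    limit of [Y] and misses the jump; the last term restores it and has mean zero, so the error
    tends to 0 without changing its expectation. *)
Let Rm m w := Y (tau m w) w - Y (sig w) w + Xjump w * \1_(Bm m) w * c (eta w) w.

Let mXB m : measurable_fun setT (fun w => Xjump w * \1_(Bm m) w * c (eta w) w).
Proof.
apply: measurable_funM; first apply: measurable_funM => //.
- by apply: measurable_indic; apply: (F_minus_measurable T0 filF rcF st_tau); exact: G_Bm.
- exact: measurable_at.
Qed.

Let mRm m : measurable_fun setT (Rm m).
Proof.
apply: measurable_funD => //; apply: measurable_funB; exact: measurable_at.
Qed.

Let XB_le m w : `|Xjump w * \1_(Bm m) w * c (eta w) w| <= 2 * Mg w.
Proof.
have /andP[c0 c1] := c01 w (pred_lim_time T0 st_tau w).
rewrite normrM normrM (le_trans _ (X_le w))// -mulrA ler_piMr// mulr_ile1//.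
  by rewrite indicE; case: (_ \in _); rewrite ?normr1 ?normr0.
by rewrite ger0_norm.
Qed.

Let Rm_le m w : `|Rm m w| <= 4 * Mg w.
Proof.
have h1 := Y_le w (stopping_time_time w (st_tau m)).
have h2 := Y_le w (stopping_time_time w st_sig).
have h3 := XB_le m w.
rewrite /Rm (le_trans (ler_normD _ _))//.
by have := ler_normB (Y (tau m w) w) (Y (sig w) w); lra.
Qed.

Let Y_right w t : time T t -> (t < T)%E ->
  (Y^~ w) @ within [set s | (t < s)%E] (nbhs t) --> Y t w.
Proof. by move=> Tt tT; apply: cvgM; [exact: (cg w).1|exact: c_right]. Qed.

Let Y_left w t : time T t -> (0 < t)%E ->
  (Y^~ w) @ within [set s | (s < t)%E] (nbhs t) --> leftlim (g^~ w) t * c t w.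
Proof. by move=> Tt t0; apply: cvgM; [exact: leftlim_cvg (cg w) Tt t0|exact: c_left]. Qed.

Let Rm_cvg w : (forall s, (sig w < s)%E -> \forall m \near \oo, (tau m w < s)%E) ->
  (fun m => Rm m w) @ \oo --> (0 : R).
Proof.
move=> up; apply/cvgr0Pnorm_lt => e e0.
have Tsig := stopping_time_time w st_sig; have /andP[sig0 sigT] := Tsig.
have right_ok : \forall m \near \oo, (sig w <= tau m w)%E -> `|Y (tau m w) w - Y (sig w) w| < e.
  have [sT|sT] := ltP (sig w) T; last first.
    apply: nearW => m sm; have /andP[_ tT] := stopping_time_time w (st_tau m).
    have -> : tau m w = sig w by apply/eqP; rewrite eq_le sm (le_trans tT sT).
    by rewrite subrr normr0.
  have s_oo : (sig w < +oo)%E by rewrite (lt_le_trans sT)// leey.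
  have /(cvg_rightP _ _ sig0 s_oo)/(_ _ e0)[s0 ss0 Hs] := @Y_right w _ Tsig sT.
  have := up _ ss0; apply: filterS => m ms; rewrite le_eqVlt => /predU1P[<-|sm].
    by rewrite subrr normr0.
  exact: Hs.
have [wB|wB] := pselect (left_approached tau w).
(* Indices with [tau m] at or after the limit use right-continuity; for those before it, the
   compensator turns [Y sig] into the left limit of [Y]. *)
- have etaE : eta w = sig w by rewrite /eta /pred_lim asboolT.
  have sgt0 : (0 < sig w)%E.
    by apply: le_lt_trans (wB 0%N); case/andP: (inf_tail_time st_tau 0 w).
  have /(cvg_leftP _ _ sgt0)/(_ _ e0)[s0 /andP[s00 s0s] Hs] := @Y_left w _ Tsig sgt0.
  have /ereal_sup_gt[_ [n0 _ <-] sn0] := s0s.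
  have left_ok : \forall m \near \oo, (s0 < tau m w)%E.
    by exists n0 => // m /= n0m; apply: lt_le_trans sn0 _; exact: inf_tail_le.
  move: right_ok left_ok; apply: filterS2 => m rm lm.
  rewrite /Rm indicE; have [sm|ms] := leP (sig w) (tau m w).
    rewrite memNset ?mulr0 ?mul0r ?addr0; first exact: rm.
    by move=> [_ /=]; rewrite ltNge sm.
  rewrite mem_set; last by split.
  rewrite mulr1 /Xjump etaE.
  rewrite (_ : _ + _ = Y (tau m w) w - leftlim (g^~ w) (sig w) * c (sig w) w).
    exact: Hs.
  by rewrite /Y; ring.
(* Once a tail infimum equals the limit, only right-continuity is at stake. *)
- have [n0 /negP Hn0] : exists n, ~ (inf_tail tau n w < sig w)%E by exact/existsNP.
  have late : \forall m \near \oo, (sig w <= tau m w)%E.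
    exists n0 => // m /= n0m; rewrite leNgt; apply: contra Hn0 => H.
    by apply: le_lt_trans H; exact: inf_tail_le.
  move: right_ok late; apply: filterS2 => m rm lm.
  rewrite /Rm indicE memNset ?mulr0 ?mul0r ?addr0; first exact: rm.
  by move=> [].
Qed.

Let iMg4 : P.-integrable setT (fun w => (4 * Mg w)%:E).
Proof.
have H : P.-integrable setT (fun w => (4%:E * (Mg w)%:E)%E) by exact: integrableZl.
by apply: eq_integrable H => // w _; rewrite EFinM.
Qed.

Let iY rho : stopping_time T F rho -> P.-integrable setT (fun w => (Y (rho w) w)%:E).
Proof.
move=> sr; apply: (le_integrable _ _ _ iMg) => //.
  by apply/measurable_EFinP; exact: measurable_at.
by move=> w _; rewrite /= lee_fin (le_trans (Y_le w (stopping_time_time w sr)))// ler_norm.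
Qed.

(* Along stopping times converging to [tau0], the payoff can only jump at the
   predictable time [pred_lim], where regularity makes the expected jump vanish. *)
Lemma regular_stopping_cvg (tau0 : Omega -> \bar R) :
  measurable_fun setT tau0 -> (forall w, time T (tau0 w)) ->
  {ae P, forall w, sig w = tau0 w /\
     forall s, (tau0 w < s)%E -> \forall m \near \oo, (tau m w < s)%E} ->
  (fun m => \int[P]_w (Y (tau m w) w)%:E)%E @ \oo --> (\int[P]_w (Y (tau0 w) w)%:E)%E.
Proof.
move=> m0 T_tau0 aeT.
have mY0 : measurable_fun setT (fun w => Y (tau0 w) w).
  exact: (jm_comp jY m0 T_tau0 (@measurable_id _ _ setT)).
have -> : (\int[P]_w (Y (tau0 w) w)%:E = \int[P]_w (Y (sig w) w)%:E)%E.
  apply: ae_eq_integral => //.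
  - exact/measurable_EFinP.
  - by apply/measurable_EFinP; exact: measurable_at.
  - by move: aeT; apply: filterS => w [-> _] _.
have [_ _ H] := @dominated_convergence _ _ _ P setT measurableT
  (fun m w => (Rm m w)%:E) (cst 0%E) (fun w => (4 * Mg w)%:E)
  (fun m => (measurable_EFinP _ _).2 (@mRm m)) (measurable_cst _)
  ltac:(move: aeT; apply: filterS => w [sE up] _; apply: cvg_EFin; [exact: nearW|apply: Rm_cvg; rewrite sE; exact: up])
  iMg4 ltac:(apply: aeW => w m _; rewrite lee_fin; exact: Rm_le).
rewrite integral0 in H.
have E m : (\int[P]_w (Y (tau m w) w)%:E = \int[P]_w (Rm m w)%:E + \int[P]_w (Y (sig w) w)%:E)%E.
  have i3 : P.-integrable setT (fun w => (Xjump w * \1_(Bm m) w * c (eta w) w)%:E).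
    have H2 : P.-integrable setT (fun w => (2%:E * (Mg w)%:E)%E) by exact: integrableZl.
    apply: (le_integrable _ _ _ H2) => //; first by apply/measurable_EFinP; exact: mXB.
    by move=> w _; rewrite /= lee_fin (le_trans (XB_le m w))// ler_norm.
  have iD : P.-integrable setT (fun w => ((Y (tau m w) w)%:E - (Y (sig w) w)%:E)%E).
    by apply: integrableB => //; exact: iY.
  transitivity (\int[P]_w ((Y (tau m w) w)%:E - (Y (sig w) w)%:E + (Xjump w * \1_(Bm m) w * c (eta w) w)%:E)
     + \int[P]_w (Y (sig w) w)%:E)%E => //.
  rewrite integralD// integralB//; [|exact: iY|exact: iY].
  by rewrite zero_weight adde0 subeK//; exact: integrable_fin_num (iY st_sig).
under eq_fun do rewrite E.
have sfin : (\int[P]_w (Y (sig w) w)%:E)%E \is a fin_num by exact: integrable_fin_num (iY st_sig).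
have K := cvgeD (fin_num_adde_defl 0%E sfin) H (cvg_cst (\int[P]_w (Y (sig w) w)%:E)%E).
by rewrite add0e in K; exact: K.
Qed.

End RegularConvergence.

(** * Upper semicontinuity of the payoff *)

Section Remaining.
Context {R : realType} {d : measure_display} {Omega : measurableType d}.
Variables (T : \bar R) (F : \bar R -> set (set Omega)).
Hypotheses (T0 : (0 < T)%E) (filF : is_filtration T F).

(* [1 - xi] made left-continuous at [T]. *)
Definition remaining (xi : \bar R -> Omega -> R) (t : \bar R) (w : Omega) : R :=
  if (t < T)%E then 1 - xi t w else 1 - leftlim (xi^~ w) T.

Variable xi : \bar R -> Omega -> R.
Hypotheses (axi : A_circ T F xi) (lxi : forall w, left_continuous_path T (xi^~ w)).
Let rxi : rproc T xi := A_circ_rproc filF axi.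
Let c := remaining xi.

Lemma remainingT w : c T w = jump (xi^~ w) T.
Proof.
by rewrite /c /remaining ltxx /jump gt_eqF//; have [_ _ _ ->] := axi.2 w.
Qed.

Lemma remaining01 t w : time T t -> 0 <= c t w <= 1.
Proof.
move=> Tt; rewrite /c /remaining; case: ifP => tT.
  by have /andP[x0 x1] := rproc01 w T0 rxi Tt; apply/andP; split; lra.
have := jump01 w T0 rxi; rewrite -remainingT /c /remaining ltxx.
by [].
Qed.

Lemma remaining_jm : jointly_measurable T c.
Proof.
rewrite /jointly_measurable /c /remaining.
have mD : measurable (time T `*` [set: Omega]) by apply: measurableX => //; exact: measurable_time.
apply: (@measurable_fun_if _ _ _ _ (fun p : \bar R * Omega => 1 - xi p.1 p.2)
  (fun p : \bar R * Omega => 1 - leftlim (xi^~ p.2) T) _ mD (fun p : \bar R * Omega => (p.1 < T)%E)).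
- apply: measurable_fun_lte => //; first exact: measurable_funTS.
- apply: (measurable_funS mD); first by move=> p [].
  by apply: measurable_funB => //; exact: (rproc_jm T0 rxi).
- apply: measurable_funB => //.
  apply: (measurable_funS measurableT) => //.
  exact: (measurableT_comp (measurable_leftlim T0 rxi) measurable_snd).
Qed.

Lemma remaining_mono s t w : time T s -> time T t -> (s <= t)%E -> c t w <= c s w.
Proof.
move=> Ts Tt st; have [px _] := rxi; have [cx nd _ _] := px w.
have /andP[s0 sT] := Ts; have /andP[t0 tT] := Tt.
rewrite /c /remaining; have [tT'|tT'] := ltP t T.
  by rewrite (le_lt_trans st tT') lerD2l lerN2 nd.
have [sT'|sT'] := ltP s T => //.
by rewrite lerD2l lerN2; exact: (leftlim_ge T0 (px w) (timeT T0)).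
Qed.

Lemma remaining_right t w : time T t -> (t < T)%E ->
  (c^~ w) @ within [set s | (t < s)%E] (nbhs t) --> c t w.
Proof.
move=> Tt tT; have [px _] := rxi; have [[rc _] _ _ _] := px w.
have /andP[t0 _] := Tt; have t_oo : (t < +oo)%E by rewrite (lt_le_trans tT)// leey.
apply/(cvg_rightP _ _ t0 t_oo) => e e0.
have /(cvg_rightP _ _ t0 t_oo)/(_ _ e0)[s0 ts0 Hs] := rc t Tt tT.
exists (Order.min s0 T); first by rewrite lt_min ts0.
move=> s ts; rewrite lt_min => /andP[ss0 sT]; rewrite /c /remaining tT sT.
by rewrite opprD addrACA subrr add0r -opprD normrN; exact: Hs.
Qed.

Lemma remaining_left t w : time T t -> (0 < t)%E ->
  (c^~ w) @ within [set s | (s < t)%E] (nbhs t) --> c t w.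
Proof.
move=> Tt t0; have [px _] := rxi; have [cx _ _ _] := px w.
have /andP[_ tT] := Tt.
apply/(cvg_leftP _ _ t0) => e e0.
have /(cvg_leftP _ _ t0)/(_ _ e0)[s0 ts0 Hs] := leftlim_cvg cx Tt t0.
exists s0 => // s ss0 st.
have sT : (s < T)%E := lt_le_trans st tT.
have -> : c t w = 1 - leftlim (xi^~ w) t.
  rewrite /c /remaining; move: tT; rewrite le_eqVlt => /predU1P[->|tT]; first by rewrite ltxx.
  by rewrite tT lxi.
rewrite /c /remaining sT opprD addrACA subrr add0r -opprD normrN; exact: Hs.
Qed.

Lemma remaining_adapted k (a : R) : F (rat_time T k) [set w | c (rat_time T k) w < a].
Proof.
have Tk := rat_time_time k T0; have [sF _ _] := filF.
rewrite (_ : [set w | _] = xi (rat_time T k) @^-1` `]1 - a, +oo[%classic).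
  by apply: (axi.1 _ Tk); exact: measurable_itv.
apply/seteqP; split => w /=; rewrite in_itv/= andbT /c /remaining rat_time_lt//.
  by rewrite ltrBlDr addrC -ltrBlDr.
by rewrite ltrBlDr addrC -ltrBlDr.
Qed.

End Remaining.

(** * Quantiles under weak convergence *)

Section QuantileLimits.
Context {R : realType}.
Implicit Types (T t s : \bar R) (x : \bar R -> R).

Lemma quantile_ltT T x u : (0 < T)%E -> ipath T x -> (quantile T x u < T)%E -> u <= leftlim x T.
Proof.
move=> T0 px qT; have Tq := quantile_time x u T0; have /andP[q0 _] := Tq.
have H : u <= x (quantile T x u) by rewrite -(quantile_leE u T0 px Tq qT).
by apply: le_trans H _; exact: (leftlim_ge T0 px (timeT T0)).
Qed.

Lemma lt_leftlim_quantile T x u : (0 < T)%E -> ipath T x -> u < leftlim x T -> (quantile T x u < T)%E.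
Proof.
move=> T0 px ul; rewrite ltNge; apply/negP => Tq.
suff : leftlim x T <= u by rewrite leNgt ul.
apply: (leftlim_le T0 px (timeT T0) T0) => s s0 sT.
have Ts : time T s by rewrite /time/= s0 ltW.
by apply: ltW; rewrite -(quantile_lt u T0 px Ts sT); exact: lt_le_trans Tq.
Qed.

(** Levels above [x(T-)] have quantile [T] and produce the jump term; levels below it produce the
    Stieltjes integral. The level [x(T-)] itself can go either way and is null. *)
Lemma integral_quantile T x (Phi : \bar R -> R) (M : R) : (0 < T)%E -> ipath T x ->
  measurable_fun (setT : set (measurableTypeR R)) (fun u => Phi (quantile T x u)) ->
  measurable_fun (dom T) (fun r => Phi r%:E) ->
  (forall t, time T t -> `|Phi t| <= M) ->
  (\int[unif01]_u (Phi (quantile T x u))%:E =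
   (LSI T x (fun r => Phi r%:E) + Phi T * jump x T)%:E)%E.
Proof.
move=> T0 px mPq mP bP; set l := leftlim x T.
have bP' r : dom T r -> `|Phi r%:E| <= M by move=> Dr; apply: bP; exact: dom_time.
have l01 : 0 <= l <= 1.
  by rewrite /l (leftlim_ge0 T0 px (timeT T0)) (le_trans (leftlim_le_val T0 px (timeT T0)))//; case: px => _ _ _ ->.
have mU : measurable ([set u : R | u <= l] : set (measurableTypeR R)).
  rewrite (_ : [set u : R | u <= l] = `]-oo, l]%classic).
    exact (measurable_itv (Interval (BInfty _ true) (BRight l))).
  by apply/seteqP; split => u /=; rewrite in_itv.
have iq := integrable_quant_fun T0 px mP bP'.
have iI : unif01.-integrable setT (fun u : measurableTypeR R => (Phi T * \1_[set u : R | u <= l] u)%:E).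
  have H : unif01.-integrable setT (fun u : measurableTypeR R => ((Phi T)%:E * (\1_[set u : R | u <= l] u)%:E)%E).
    by apply: integrableZl => //; exact: integrable_indic.
  exact: H.
have iC : unif01.-integrable setT (fun u : measurableTypeR R => (Phi T)%:E).
  exact: finite_measure_integrable_cst.
have iD : unif01.-integrable setT (fun u : measurableTypeR R =>
    ((Phi T)%:E - (Phi T * \1_[set u : R | u <= l] u)%:E)%E) by exact: integrableB.
have mq : measurable_fun (setT : set (measurableTypeR R)) (quant_fun T x (fun r => Phi r%:E)).
  exact: measurable_quant_fun.
transitivity (\int[unif01]_u ((quant_fun T x (fun r => Phi r%:E) u)%:E +
   ((Phi T)%:E - (Phi T * \1_[set u : R | u <= l] u)%:E)))%E.
  apply: ae_eq_integral => //.
  - exact/measurable_EFinP.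
  - apply: emeasurable_funD; first exact/measurable_EFinP.
    exact: measurable_int iD.
  - exists [set l]; split.
    + exact (measurable_set1 l).
    + by apply: unif01_countable; exact: countable1.
    + move=> u /=; apply: contra_notP => /eqP ul _.
      have Tq := quantile_time x u T0; have /andP[q0 qT] := Tq.
      rewrite /quant_fun indicE; have [qT'|qT'] := ltP (quantile T x u) T.
        have uL := quantile_ltT T0 px qT'.
        rewrite mem_set// mulr1 subee// adde0 fineK// ge0_fin_numE//.
        by rewrite (lt_le_trans qT')// leey.
      have -> : quantile T x u = T by apply/eqP; rewrite eq_le qT qT'.
      rewrite memNset ?mulr0 ?sube0 ?add0e//=.
      move=> uL; have := lt_leftlim_quantile (u := u) T0 px.
      by rewrite -/l lt_neqAle ul uL => /(_ isT); rewrite ltNge qT'.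
rewrite integralD// integralB//.
rewrite -(LS_integralE T0 px mP bP') (LS_integral_LSI T0 px mP bP').
rewrite integral_cst//= unif01_setT mule1.
have -> : (\int[unif01]_u (Phi T * \1_[set u : R | u <= l] u)%:E = (Phi T * l)%:E)%E.
  under eq_integral do rewrite EFinM.
  rewrite integralZl//; last exact: integrable_indic.
  by rewrite integral_indic// setIT EFinM; congr (_ * _)%E; exact: unif01_le.
rewrite -EFinB -EFinD; congr EFin; rewrite /jump gt_eqF// -/l.
by have [_ _ _ ->] := px; ring.
Qed.

(** If [x] were constant at the level [u] on an interval, the quantiles of [y n] could settle at its
    far end. Such an interval contains a rational time, so countably many conditions exclude it. *)
Lemma weak_quantile T (y : nat -> \bar R -> R) x u : (0 < T)%E -> ipath T x ->
  (forall n, ipath T (y n)) -> weak_upper T y x -> weak_lower T y x ->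
  (forall k, x (rat_time T k) != u) ->
  (forall s, (s < quantile T x u)%E -> \forall n \near \oo, (s < quantile T (y n) u)%E) /\
  (forall s, (quantile T x u < s)%E -> \forall n \near \oo, (quantile T (y n) u < s)%E).
Proof.
move=> T0 px py yU yL xu.
have Tq := quantile_time x u T0; have /andP[q0 qT] := Tq.
split => s.
- have [s0|s0] := ltP s 0%E.
    move=> _; apply: nearW => n; apply: lt_le_trans s0 _.
    by case/andP: (quantile_time (y n) u T0).
  move=> sq; have sT : (s < T)%E := lt_le_trans sq qT.
  have Ts : time T s by rewrite /time/= s0 ltW.
  move: sq; rewrite (quantile_lt u T0 px Ts sT) => xs.
  have e0 : 0 < u - x s by rewrite subr_gt0.
  have := yU s _ Ts sT e0; apply: filterS => n.
  by rewrite (quantile_lt u T0 (py n) Ts sT); lra.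
- move=> qs; have [sT|Ts] := leP s T; last first.
    apply: nearW => n; apply: le_lt_trans Ts.
    by case/andP: (quantile_time (y n) u T0).
  have [k [qk ks]] := rat_time_dense q0 qs sT.
  have [j [kj js]] := rat_time_dense (rat_time_ge0 k T0) ks sT.
  have Tk := rat_time_time k T0; have Tj := rat_time_time j T0.
  have xk : u < x (rat_time T k).
    rewrite lt_neqAle eq_sym xu /=.
    by rewrite -(quantile_leE u T0 px Tk (rat_time_lt k T0)) ltW.
  have e0 : 0 < x (rat_time T k) - u by rewrite subr_gt0.
  have := yL _ _ _ Tj (rat_time_ge0 k T0) kj e0; apply: filterS => n H.
  apply: le_lt_trans js; rewrite (quantile_leE u T0 (py n) Tj (rat_time_lt j T0)).
  by lra.
Qed.

(* A jump of [z] at the quantile of [x] determines that quantile by a rational level. *)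
Lemma jump_at_quantile T x z u : (0 < T)%E -> ipath T x -> ipath T z ->
  left_continuous_path T x -> x 0%E = 0 -> 0 < u -> (quantile T x u < T)%E ->
  ~ (exists r : rat, u = x (quantile T z (ratr r))) ->
  (0 < quantile T x u)%E /\ leftlim z (quantile T x u) = z (quantile T x u).
Proof.
move=> T0 px pz lx x0 u0 qT; set q := quantile T x u => nr.
have Tq : time T q := quantile_time x u T0; have /andP[q_ge0 _] := Tq.
have q0 : (0 < q)%E.
  rewrite lt_def q_ge0 andbT; apply/eqP => qE.
  have : (quantile T x u <= 0)%E by rewrite -/q qE.
  by rewrite (quantile_leE u T0 px (time0 T0) T0) x0 leNgt u0.
split => //; apply: contrapT => /eqP lz; apply: nr.
have lz_lt : leftlim z q < z q by rewrite lt_neqAle lz (leftlim_le_val T0 pz Tq).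
have [r] := rat_in_itvoo lz_lt; rewrite in_itv/= => /andP[lr rz]; exists r.
have -> : quantile T z (ratr r) = q.
  apply/eqP; rewrite eq_le; apply/andP; split.
    by rewrite (quantile_leE _ T0 pz Tq qT) ltW.
  rewrite leNgt; apply/negP => qr.
  have Tr := quantile_time z (ratr r) T0.
  have H : ratr r <= z (quantile T z (ratr r)).
    by rewrite -(quantile_leE (ratr r) T0 pz Tr (lt_trans qr qT)).
  have := leftlim_ge T0 pz Tq (proj1 (andP Tr)) qr; lra.
have h1 : u <= x q by rewrite -(quantile_leE u T0 px Tq qT).
have h2 : x q <= u.
  rewrite -(lx q q0 qT); apply: (leftlim_le T0 px Tq q0) => s s0 sq.
  have sT := lt_trans sq qT; have Ts : time T s by rewrite /time/= s0 ltW.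
  by apply: ltW; rewrite -(quantile_lt u T0 px Ts sT).
by apply/eqP; rewrite eq_le h1 h2.
Qed.

End QuantileLimits.

Section Domination.
Context {R : realType} {d : measure_display} {S : measurableType d}.
Variable mu : {measure set S -> \bar R}.

Variables (f_ : nat -> S -> R) (f M : S -> R).
Hypotheses (mf_ : forall n, measurable_fun setT (f_ n)) (mf : measurable_fun setT f)
  (f_f : {ae mu, forall w, (fun n => f_ n w) @ \oo --> f w})
  (iM : mu.-integrable setT (EFin \o M)) (f_M : {ae mu, forall w n, `|f_ n w| <= M w}).

Let dominated := @dominated_convergence _ _ _ mu setT measurableT
  (fun n w => (f_ n w)%:E) (EFin \o f) (EFin \o M)
  (fun n => (measurable_EFinP _ _).2 (mf_ n)) ((measurable_EFinP _ _).2 mf)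
  ltac:(move: f_f; apply: filterS => w fw _; apply: cvg_EFin; [exact: nearW|exact: fw]) iM
  ltac:(move: f_M; apply: filterS => w fw n _; rewrite lee_fin; exact: fw).

Lemma dominated_Rintegrable : mu.-integrable setT (EFin \o f).
Proof. by have [If _ _] := dominated. Qed.

Lemma dominated_Rcvg : (fun n => \int[mu]_w f_ n w) @ \oo --> \int[mu]_w f w.
Proof.
have [If _ H] := dominated.
apply: fine_cvg; rewrite fineK; first exact: H.
exact: integrable_fin_num If.
Qed.

End Domination.

Section ProductDomination.
Context {R : realType} {d : measure_display} {Omega : measurableType d}.
Variable P : probability Omega R.

(** The graph of [X] is null for the product measure because its section at each [w] is a point; by
    Fubini almost every section at fixed [u] is null too. *)
Lemma ae_level_null (X : Omega -> R) : measurable_fun setT X ->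
  {ae unif01, forall u, {ae P, forall w, X w != u}}.
Proof.
move=> mX.
pose D := [set p : Omega * measurableTypeR R | X p.1 = p.2].
have mD : measurable D.
  rewrite (_ : D = setT `&` (fun p : Omega * measurableTypeR R => X p.1 - p.2) @^-1` [set 0]).
    have mB : measurable_fun setT (fun p : Omega * measurableTypeR R => X p.1 - p.2).
      by apply: (measurable_funB (measurableT_comp mX measurable_fst)); exact: measurable_snd.
    by apply: mB => //; exact (measurable_set1 0).
  by apply/seteqP; split => p /=; [move=> ->; rewrite subrr|move=> [_ /eqP]; rewrite subr_eq0 => /eqP].
have mF : measurable_fun setT (fun p : Omega * measurableTypeR R => (\1_D p : R)%:E).
  by apply/measurable_EFinP; exact: measurable_indic.
have F0 (p : Omega * measurableTypeR R) : (0 <= (\1_D p : R)%:E)%E by rewrite lee_fin.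
have mG := measurable_fun_fubini_tonelli_G (m1 := P) _ mF F0.
have := @fubini_tonelli _ _ _ _ _ P unif01 _ mF F0.
rewrite [X in X = _ -> _]integral0_eq; last first.
  move=> w _; rewrite (_ : (fun _ => _) = (fun u : measurableTypeR R => (\1_[set X w] u : R)%:E)).
    have mw : measurable ([set X w] : set (measurableTypeR R)) by exact (measurable_set1 (X w)).
    by rewrite integral_indic//= setIT; apply: unif01_countable; exact: countable1.
  by apply/funext => u; rewrite !indicE; congr ((nat_of_bool _)%:R%:E); apply/idP/idP; rewrite !inE /D/= => ->.
move=> /esym G0.
have /(ae_eq_integral_abs unif01 measurableT mG) : (\int[unif01]_u `|fubini_G P (fun p : Omega * measurableTypeR R => (\1_D p : R)%:E) u| = 0)%E.
  rewrite -[RHS]G0; apply: eq_integral => u _; rewrite gee0_abs//.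
  by apply: integral_ge0 => w _; exact: F0.
apply: filterS => u /(_ I) /= Du.
have mu : measurable [set w | X w = u].
  rewrite (_ : [set w | X w = u] = setT `&` X @^-1` [set u]); last by rewrite setTI.
  by apply: mX => //; exact (measurable_set1 u).
exists [set w | X w = u]; split => //.
- rewrite -Du /fubini_G; transitivity (\int[P]_w (\1_[set w | X w = u] w : R)%:E)%E.
    by rewrite integral_indic// setIT.
  by apply: eq_integral => w _; rewrite !indicE; congr ((nat_of_bool _)%:R%:E); apply/idP/idP; rewrite !inE /D/=.
- by move=> w /= /negP; rewrite negbK => /eqP.
Qed.

End ProductDomination.

Section LimInf.
Context {R : realType} {d : measure_display} {Omega : measurableType d}.
Variables (T : \bar R) (F : \bar R -> set (set Omega)) (tau : nat -> Omega -> \bar R).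
Hypothesis st_tau : forall n, stopping_time T F (tau n).

Lemma lim_inf_stE w q : (forall s, (s < q)%E -> \forall n \near \oo, (s < tau n w)%E) ->
  (forall s, (q < s)%E -> \forall n \near \oo, (tau n w < s)%E) -> lim_inf_st tau w = q.
Proof.
move=> below above; apply/eqP; rewrite eq_le; apply/andP; split.
  apply: ge_ereal_sup => _ [n _ <-]; rewrite leNgt; apply/negP => /above[N _ HN].
  have := HN (maxn n N) (leq_maxr n N); rewrite /= ltNge inf_tail_le//.
  exact: leq_maxl.
rewrite leNgt; apply/negP => lq.
have /andP[l0 _] := lim_inf_time st_tau w.
have [s ls sq] := lte_dense lq l0.
have [N _ HN] := below _ sq.
have : (s%:E <= inf_tail tau N w)%E.
  by apply: le_ereal_inf_tmp => _ [m /= Nm <-]; apply: ltW; exact: HN.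
move=> /le_trans -/(_ _ (inf_tail_le_lim tau N w)).
by rewrite leNgt ls.
Qed.

End LimInf.

Section UpperSemicontinuity.
Context {R : realType} {d : measure_display} {Omega : measurableType d}.
Variables (P : probability Omega R) (T : \bar R) (F : \bar R -> set (set Omega))
  (f g h : \bar R -> Omega -> R) (Mf Mg : Omega -> R).
Hypotheses (T0 : (0 < T)%E) (bf : bproc T f Mf) (bg : bproc T g Mg)
  (iMf : P.-integrable setT (EFin \o Mf)) (iMg : P.-integrable setT (EFin \o Mg))
  (mh0 : measurable_fun setT (h 0%E)) (mhT : measurable_fun setT (h T))
  (fgh : {ae P, forall w t, time T t -> f t w >= h t w /\ h t w >= g t w}).
Hypotheses (filF : is_filtration T F) (rcF : right_continuous_filtration T F)
  (cg : forall w, cadlag T (g^~ w)) (rg : regular P T F g).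
Variable xi : \bar R -> Omega -> R.
Hypotheses (axi : A_circ T F xi) (lxi : forall w, left_continuous_path T (xi^~ w))
  (xi0 : forall w, xi 0%E w = 0).
Let rxi : rproc T xi := A_circ_rproc filF axi.
Let c := remaining T xi.
Let Y t w := g t w * c t w.

Let bY : bproc T Y Mg.
Proof.
split; first by apply: jmM; [case: bg|exact: (remaining_jm T0 filF axi)].
move=> t w Tt; have /andP[c0 c1] := remaining01 T0 filF axi w Tt.
by rewrite /Y normrM (le_trans _ (bg.2 t w Tt))// ler_piMr// ger0_norm.
Qed.

Definition own_part z w := LSI T (xi^~ w) (fun r => f r%:E w * (1 - z r%:E w)).
Definition opp_part z w := LSI T (z^~ w) (fun r => Y r%:E w) + Y T w * jump (z^~ w) T.

(** The remaining mass at [T] is the jump of [xi] there, so [opp_part] counts the common jump at [T]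
    with [g_T]. The payoff counts it with [h_T]; the last term is the difference, almost surely
    nonnegative. *)
Lemma payoff_path_split z w : rproc T z ->
  payoff_path T f g h xi z w =
  own_part z w + opp_part z w + (h T w - g T w) * c T w * jump (z^~ w) T.
Proof.
move=> rz; rewrite /payoff_path /opp_part xi0 mulr0 mul0r add0r.
have -> : LSI T (z^~ w) (fun r => g r%:E w * (1 - xi r%:E w)) = LSI T (z^~ w) (fun r => Y r%:E w).
  apply: EFin_inj; rewrite -(LSI_fin w T0 rz bY) -(LSI_fin w T0 rz (bproc_stop T0 bg rxi)).
  by apply: eq_integral => r /set_mem[_ rT]; rewrite /Y /c /remaining rT.
rewrite /Y /c (remainingT T0 axi) /own_part; ring.
Qed.

Let mquant z : rproc T z -> measurable_fun setT
  (fun p : Omega * measurableTypeR R => Y (quantile T (z^~ p.1) p.2) p.1).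
Proof.
move=> rz; apply: (jm_comp (T := T) (tau := fun p : Omega * measurableTypeR R => quantile T (z^~ p.1) p.2) (v := fst)) => //.
- by case: bY.
- exact: measurable_quantile_proc.
- by move=> p; exact: quantile_time.
Qed.

Let quant_le z u w : `|Y (quantile T (z^~ w) u) w| <= Mg w.
Proof. by apply: bY.2; exact: quantile_time. Qed.

Lemma opp_partE z w : rproc T z ->
  (\int[unif01]_u (Y (quantile T (z^~ w) u) w)%:E = (opp_part z w)%:E)%E.
Proof.
move=> rz; apply: (@integral_quantile _ T (z^~ w) (Y^~ w) (Mg w) T0 (rz.1 w)).
- exact: (measurableT_comp (mquant rz) (measurable_pair1 w)).
- by have [jY _] := bY; exact: jm_path jY.
- by move=> t Tt; apply: bY.2.
Qed.

Let iquant z : rproc T z -> (P \x (unif01 : measure (measurableTypeR R) R))%E.-integrable setT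
  (EFin \o (fun p : Omega * measurableTypeR R => Y (quantile T (z^~ p.1) p.2) p.1)).
Proof. by move=> rz; apply: (integrable_prod_dominated (mquant rz) iMg) => w u; exact: quant_le. Qed.

Let V z u : R := \int[P]_w Y (quantile T (z^~ w) u) w.

Let iYq z u : rproc T z -> P.-integrable setT (EFin \o (fun w => Y (quantile T (z^~ w) u) w)).
Proof.
move=> rz; apply: (le_integrable _ _ _ iMg) => //.
- by apply/measurable_EFinP; exact: (measurableT_comp (mquant rz) (measurable_pair2 u)).
- by move=> w _; rewrite /= lee_fin (le_trans (quant_le z u w))// ler_norm.
Qed.

Let V_fin z u : rproc T z -> (\int[P]_w (Y (quantile T (z^~ w) u) w)%:E = (V z u)%:E)%E.
Proof. by move=> rz; rewrite /V /Rintegral fineK//; exact: integrable_fin_num (iYq u rz). Qed.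

Let mV z : rproc T z -> measurable_fun (setT : set (measurableTypeR R)) (V z).
Proof.
move=> rz; apply/measurable_EFinP.
rewrite [X in measurable_fun _ X](_ : _ = fubini_G P
  (EFin \o (fun p : Omega * measurableTypeR R => Y (quantile T (z^~ p.1) p.2) p.1))).
  exact: measurable_fubini_G (iquant rz).
by apply/funext => u /=; rewrite -V_fin.
Qed.

Let V_le z u : rproc T z -> `|V z u| <= \int[P]_w Mg w.
Proof.
move=> rz; apply: (le_trans (le_normr_Rintegral _ (iYq u rz))) => //.
by apply: le_Rintegral => //; exact: (integrable_abse (iYq u rz)).
Qed.

(** Fubini brings the level outside, where each inner mean is the expectation of [Y] at a stopping
    time, the form that regularity can handle. *)
Lemma expectation_opp_part z : rproc T z -> \int[P]_w opp_part z w = \int[unif01]_u V z u.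
Proof.
move=> rz; rewrite /Rintegral; congr fine.
have H := iquant rz.
transitivity (\int[P]_w fubini_F (unif01 : measure (measurableTypeR R) R)
  (EFin \o (fun p : Omega * measurableTypeR R => Y (quantile T (z^~ p.1) p.2) p.1)) w)%E.
  by apply: eq_integral => w _; rewrite -opp_partE.
rewrite (integral12_prod_meas1 H) -(integral21_prod_meas1 H).
by apply: eq_integral => u _; rewrite -V_fin.
Qed.

Lemma stopping_quantile z u : A_circ T F z -> stopping_time T F (fun w => quantile T (z^~ w) u).
Proof.
move=> az; have [pz _] := A_circ_rproc filF az; split => [w|t Tt]; first exact: quantile_time.
have [sF _ _] := filF; have /andP[_] := Tt; rewrite le_eqVlt => /predU1P[->|tT].
  rewrite (_ : [set w | _] = setT); first exact: sigma_algebra_setT (sF _ (timeT T0)).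
  by apply/seteqP; split => w //= _; case/andP: (quantile_time (z^~ w) u T0).
rewrite (_ : [set w | _] = z t @^-1` `[u, +oo[%classic).
  by apply: (az.1 _ Tt); exact: measurable_itv.
by apply/seteqP; split => w /=; rewrite in_itv/= andbT (quantile_leE u T0 (pz w) Tt tT).
Qed.

Variables (y : nat -> \bar R -> Omega -> R) (zeta : \bar R -> Omega -> R).
Hypotheses (ay : forall n, A_circ T F (y n)) (az : A_circ T F zeta)
  (yz : {ae P, forall w, weak_upper T (fun n => (y n)^~ w) (zeta^~ w) /\
                   weak_lower T (fun n => (y n)^~ w) (zeta^~ w)}).
Let ry n : rproc T (y n) := A_circ_rproc filF (ay n).
Let rz : rproc T zeta := A_circ_rproc filF az.

(** The integrator [xi] is fixed, so convergence of [y n] is needed only at its quantiles. It can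
    fail there only where [zeta] jumps, and a continuous [xi] starting at 0 meets such times at
    countably many levels. *)
Lemma own_part_cvg : (fun n => \int[P]_w own_part (y n) w) @ \oo --> \int[P]_w own_part zeta w.
Proof.
have mo z : rproc T z -> measurable_fun setT (own_part z).
  by move=> rz'; exact: (measurable_LSI T0 rxi (bproc_stop T0 bf rz') iMf).
apply: (@dominated_Rcvg _ _ _ P (fun n => own_part (y n)) (own_part zeta) Mf) => //.
- by move=> n; exact: mo.
- exact: mo.
- move: yz; apply: filterS => w [yU yL].
  have oE z : rproc T z -> own_part z w = \int[unif01]_u quant_fun T (xi^~ w) (fun r => f r%:E w * (1 - z r%:E w)) u.
    move=> rz'; rewrite /Rintegral.
    by rewrite -(LSIE w T0 rxi (bproc_stop T0 bf rz')) (LSI_fin w T0 rxi (bproc_stop T0 bf rz')).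
  rewrite oE//; under eq_fun do rewrite oE//.
  apply: (@dominated_Rcvg _ _ _ unif01
    (fun n => quant_fun T (xi^~ w) (fun r => f r%:E w * (1 - y n r%:E w)))
    (quant_fun T (xi^~ w) (fun r => f r%:E w * (1 - zeta r%:E w))) (cst (Mf w))).
  + by move=> n; exact: (measurable_quant_path w T0 rxi (bproc_stop T0 bf (ry n)).1).
  + exact: (measurable_quant_path w T0 rxi (bproc_stop T0 bf rz).1).
  + have N0 : {ae unif01, forall u : measurableTypeR R, ~ (exists r : rat, u = xi (quantile T (zeta^~ w) (ratr r)) w)}.
      pose N := range (fun r : rat => xi (quantile T (zeta^~ w) (ratr r)) w).
      have cN : countable N by exact: sub_countable (card_image_le _ _) (countableP _).
      exists N; split.
      * by apply: countable_measurable => // r; exact (measurable_set1 r).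
      * exact: unif01_countable.
      * by move=> u /= /contrapT[r ->]; exists r.
    have u_gt0 : {ae unif01, forall u : measurableTypeR R, 0 < u} by apply: ae_unif01 => u /andP[].
    move: N0 u_gt0; apply: filterS2 => u nr u0.
    have qE z := quant_funE xi (fun t w => f t w * (1 - z t w)) w u T0.
    rewrite qE; under eq_fun do rewrite qE; case: ifPn => qT; last exact: cvg_cst.
    have [q0 lz] := jump_at_quantile T0 (rxi.1 w) (rz.1 w) (@lxi w) (xi0 w) u0 qT nr.
    apply: cvgMr; apply: cvgB; first exact: cvg_cst.
    exact: (weak_cvg T0 (rz.1 w) yU yL q0 qT lz).
  + exact: finite_measure_integrable_cst.
  + by apply: aeW => u n; exact: (quant_fun_le _ _ _ T0 (bproc_stop T0 bf (ry n))).
- by apply: aeW => w n; exact: (LSI_le _ T0 rxi (bproc_stop T0 bf (ry n))).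
Qed.

(** Now the integrator varies and its quantiles move with [n]. Limits are taken in expectation at a
    fixed level, so the exceptional levels have to be chosen independently of [w]. *)
Lemma opp_part_cvg : (fun n => \int[P]_w opp_part (y n) w) @ \oo --> \int[P]_w opp_part zeta w.
Proof.
rewrite expectation_opp_part//; under eq_fun do rewrite expectation_opp_part//.
apply: (@dominated_Rcvg _ _ _ unif01 (fun n => V (y n)) (V zeta) (cst (\int[P]_w Mg w))).
- by move=> n; exact: mV.
- exact: mV.
- have : {ae unif01, forall u : measurableTypeR R, forall k, {ae P, forall w, zeta (rat_time T k) w != u}}.
    apply/ae_foralln => k; apply: ae_level_null; apply: rz.2; exact: rat_time_time.
  apply: filterS => u Hu.
  have {}Hu : {ae P, forall w k, zeta (rat_time T k) w != u} by exact/ae_foralln.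
  have st n := stopping_quantile u (ay n).
  have K := regular_stopping_cvg T0 filF rcF cg bg iMg rg (remaining_jm T0 filF axi)
    (fun t w => @remaining01 _ _ _ T F T0 filF xi axi t w)
    (fun s t w => @remaining_mono _ _ _ T F T0 filF xi axi s t w)
    (fun t w => @remaining_right _ _ _ T F filF xi axi t w)
    (fun t w => @remaining_left _ _ _ T F filF xi axi lxi t w)
    (@remaining_adapted _ _ _ T F T0 filF xi axi) st
    (measurable_quantile_fix u T0 rz) (fun w => quantile_time (zeta^~ w) u T0).
  have -> : (fun n => V (y n) u) = (fun n => fine (\int[P]_w (Y (quantile T ((y n)^~ w) u) w)%:E)).
    by apply/funext => n; rewrite V_fin.
  apply: fine_cvg; rewrite -V_fin//; apply: K.
  move: yz Hu; apply: filterS2 => w [yU yL] Hw.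
  have [below above] := weak_quantile T0 (rz.1 w) (fun n => (ry n).1 w) yU yL Hw.
  split => //; exact: (lim_inf_stE st).
- exact: finite_measure_integrable_cst.
- by apply: aeW => u n; exact: V_le.
Qed.

(** Truncation at 0 allows pointwise comparison at every [w]; it is active on a null set only. *)
Let K w := Num.max 0 ((h T w - g T w) * c T w).

Let mK : measurable_fun setT K.
Proof.
apply: measurable_maxr; first exact: measurable_cst.
apply: measurable_funM.
  apply: measurable_funB => //; apply: jm_fix (timeT T0); by case: bg.
rewrite (_ : c T = fun w => jump (xi^~ w) T); first exact: measurable_jump.
by apply/funext => w; exact: remainingT axi w.
Qed.

Let K_ae : {ae P, forall w, K w = (h T w - g T w) * c T w /\ K w <= Mf w + Mg w}.
Proof.
move: fgh; apply: filterS => w /(_ T (timeT T0))[hf gh].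
have /andP[c0 c1] := remaining01 T0 filF axi w (timeT T0).
have k0 : 0 <= (h T w - g T w) * c T w by rewrite mulr_ge0// subr_ge0.
rewrite /K max_r//; split => //.
apply: (@le_trans _ _ (h T w - g T w)); first by rewrite ler_piMr// subr_ge0.
have := bf.2 T w (timeT T0); have := bg.2 T w (timeT T0).
by rewrite !ler_norml => /andP[? ?] /andP[? ?]; lra.
Qed.

Let iMM : P.-integrable setT (EFin \o (fun w => Mf w + Mg w)).
Proof.
have H : P.-integrable setT (fun w => ((Mf w)%:E + (Mg w)%:E)%E) by exact: integrableD.
exact: H.
Qed.

Let iK (j : Omega -> R) : measurable_fun setT j -> (forall w, 0 <= j w <= 1) ->
  P.-integrable setT (EFin \o (fun w => K w * j w)).
Proof.
move=> mj j01.
have mKj := measurable_funM mK mj.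
have Kj : {ae P, forall w (n : nat), setT w -> (`|(K w * j w)%:E| <= (Mf w + Mg w)%:E)%E}.
  move: K_ae; apply: filterS => w [_ KM] _ _; have /andP[j0 j1] := j01 w.
  have K0 : 0 <= K w by rewrite /K le_max lexx.
  by rewrite abse_EFin lee_fin ger0_norm ?mulr_ge0// (le_trans _ KM)// ler_piMr.
(* Dominated convergence along a constant sequence yields integrability from a bound that holds
   almost everywhere. *)
have [i _ _] := @dominated_convergence _ _ _ P setT measurableT
  (fun _ => EFin \o (fun w => K w * j w)) (EFin \o (fun w => K w * j w)) (EFin \o (fun w => Mf w + Mg w))
  (fun _ => (measurable_EFinP _ _).2 mKj) ((measurable_EFinP _ _).2 mKj)
  ltac:(apply: aeW => w _; exact: cvg_cst) iMM Kj.
exact: i.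
Qed.

Let own_integrable z : rproc T z -> P.-integrable setT (EFin \o own_part z).
Proof.
move=> rz'; apply: (le_integrable _ _ _ iMf) => //.
- by apply/measurable_EFinP; exact: (measurable_LSI T0 rxi (bproc_stop T0 bf rz') iMf).
- by move=> w _; rewrite /= lee_fin (le_trans _ (ler_norm _))//; exact: (LSI_le _ T0 rxi (bproc_stop T0 bf rz')).
Qed.

Let opp_integrable z : rproc T z -> P.-integrable setT (EFin \o opp_part z).
Proof.
move=> rz'; have H := integrable_fubini_F (iquant rz').
apply: eq_integrable H => // w _ /=; exact: opp_partE.
Qed.

Let payoffR_split z : rproc T z -> payoffR P T f g h xi z =
  \int[P]_w own_part z w + \int[P]_w opp_part z w + \int[P]_w (K w * jump (z^~ w) T).
Proof.
move=> rz'.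
have iJ := iK (measurable_jump T0 rz') (fun w => jump01 w T0 rz').
have iO := own_integrable rz'; have iP := opp_integrable rz'.
have iOP : P.-integrable setT (EFin \o (fun w => own_part z w + opp_part z w)).
  have H : P.-integrable setT (fun w => ((own_part z w)%:E + (opp_part z w)%:E)%E) by exact: integrableD.
  exact: H.
rewrite -RintegralD// -RintegralD// /payoffR /Rintegral; congr fine.
apply: ae_eq_integral => //.
- apply/measurable_EFinP; exact: measurable_payoff_path T0 bf bg iMf iMg mh0 mhT rxi rz'.
- by have := measurable_int P (integrableD measurableT iOP iJ).
- by move: K_ae; apply: filterS => w [-> _] _; rewrite payoff_path_split.
Qed.

Lemma payoffR_usc (a : R) : (forall n, a - n.+1%:R^-1 < payoffR P T f g h xi (y n)) ->
  a <= payoffR P T f g h xi zeta.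
Proof.
move=> Ha.
(* The jumps of [y n] at [T] are only bounded above in the limit by that of [zeta]. Their maximum
   with the latter does converge, and the replacement can only raise the payoff. *)
pose m n w := Num.max (jump ((y n)^~ w) T) (jump (zeta^~ w) T).
have m01 n w : 0 <= m n w <= 1.
  have /andP[j0 j1] := jump01 w T0 (ry n); have /andP[z0 z1] := jump01 w T0 rz.
  by rewrite /m le_max j0 ge_max j1 z1.
have mm n : measurable_fun setT (m n) by apply: measurable_maxr; exact: measurable_jump.
have Kcvg : (fun n => \int[P]_w (K w * m n w)) @ \oo --> \int[P]_w (K w * jump (zeta^~ w) T).
  apply: (@dominated_Rcvg _ _ _ P (fun n w => K w * m n w) _ (fun w => Mf w + Mg w)) => //.
  - by move=> n; exact: measurable_funM.
  - by apply: measurable_funM => //; exact: measurable_jump.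
  - move: yz; apply: filterS => w [_ yL]; apply: cvgMr.
    apply/cvgrPdist_lt => e e0.
    have := weak_leftlim T0 (rz.1 w) (fun n => (ry n).1 w) yL e0; apply: filterS => n.
    rewrite /m /jump gt_eqF//.
    have [_ _ _ ->] := (ry n).1 w; have [_ _ _ ->] := rz.1 w.
    move=> H; rewrite ltr_norml; case: (leP (1 - leftlim ((y n)^~ w) T)) => H'; apply/andP; split; lra.
  - move: K_ae; apply: filterS => w [_ KM] n.
    have /andP[m0 m1] := m01 n w.
    have K0 : 0 <= K w by rewrite /K le_max lexx.
    by rewrite ger0_norm ?mulr_ge0// (le_trans _ KM)// ler_piMr.
pose r n := \int[P]_w own_part (y n) w + \int[P]_w opp_part (y n) w + \int[P]_w (K w * m n w).
have rcvg : r @ \oo --> payoffR P T f g h xi zeta.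
  rewrite payoffR_split//; apply: cvgD Kcvg; apply: cvgD; [exact: own_part_cvg|exact: opp_part_cvg].
have r_ge n : a - n.+1%:R^-1 <= r n.
  apply: (le_trans (ltW (Ha n))); rewrite payoffR_split// /r lerD2l.
  apply: le_Rintegral => //.
  - exact: (iK (measurable_jump T0 (ry n)) (fun w => jump01 w T0 (ry n))).
  - exact: (iK (mm n) (m01 n)).
  - by move=> w _; rewrite ler_wpM2l// /K ?le_max ?lexx.
have acvg : (fun n => a - n.+1%:R^-1 : R) @ \oo --> a.
  rewrite -[X in _ --> X]subr0; apply: cvgB; first exact: cvg_cst.
  exact: cvg_harmonic.
apply: (ler_cvg_to acvg rcvg); exact: nearW.
Qed.

End UpperSemicontinuity.

(** * Removing the jump at time 0 *)

Section Ramp.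
Context {R : realType}.
Implicit Types (T t s : \bar R) (x z phi : \bar R -> R).

(** [1 - ramp] spends a unit mass linearly over [[0, 1/(n+1)]]; if [T] comes first, the rest is
    spent by a jump at [T]. *)
Definition ramp T (n : nat) : \bar R -> R :=
  fun t => if (t < T)%E then Num.max 0 (1 - n.+1%:R * fine t) else 0.

Lemma ramp0 T n : (0 < T)%E -> ramp T n 0%E = 1.
Proof. by move=> T0; rewrite /ramp T0 mulr0 subr0 max_r. Qed.

Lemma rampT T n : ramp T n T = 0.
Proof. by rewrite /ramp ltxx. Qed.

Lemma ramp_ge0 T n t : 0 <= ramp T n t.
Proof. by rewrite /ramp; case: ifP => // _; rewrite le_max lexx. Qed.

Lemma ramp_le1 T n t : (0 <= t)%E -> ramp T n t <= 1.
Proof.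
move=> t0; rewrite /ramp; case: ifP => // _; rewrite ge_max ler01/=.
by rewrite lerBlDr lerDl mulr_ge0// fine_ge0.
Qed.

Let time_fin T t : time T t -> (t < T)%E -> t \is a fin_num.
Proof. by move=> /andP[t0 _] tT; rewrite ge0_fin_numE// (lt_le_trans tT)// leey. Qed.

Lemma ramp_mono T n s t : time T s -> time T t -> (s <= t)%E -> ramp T n t <= ramp T n s.
Proof.
move=> Ts Tt st; have [tT|tT] := ltP t T; last by rewrite {1}/ramp ltNge tT ramp_ge0.
have sT := le_lt_trans st tT; have sf := time_fin Ts sT; have tf := time_fin Tt tT.
have : fine s <= fine t by rewrite fine_le.
rewrite /ramp sT tT => H; rewrite ge_max !le_max lexx/=; apply/orP; right.
by rewrite lerD2l lerN2 ler_wpM2l.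
Qed.

Lemma ramp_lip T n s t : time T s -> time T t -> (s <= t)%E -> (t < T)%E ->
  `|ramp T n t - ramp T n s| <= n.+1%:R * (fine t - fine s).
Proof.
move=> Ts Tt st tT; rewrite distrC ger0_norm ?subr_ge0 ?ramp_mono//.
have sT := le_lt_trans st tT; have sf := time_fin Ts sT; have tf := time_fin Tt tT.
have H : fine s <= fine t by rewrite fine_le.
have {}H : n.+1%:R * fine s <= n.+1%:R * fine t :> R by rewrite ler_wpM2l.
rewrite /ramp sT tT mulrBr; move: H; set a := _ * fine s; set b := _ * fine t.
by case: (leP 0 (1 - a)); case: (leP 0 (1 - b)); lra.
Qed.

Lemma measurable_ramp T n : measurable_fun (dom T) (fun r : R => ramp T n r%:E).
Proof.
have mm : measurable_fun (dom T) (fun r : R => Num.max 0 (1 - n.+1%:R * r)).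
  by apply: measurable_maxr => //; apply: measurable_funB => //; exact: measurable_funM.
by apply: eq_measurable_fun mm => r /set_mem[_ rT]; rewrite /ramp rT.
Qed.

Lemma ramp_eventually0 T t : time T t -> (0 < t)%E -> \forall n \near \oo, ramp T n t = 0.
Proof.
move=> Tt t0; have [tT|tT] := ltP t T; last by apply: nearW => n; rewrite /ramp ltNge tT.
have tf := time_fin Tt tT; have ft : 0 < fine t by rewrite fine_gt0// t0/= ltey_eq tf.
have := near_infty_natSinv_lt (PosNum ft); apply: filterS => n /= H.
rewrite /ramp tT max_l// subr_le0 mulrC -ler_pdivrMr// mul1r ltW//.
Qed.

Lemma ipath_ramp T n : (0 < T)%E -> ipath T (fun t => 1 - ramp T n t).
Proof.
move=> T0; have nd : nondecreasing_on T (fun t => 1 - ramp T n t).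
  by move=> s t Ts Tt st; rewrite lerD2l lerN2 ramp_mono.
split => //; last 2 first.
- by rewrite ramp0// subrr.
- by rewrite rampT subr0.
split; last by move=> t Tt t0; exact: nondecreasing_left_cvg nd Tt t0.
move=> t Tt tT; have /andP[t0 _] := Tt; have tf := time_fin Tt tT.
have t_oo : (t < +oo)%E by rewrite (lt_le_trans tT)// leey.
apply/(cvg_rightP _ _ t0 t_oo) => e e0.
pose r := e / n.+1%:R; have r0 : 0 < r by rewrite divr_gt0.
exists (Order.min (t + r%:E)%E T).
  by rewrite lt_min tT andbT lteDl// lte_fin.
move=> s ts; rewrite lt_min => /andP[sr sT].
have s0 : (0 <= s)%E by rewrite (le_trans t0)// ltW.
have Ts : time T s by rewrite /time/= s0 ltW.
have sf := time_fin Ts sT.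
rewrite (_ : _ - _ = - (ramp T n s - ramp T n t)); last by ring.
rewrite normrN.
apply: (le_lt_trans (ramp_lip n Tt Ts (ltW ts) sT)).
have H : fine s < fine t + e / n.+1%:R by rewrite -lte_fin EFinD !fineK.
by rewrite -ltrBlDl ltr_pdivlMr// mulrC in H.
Qed.

Definition ramped T n x : \bar R -> R := fun t => x t - x 0%E * ramp T n t.

Lemma ramped_ipath T n x : (0 < T)%E -> ipath T x -> ipath T (ramped T n x).
Proof.
move=> T0 px; have [cx nx x0 x1] := px; have [[rr lr] nr _ _] := ipath_ramp n T0.
have [rx lx] := cx.
have E : ramped T n x = (fun t => x t + (x 0%E * (1 - ramp T n t) - x 0%E)).
  by apply/funext => t; rewrite /ramped; ring.
split.
- rewrite E; split => t Tt tT.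
    by apply: cvgD; [exact: rx|apply: cvgB; [apply: cvgMr; exact: rr|exact: cvg_cst]].
  have [l1 L1] := lx t Tt tT; have [l2 L2] := lr t Tt tT.
  exists (l1 + (x 0%E * l2 - x 0%E)).
  by apply: cvgD => //; apply: cvgB; [apply: cvgMr|exact: cvg_cst].
- move=> s t Ts Tt st; rewrite E lerD ?nx// lerD2r ler_wpM2l//; exact: nr.
- by rewrite /ramped ramp0// mulr1 subrr.
- by rewrite /ramped rampT mulr0 subr0.
Qed.

Lemma quant_fun_path T x phi u : (0 < T)%E ->
  quant_fun T x (fun r => phi r%:E) u =
  if (quantile T x u < T)%E then phi (quantile T x u) else 0.
Proof.
move=> T0; rewrite /quant_fun; case: ifPn => // qT; rewrite fineK//.
exact: time_fin (quantile_time x u T0) qT.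
Qed.

Lemma LSI_unif01 T x (phi : R -> R) C : (0 < T)%E -> ipath T x ->
  measurable_fun (dom T) phi -> (forall r, dom T r -> `|phi r| <= C) ->
  LSI T x phi = \int[unif01]_u quant_fun T x phi u.
Proof.
move=> T0 px mphi bphi; rewrite /Rintegral -(LS_integralE T0 px mphi bphi).
by rewrite (LS_integral_LSI T0 px mphi bphi).
Qed.

Section Limits.
Variables (T : \bar R) (phi : \bar R -> R) (C : R).
Hypotheses (T0 : (0 < T)%E) (mphi : measurable_fun (dom T) (fun r => phi r%:E))
  (bphi : forall t, time T t -> `|phi t| <= C).
Let bphi' r : dom T r -> `|phi r%:E| <= C.
Proof. by move=> Dr; apply: bphi; exact: dom_time. Qed.

Let path1 : ipath T (fun=> 1).
Proof.
split => //.
by split => t Tt tT; [|exists 1]; exact: cvg_cst.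
Qed.

Lemma LSI_cst1 : LSI T (fun=> 1) (fun r => phi r%:E) = phi 0%E.
Proof.
rewrite (LSI_unif01 T0 path1 mphi bphi') /Rintegral.
have -> : (\int[unif01]_u (quant_fun T (fun=> 1) (fun r => phi r%:E) u)%:E = \int[unif01]_u (phi 0%E)%:E)%E.
  apply: ae_eq_integral => //; first by apply/measurable_EFinP; exact: measurable_quant_fun.
  apply: ae_unif01 => u /andP[u0 u1] _ /=; rewrite quant_fun_path//.
  have q0 : quantile T (fun=> 1) u = 0%E.
    apply/eqP; rewrite eq_le (quantile_leE u T0 path1 (time0 T0) T0) u1/=.
    by case/andP: (quantile_time (fun=> 1) u T0).
  by rewrite q0 T0.
by rewrite integral_cst//= unif01_setT mule1.
Qed.

(** The identity [ramped = x + x_0 (1 - ramp) - x_0] is not a convex combination. Moving the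
    negative term across and dividing by [1 + x_0] turns it into an equality of two mixtures, to
    which [LSI_mix] applies. *)
Lemma LSI_ramped n x : ipath T x -> LSI T (ramped T n x) (fun r => phi r%:E) =
  LSI T x (fun r => phi r%:E) + x 0%E * (LSI T (fun t => 1 - ramp T n t) (fun r => phi r%:E) - phi 0%E).
Proof.
move=> px; have [_ _ x0 _] := px; have x1 : 0 < 1 + x 0%E by rewrite ltr_pwDl.
pose a := (1 + x 0%E)^-1.
have a01 : 0 <= a <= 1 by rewrite invr_ge0 ltW//= invf_le1// lerDl.
have aE : a * (1 + x 0%E) = 1 by rewrite mulVf// gt_eqF.
have a1 : a * x 0%E = 1 - a by rewrite -[in RHS]aE; ring.
have E : mix a (ramped T n x) (fun=> 1) = mix a x (fun t => 1 - ramp T n t).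
  by apply/funext => t; rewrite /mix /ramped; ring: a1.
have := LSI_mix T0 a01 (ramped_ipath n T0 px) path1 mphi bphi'.
rewrite E (LSI_mix T0 a01 px (ipath_ramp n T0) mphi bphi') LSI_cst1.
move=> H; apply: (@mulfI _ a); first by rewrite /a invr_eq0 gt_eqF.
by move: H; rewrite mulrDr mulrA a1 mulrBr => H; lra.
Qed.

Lemma LSI_ramp_cvg : phi @ within [set s | (0 < s)%E] (nbhs 0%E) --> phi 0%E ->
  (fun n => LSI T (fun t => 1 - ramp T n t) (fun r => phi r%:E)) @ \oo --> phi 0%E.
Proof.
move=> phi0; under eq_fun do rewrite (LSI_unif01 T0 (ipath_ramp _ T0) mphi bphi').
rewrite (_ : phi 0%E = \int[unif01]_u (cst (phi 0%E) u)); last first.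
  rewrite Rintegral_cst// [X in fine X](_ : _ = 1%E) ?mulr1//; exact: unif01_setT.
apply: (@dominated_Rcvg _ _ _ unif01
  (fun n => quant_fun T (fun t => 1 - ramp T n t) (fun r => phi r%:E)) (cst (phi 0%E)) (cst C)) => //.
- by move=> n; apply: measurable_quant_fun => //; exact: ipath_ramp.
- apply: ae_unif01 => u /andP[u0 u1].
  apply/cvgrPdist_lt => e e0.
  have /(cvg_rightP _ _ (lexx 0%E) (ltry 0))/(_ _ e0)[s0 s00 Hs] := phi0.
  have sm : (0 < Order.min s0 T)%E by rewrite lt_min s00.
  have [s s_gt0 ss] := lte_dense sm (lexx 0%E).
  move: ss; rewrite lt_min => /andP[ss0 sT].
  have Ts : time T s%:E by rewrite /time/= !ltW.
  have := ramp_eventually0 Ts s_gt0; apply: filterS => n r0.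
  rewrite quant_fun_path//; set q := quantile T _ u.
  have qs : (q <= s%:E)%E by rewrite (quantile_leE u T0 (ipath_ramp n T0) Ts sT) r0 subr0.
  rewrite (le_lt_trans qs sT).
  have /andP[q0 _] : time T q := quantile_time _ u T0.
  move: q0; rewrite le_eqVlt => /predU1P[<-|q0]; first by rewrite subrr normr0.
  by rewrite distrC; apply: Hs => //; exact: le_lt_trans ss0.
- exact: finite_measure_integrable_cst.
- by apply: aeW => u n; exact: quant_fun_bound.
Qed.

(** The ramp tends to the indicator of time 0, so the limit sees only the atom of [z] at 0, that is,
    the levels [u <= z_0]. *)
Lemma LSI_mul_ramp_cvg z : ipath T z ->
  (fun n => LSI T z (fun r => phi r%:E * ramp T n r%:E)) @ \oo --> phi 0%E * z 0%E.
Proof.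
move=> pz; have [_ _ z0 _] := pz.
have mr n : measurable_fun (dom T) (fun r => phi r%:E * ramp T n r%:E).
  by apply: measurable_funM => //; exact: measurable_ramp.
have br n r : dom T r -> `|phi r%:E * ramp T n r%:E| <= C.
  move=> Dr; have [r0 _] := Dr; rewrite normrM (le_trans _ (bphi' Dr))// ler_piMr//.
  by rewrite ger0_norm ?ramp_ge0// ramp_le1.
under eq_fun do rewrite (LSI_unif01 T0 pz (mr _) (br _)).
pose lev := [set u : R | u <= z 0%E].
have z1 : z 0%E <= 1 := ipath_le1 T0 pz (time0 T0).
have mlev : measurable (lev : set (measurableTypeR R)).
  rewrite (_ : lev = `]-oo, z 0%E]%classic).
    exact (measurable_itv (Interval (BInfty _ true) (BRight (z 0%E)))).
  by apply/seteqP; split => u /=; rewrite in_itv.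
have mlim : measurable_fun (setT : set (measurableTypeR R)) (fun u => phi 0%E * \1_lev u).
  by apply: measurable_funM => //; exact: measurable_indic.
rewrite (_ : phi 0%E * z 0%E = \int[unif01]_u (phi 0%E * \1_lev u)); last first.
  rewrite RintegralZl//; last exact: integrable_indic.
  rewrite /Rintegral integral_indic// setIT; congr (_ * _); rewrite -[LHS]/(fine (z 0%E)%:E); congr fine.
  by apply/esym; apply: unif01_le; rewrite z0.
apply: (@dominated_Rcvg _ _ _ unif01
  (fun n => quant_fun T z (fun r => phi r%:E * ramp T n r%:E)) (fun u => phi 0%E * \1_lev u) (cst C)) => //.
- by move=> n; exact: measurable_quant_fun.
- apply: aeW => u; set q := quantile T z u.
  have qE n : quant_fun T z (fun r => phi r%:E * ramp T n r%:E) u =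
      if (q < T)%E then phi q * ramp T n q else 0.
    exact: (quant_fun_path z (fun t => phi t * ramp T n t) u T0).
  under eq_fun do rewrite qE.
  have Tq : time T q := quantile_time z u T0; have /andP[q0 _] := Tq.
  have levE : lev u = (q <= 0)%E by rewrite /lev/= (quantile_leE u T0 pz (time0 T0) T0).
  move: q0; rewrite le_eqVlt => /predU1P[q0|q0].
    rewrite indicE mem_set ?levE -?q0// T0.
    by under eq_fun do rewrite ramp0//; exact: cvg_cst.
  rewrite indicE memNset ?levE ?leNgt ?q0// mulr0.
  apply: (@cvg_trans _ ((fun=> 0) @ \oo)); last exact: cvg_cst.
  apply: near_eq_cvg; have := ramp_eventually0 Tq q0; apply: filterS => n ->.
  by rewrite mulr0 if_same.
- exact: finite_measure_integrable_cst.
- by apply: aeW => u n; apply: quant_fun_bound => //; exact: br.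
Qed.

End Limits.
End Ramp.

(** * Absolute continuity and stability of the strategy sets *)

Section AbsContinuity.
Context {R : realType}.
Implicit Types x y : R -> R.

Lemma abs_continuous_lin (a b p q : R) x y : abs_continuous_on a b x -> abs_continuous_on a b y ->
  abs_continuous_on a b (fun r => p * x r + q * y r).
Proof.
move=> acx acy e e0.
have p0 : 0 < `|p| + 1 by rewrite ltr_wpDl.
have q0 : 0 < `|q| + 1 by rewrite ltr_wpDl.
have [d1 d10 H1] := acx (e / 2 / (`|p| + 1)) ltac:(by rewrite !divr_gt0).
have [d2 d20 H2] := acy (e / 2 / (`|q| + 1)) ltac:(by rewrite !divr_gt0).
exists (Num.min d1 d2) => [|n u v uv vu]; first by rewrite lt_min d10.
rewrite lt_min => /andP[/(H1 _ _ _ uv vu) hx /(H2 _ _ _ uv vu) hy].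
rewrite ltr_pdivlMr// in hx; rewrite ltr_pdivlMr// in hy.
set X := \sum_(_ < n) _ in hx; set Y := \sum_(_ < n) _ in hy.
have X0 : 0 <= X by apply: sumr_ge0.
have Y0 : 0 <= Y by apply: sumr_ge0.
apply: (@le_lt_trans _ _ (`|p| * X + `|q| * Y)); last by move: hx hy; rewrite !mulrDr; lra.
rewrite /X /Y !mulr_sumr -big_split/=; apply: ler_sum => k _.
rewrite -!normrM (le_trans _ (ler_normD _ _))// le_eqVlt; apply/orP; left.
by apply/eqP; congr (`|_|); ring.
Qed.

Lemma lipschitz_abs_continuous (a b L : R) x : 0 <= L ->
  (forall u v, a <= u -> u <= v -> v <= b -> `|x v - x u| <= L * (v - u)) ->
  abs_continuous_on a b x.
Proof.
move=> L0 Lx e e0; have L1 : 0 < L + 1 by rewrite ltr_wpDl.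
exists (e / (L + 1)) => [|n u v uv _]; first exact: divr_gt0.
rewrite ltr_pdivlMr// => H; set S := \sum_(k < n) (v k - u k) in H.
have S0 : 0 <= S by apply: sumr_ge0 => k _; have [_ [? _]] := uv k (ltn_ord k); rewrite subr_ge0.
apply: (@le_lt_trans _ _ (L * S)); last by rewrite mulrDr in H; lra.
rewrite /S mulr_sumr; apply: ler_sum => k _.
by have [? [? ?]] := uv k (ltn_ord k); exact: Lx.
Qed.

End AbsContinuity.

Section Strategies.
Context {R : realType} {d : measure_display} {Omega : measurableType d}.
Variables (T : \bar R) (F : \bar R -> set (set Omega)).
Hypotheses (T0 : (0 < T)%E) (filF : is_filtration T F).
Implicit Types (x xi : \bar R -> Omega -> R).

Lemma G_measurable_lin (G : set (set Omega)) (a b : R) (Y Z : Omega -> R) :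
  sigma_algebra setT G -> G_measurable G Y -> G_measurable G Z ->
  G_measurable G (fun w => a * Y w + b * Z w).
Proof.
move=> sG /(G_measurableP _ sG) mY /(G_measurableP _ sG) mZ; apply/(G_measurableP _ sG).
by apply: measurable_funD; apply: measurable_funM.
Qed.

Lemma A_circ_pmix (a : R) x xi : 0 <= a <= 1 -> A_circ T F x -> A_circ T F xi ->
  A_circ T F (pmix a x xi).
Proof.
have [sF _ _] := filF.
move=> a01 [ax px] [axi pxi]; split => [t Tt|w].
  exact: G_measurable_lin (sF _ Tt) (ax _ Tt) (axi _ Tt).
exact: (ipath_mix a01 (px w) (pxi w)).
Qed.

Lemma A_circ_ac_pmix (a : R) x xi : 0 <= a <= 1 -> A_circ_ac T F x -> A_circ_ac T F xi ->
  A_circ_ac T F (pmix a x xi).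
Proof.
move=> a01 [Ax acx] [Axi acxi]; split; first exact: A_circ_pmix.
by move=> w s s0 sT; apply: abs_continuous_lin; [exact: acx|exact: acxi].
Qed.

(** Regularity concerns stopping times of the full filtration, so the strategies of both players
    have to be read there. *)
Lemma A_circ_sub (F' : \bar R -> set (set Omega)) xi :
  (forall t, time T t -> F t `<=` F' t) -> A_circ T F xi -> A_circ T F' xi.
Proof. by move=> FF' [axi pxi]; split => // t Tt B mB; apply: FF' => //; exact: axi. Qed.

Lemma A_circ_ac_lc xi : A_circ_ac T F xi -> lc_proc T xi.
Proof.
move=> [Axi acxi]; split; first exact: A_circ_rproc filF Axi.
by move=> w; apply: ac_left_continuous; [case: (Axi.2 w)|exact: acxi].
Qed.

(** The ramp is deterministic and [xi 0] is known at time 0, so adaptedness survives; the Lipschitz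
    constant [n + 1] of the ramp gives absolute continuity. *)
Lemma A_circ_ac_ramped n xi : A_circ_ac T F xi ->
  A_circ_ac T F (fun t w => ramped T n (xi^~ w) t).
Proof.
move=> [[axi pxi] acxi]; have [sF _ mF] := filF; split; first split.
- move=> t Tt.
  have E : (fun w => ramped T n (xi^~ w) t) = (fun w => 1 * xi t w + (- ramp T n t) * xi 0%E w).
    by apply/funext => w; rewrite /ramped; ring.
  rewrite E; apply: G_measurable_lin (sF _ Tt) (axi _ Tt) _ => B mB.
  apply: (mF _ _ (time0 T0) Tt); first by case/andP: Tt.
  exact: (axi _ (time0 T0)).
- by move=> w; exact: (ramped_ipath n T0 (pxi w)).
- move=> w s s0 sT.
  have E : (fun r : R => ramped T n (xi^~ w) r%:E) = (fun r => 1 * xi r%:E w + (- xi 0%E w) * ramp T n r%:E).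
    by apply/funext => r; rewrite /ramped; ring.
  rewrite E; apply: abs_continuous_lin; first exact: acxi.
  apply: (@lipschitz_abs_continuous _ _ _ n.+1%:R) => // u v u0 uv vs.
  have vT : (v%:E < T)%E by rewrite (le_lt_trans _ sT)// lee_fin.
  apply: (ramp_lip n (s := u%:E) (t := v%:E)) => //.
  - by rewrite /time/= lee_fin u0 (le_trans _ (ltW vT))// lee_fin.
  - by rewrite /time/= lee_fin (le_trans u0)//= ltW.
Qed.

(** Waiting until [T] is adapted to any filtration, so neither strategy set is empty. *)
Definition at_end : \bar R -> Omega -> R := fun t _ => if (t < T)%E then 0 else 1.

Lemma A_circ_ac_at_end : A_circ_ac T F at_end.
Proof.
have [sF _ _] := filF; split; first split.
- move=> t Tt B mB; have [tB|tB] := pselect (B (if (t < T)%E then 0 else 1)).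
    rewrite (_ : _ @^-1` _ = setT); first exact: sigma_algebra_setT (sF _ Tt).
    by apply/seteqP; split.
  rewrite (_ : _ @^-1` _ = set0); first by case: (sF _ Tt).
  by apply/seteqP; split.
- move=> w; split; rewrite /at_end ?T0 ?ltxx//.
    split => t Tt tT.
      have /andP[t0 _] := Tt; have t_oo : (t < +oo)%E by rewrite (lt_le_trans tT)// leey.
      apply/(cvg_rightP _ _ t0 t_oo) => e e0; exists T => // s _ ->.
      by rewrite tT subrr normr0.
    exists 0; apply/(cvg_leftP _ _ tT) => e e0; exists 0%E; first by rewrite lexx.
    move=> s _ st; have /andP[_ tT'] := Tt.
    by rewrite (lt_le_trans st tT') subrr normr0.
  move=> s t _ _ st; case: ifP => [sT|/negbT sT]; first by case: ifP.
  by rewrite ifN// -leNgt (le_trans _ st)// leNgt.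
- move=> w s s0 sT; apply: (@lipschitz_abs_continuous _ _ _ 0) => // u v u0 uv vs.
  rewrite /at_end !(le_lt_trans _ sT) ?lee_fin// ?subrr ?normr0 ?mul0r//.
  exact: le_trans vs.
Qed.

End Strategies.

(** * Limit of the payoff under ramps *)

Section RampedPayoff.
Context {R : realType} {d : measure_display} {Omega : measurableType d}.
Variables (P : probability Omega R) (T : \bar R) (f g h : \bar R -> Omega -> R) (Mf Mg : Omega -> R).
Hypotheses (T0 : (0 < T)%E) (bf : bproc T f Mf) (bg : bproc T g Mg)
  (cf : forall w, cadlag T (f^~ w))
  (iMf : P.-integrable setT (EFin \o Mf)) (iMg : P.-integrable setT (EFin \o Mg))
  (mh0 : measurable_fun setT (h 0%E)) (mhT : measurable_fun setT (h T))
  (fgh : {ae P, forall w t, time T t -> f t w >= h t w /\ h t w >= g t w}).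
Implicit Types (x xi zeta : \bar R -> Omega -> R) (a : R).

Definition ramped_proc n xi : \bar R -> Omega -> R := fun t w => ramped T n (xi^~ w) t.

Lemma rproc_ramped n xi : rproc T xi -> rproc T (ramped_proc n xi).
Proof.
move=> [px mx]; split; first by move=> w; exact: (ramped_ipath n T0 (px w)).
move=> t Tt; apply: measurable_funB; first exact: mx.
by apply: measurable_funM => //; apply: mx; exact: time0.
Qed.

(** Under the ramp the atom of [zeta] at 0 meets [1 - 0] instead of [1 - xi_0], which adds
    [g_0 xi_0 zeta_0], while the term [h_0 xi_0 zeta_0] disappears. The [f] integral converges
    because [f (1 - zeta)] is right-continuous at 0. *)
Lemma payoff_path_ramped_cvg xi zeta w : rproc T xi -> rproc T zeta ->
  (fun n => payoff_path T f g h (ramped_proc n xi) zeta w) @ \oo -->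
  payoff_path T f g h xi zeta w + (g 0%E w - h 0%E w) * (xi 0%E w * zeta 0%E w).
Proof.
move=> rx rz; have px := rx.1 w; have pz := rz.1 w.
pose X := xi^~ w; pose x0 := xi 0%E w.
pose phi t := f t w * (1 - zeta t w).
have bphi := bproc_stop T0 bf rz.
have [mphi _] := bproc_path w bphi.
have phi0 : phi @ within [set s | (0 < s)%E] (nbhs 0%E) --> phi 0%E.
  apply: cvgM; first exact: (cf w).1 (time0 T0) T0.
  by apply: cvgB; [exact: cvg_cst|have [[+ _] _ _ _] := pz; apply => //; exact: time0].
have L1 : (fun n => LSI T (ramped T n X) (fun r => phi r%:E)) @ \oo --> LSI T X (fun r => phi r%:E).
  under eq_fun do rewrite (LSI_ramped T0 mphi (fun t => bphi.2 t w) _ px).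
  suff : (fun n => LSI T X (fun r => phi r%:E) + X 0%E *
      (LSI T (fun t => 1 - ramp T n t) (fun r => phi r%:E) - phi 0%E)) @ \oo -->
      LSI T X (fun r => phi r%:E) + X 0%E * (phi 0%E - phi 0%E) by rewrite subrr mulr0 addr0.
  apply: cvgD; first exact: cvg_cst.
  apply: cvgMr; apply: cvgB; last exact: cvg_cst.
  exact: (LSI_ramp_cvg T0 mphi (fun t => bphi.2 t w) phi0).
have [mg bgw] := bproc_path w bg.
have [ms bs] := bproc_path w (bproc_stop T0 bg rx).
have L2 : (fun n => LSI T (zeta^~ w) (fun r => g r%:E w * (1 - ramped T n X r%:E))) @ \oo -->
    LSI T (zeta^~ w) (fun r => g r%:E w * (1 - X r%:E)) + x0 * (g 0%E w * zeta 0%E w).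
  have E n : LSI T (zeta^~ w) (fun r => g r%:E w * (1 - ramped T n X r%:E)) =
      LSI T (zeta^~ w) (fun r => g r%:E w * (1 - X r%:E)) +
      x0 * LSI T (zeta^~ w) (fun r => g r%:E w * ramp T n r%:E).
    have [mr br] : measurable_fun (dom T) (fun r => g r%:E w * ramp T n r%:E) /\
        forall r, dom T r -> `|g r%:E w * ramp T n r%:E| <= Mg w.
      split; first by apply: measurable_funM => //; exact: measurable_ramp.
      move=> r Dr; rewrite normrM (le_trans _ (bgw _ Dr))// ler_piMr//.
      by have [r0 _] := Dr; rewrite ger0_norm ?ramp_ge0// ramp_le1.
    rewrite -[X in X + _]mul1r -(LSI_lin 1 x0 T0 pz ms bs mr br); congr LSI.
    by apply/funext => r; rewrite /ramped /x0 /X; ring.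
  under eq_fun do rewrite E.
  apply: cvgD; first exact: cvg_cst.
  by apply: cvgMr; exact: (LSI_mul_ramp_cvg T0 mg (fun t => bg.2 t w) pz).
(* For large [n] the ramp vanishes from a fixed rational time before [T] on, so the jump at [T] is
   eventually unchanged. *)
have L3 : (fun n => jump (ramped T n X) T) @ \oo --> jump X T.
  have [k [k0 kT]] := rat_time_dense (lexx 0%E) T0 (lexx T).
  have Tk := rat_time_time k T0.
  apply: (@cvg_trans _ ((fun=> jump X T) @ \oo)); last exact: cvg_cst.
  apply: near_eq_cvg; have := ramp_eventually0 Tk k0; apply: filterS => n r0.
  rewrite /jump gt_eqF//; congr (_ - _).
    by rewrite /ramped rampT mulr0 subr0.
  have [cx _ _ _] := px; apply: esym; apply: leftlim_eq => //.
  apply/(cvg_leftP _ _ T0) => e e0.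
  have /(cvg_leftP _ _ T0)/(_ _ e0)[s0 /andP[s00 s0T] Hs] := leftlim_cvg cx (timeT T0) T0.
  exists (Order.max s0 (rat_time T k)); first by rewrite le_max s00 gt_max s0T.
  move=> s; rewrite gt_max => /andP[s0s ks] sT.
  have Ts : time T s by rewrite /time/= (ltW sT) (ltW (lt_trans k0 ks)).
  have -> : ramped T n X s = X s.
    have : ramp T n s = 0.
      by apply/eqP; rewrite eq_le ramp_ge0 andbT -r0 ramp_mono// ltW.
    by rewrite /ramped => ->; rewrite mulr0 subr0.
  exact: Hs.
rewrite (_ : _ + _ = LSI T X (fun r => phi r%:E) +
  (LSI T (zeta^~ w) (fun r => g r%:E w * (1 - X r%:E)) + x0 * (g 0%E w * zeta 0%E w)) +
  h T w * jump X T * jump (zeta^~ w) T); last first.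
  by rewrite /payoff_path /X /x0 /phi; ring.
have E n : payoff_path T f g h (ramped_proc n xi) zeta w =
    LSI T (ramped T n X) (fun r => phi r%:E) +
    LSI T (zeta^~ w) (fun r => g r%:E w * (1 - ramped T n X r%:E)) +
    h T w * jump (ramped T n X) T * jump (zeta^~ w) T.
  rewrite /payoff_path; congr (_ + _).
  by rewrite /ramped_proc /ramped ramp0// mulr1 subrr mulr0 mul0r add0r.
under eq_fun do rewrite E.
apply: cvgD; first exact: cvgD.
by apply: cvgMl; exact: cvgMr.
Qed.

Lemma payoffR_ramped xi zeta a : rproc T xi -> rproc T zeta ->
  (forall n, a <= payoffR P T f g h (ramped_proc n xi) zeta) ->
  a <= payoffR P T f g h xi zeta.
Proof.
move=> rx rz Ha.
(* The minimum makes the correction nonpositive at every [w]; almost surely it changes nothing. *)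
pose k w := Num.min 0 (g 0%E w - h 0%E w) * (xi 0%E w * zeta 0%E w).
pose Q w := payoff_path T f g h xi zeta w + k w.
have mp x : rproc T x -> measurable_fun setT (payoff_path T f g h x zeta).
  by move=> rx'; exact: measurable_payoff_path T0 bf bg iMf iMg mh0 mhT rx' rz.
have k0 w : k w <= 0.
  have /andP[x0 _] := rproc01 w T0 rx (time0 T0); have /andP[z0 _] := rproc01 w T0 rz (time0 T0).
  by rewrite /k mulr_le0_ge0 ?mulr_ge0// ge_min lexx.
have mQ : measurable_fun setT Q.
  apply: measurable_funD; first exact: mp.
  apply: measurable_funM.
    apply: measurable_minr; first exact: measurable_cst.
    by apply: measurable_funB => //; apply: jm_fix (time0 T0); case: bg.
  by apply: measurable_funM; [apply: rx.2|apply: rz.2]; exact: time0.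
have Qcvg : {ae P, forall w, (fun n => payoff_path T f g h (ramped_proc n xi) zeta w) @ \oo --> Q w}.
  move: fgh; apply: filterS => w /(_ 0%E (time0 T0))[_ gh].
  rewrite /Q /k min_r ?subr_le0//; exact: payoff_path_ramped_cvg.
have ale : {ae P, forall w n, `|payoff_path T f g h (ramped_proc n xi) zeta w| <= 3 * (Mf w + Mg w)}.
  move: (ae_payoff_path_le T0 bf bg fgh); apply: filterS => w H n.
  by apply: H => //; exact: rproc_ramped.
have mr n := mp _ (rproc_ramped n rx).
have K := dominated_Rcvg mr mQ Qcvg (integrable_bound iMf iMg) ale.
have iQ := dominated_Rintegrable mr mQ Qcvg (integrable_bound iMf iMg) ale.
apply: (@le_trans _ _ (\int[P]_w Q w)).
  have := ler_cvg_to (cvg_cst a) K; apply; apply: nearW => n; exact: Ha.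
apply: le_Rintegral => //; last by move=> w _; rewrite /Q gerDl.
exact: (integrable_payoff_path T0 bf bg iMf iMg mh0 mhT fgh rx rz).
Qed.

End RampedPayoff.

(** * The value of the game *)

(** Makes a weighted family of opponents equivalent to one opponent, so that a hypothesis on single
    opponents yields the weighted hypothesis of the finite minimax. *)
Lemma convex_combination {R : realType} (X Y : Type) (XX : set X) (A : set Y)
  (mixX : R -> X -> X -> X) (N : X -> Y -> R) :
  (forall a x x', 0 <= a <= 1 -> XX x -> XX x' -> XX (mixX a x x') /\
     forall y, A y -> N (mixX a x x') y = a * N x y + (1 - a) * N x' y) ->
  forall n (s : 'I_n -> X) (p : 'I_n -> R), (forall i, XX (s i)) -> (forall i, 0 <= p i) ->
  \sum_i p i = 1 -> exists2 x, XX x & forall y, A y -> N x y = \sum_i p i * N (s i) y.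
Proof.
move=> XXmix; elim=> [|n IH] s p Xs p0.
  by rewrite big_ord0 => /esym/eqP; rewrite oner_eq0.
rewrite big_ord_recl; set q := \sum_(i < n) _ => pq.
have q0 : 0 <= q by apply: sumr_ge0.
have [q_eq0|qn0] := eqVneq q 0.
  exists (s ord0) => // y Ay; rewrite big_ord_recl big1 ?addr0.
    by move: pq; rewrite q_eq0 addr0 => ->; rewrite mul1r.
  move=> i _; have /psumr_eq0P H : q = 0 by [].
  by rewrite H ?mul0r// => j _.
have q_gt0 : 0 < q by rewrite lt_def qn0.
have [x Xx Nx] := IH (fun i => s (lift ord0 i)) (fun i => p (lift ord0 i) / q)
  (fun i => Xs _) (fun i => divr_ge0 (p0 _) q0) ltac:(by rewrite -mulr_suml divff).
have p1 : 0 <= p ord0 <= 1 by rewrite p0 -pq lerDl.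
have [XX' N'] := XXmix _ _ _ p1 (Xs ord0) Xx.
exists (mixX (p ord0) (s ord0) x) => // y Ay.
rewrite N'// Nx// big_ord_recl; congr (_ + _).
have -> : 1 - p ord0 = q by rewrite -pq addrC addKr.
by rewrite mulr_sumr; apply: eq_bigr => i _; rewrite mulrA mulrCA divff// mulr1.
Qed.

Section Game.
Context {R : realType} {d : measure_display} {Omega : measurableType d}.
Variables (P : probability Omega R) (T : \bar R) (F F1 F2 : \bar R -> set (set Omega))
  (f g h : \bar R -> Omega -> R) (Mf Mg : Omega -> R).
Hypotheses (T0 : (0 < T)%E) (filF : is_filtration T F) (filF1 : is_filtration T F1)
  (filF2 : is_filtration T F2)
  (F1F : forall t, time T t -> F1 t `<=` F t) (F2F : forall t, time T t -> F2 t `<=` F t)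
  (rcF : right_continuous_filtration T F) (rcF2 : right_continuous_filtration T F2)
  (bf : bproc T f Mf) (bg : bproc T g Mg)
  (cf : forall w, cadlag T (f^~ w)) (cg : forall w, cadlag T (g^~ w))
  (iMf : P.-integrable setT (EFin \o Mf)) (iMg : P.-integrable setT (EFin \o Mg))
  (rg : regular P T F g)
  (mh0 : measurable_fun setT (h 0%E)) (mhT : measurable_fun setT (h T))
  (fgh : {ae P, forall w t, time T t -> f t w >= h t w /\ h t w >= g t w}).

Let N := payoffR P T f g h.
Let XX := [set xi | A_circ_ac T F1 xi /\ forall w, xi 0%E w = 0].

Let rX xi : XX xi -> rproc T xi.
Proof. by move=> [/(A_circ_ac_lc filF1)[rx _] _]. Qed.

Let rA zeta : A_circ T F2 zeta -> rproc T zeta.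
Proof. exact: A_circ_rproc. Qed.

Let mixX (a : R) x x' : 0 <= a <= 1 -> XX x -> XX x' -> XX (pmix a x x') /\
  forall y, A_circ T F2 y -> N (pmix a x x') y = a * N x y + (1 - a) * N x' y.
Proof.
move=> a01 Xx Xx'; split.
  split; first by apply: (A_circ_ac_pmix filF1 a01); [case: Xx|case: Xx'].
  by move=> w; rewrite /pmix Xx.2 Xx'.2 !mulr0 addr0.
move=> y Ay.
exact: (payoffR_mixl T0 bf bg iMf iMg mh0 mhT fgh a01 (rX Xx) (rX Xx') (rA Ay)).
Qed.

Lemma minimax_strategy (c : R) :
  (forall xi, A_circ_ac T F1 xi -> forall e, 0 < e -> exists2 zeta, A_circ T F2 zeta & c - e < N xi zeta) ->
  (exists zeta, A_circ T F2 zeta) ->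
  exists2 zeta, A_circ T F2 zeta & forall xi, A_circ_ac T F1 xi -> c <= N xi zeta.
Proof.
move=> Hc [y0 Ay0].
have fin n (s : 'I_n -> \bar R -> Omega -> R) e : (forall i, XX (s i)) -> 0 < e ->
    exists2 y, A_circ T F2 y & forall i, c - e < N (s i) y.
  move=> Xs e0.
  apply: (@finite_affine_minimax _ _ (A_circ T F2) pmix n (fun i y => N (s i) y)
    (\int[P]_w (3 * (Mf w + Mg w))) c y0 Ay0 _ _ _ e e0).
  - move=> a y y' a01 Ay Ay'; split; first exact: (A_circ_pmix filF2 a01 Ay Ay').
    move=> i; exact: (payoffR_mixr T0 bf bg iMf iMg mh0 mhT fgh a01 (rA Ay) (rA Ay') (rX (Xs i))).
  - move=> i y Ay; exact: (payoffR_le T0 bf bg iMf iMg mh0 mhT fgh (rX (Xs i)) (rA Ay)).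
  - move=> p p0 p1 e' e'0.
    have [x Xx Nx] := @convex_combination _ _ _ XX (A_circ T F2) pmix N mixX n s p Xs p0 p1.
    by have [y Ay Hy] := Hc x Xx.1 e' e'0; exists y => //; rewrite -Nx.
have half : 0 <= (1 / 2 : R) <= 1 by apply/andP; split; lra.
have [u [Au Du Vu]] := @min_norm_selection _ _ _ XX (A_circ T F2) (pmix (1 / 2)) (sqexp P T) (sqdist P T) N c
  (fun y Ay => sqexp01 P T0 (rA Ay)) (fun y y' Ay Ay' => sqdistE P T0 (rA Ay) (rA Ay'))
  (fun y y' Ay Ay' => A_circ_pmix filF2 half Ay Ay')
  ltac:(move=> x y y' Xx Ay Ay';
    rewrite /N (payoffR_mixr T0 bf bg iMf iMg mh0 mhT fgh half (rA Ay) (rA Ay') (rX Xx)); lra)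
  fin.
exists (limit_proc T u); first exact: limit_proc_A_circ.
have A0 xi : XX xi -> c <= N xi (limit_proc T u).
  move=> Xxi; have [v Hv] := Vu _ Xxi.
  have Av n : A_circ T F2 (v n) by case: (Hv n).
  have yz := selection_limit T0 filF2 Au Av (fun n => Du n n.+1 (leqnSn n))
    (fun n => let: And3 _ _ H := Hv n in H).
  have axi : A_circ T F xi := A_circ_sub F1F Xxi.1.1.
  have [_ lxi] := A_circ_ac_lc filF1 Xxi.1.
  apply: (payoffR_usc T0 bf bg iMf iMg mh0 mhT fgh filF rcF cg rg axi lxi Xxi.2
    (fun n => A_circ_sub F2F (Av n)) (A_circ_sub F2F (limit_proc_A_circ T0 filF2 rcF2 Au)) yz).
  by move=> n; case: (Hv n).
(* An opponent with a jump at 0 is reached as the limit of its ramped versions, which start from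
   0. *)
move=> xi axi; have [rx _] := A_circ_ac_lc filF1 axi.
have rl : rproc T (limit_proc T u) by apply: rA; exact: limit_proc_A_circ.
apply: (payoffR_ramped T0 bf bg cf iMf iMg mh0 mhT fgh rx rl) => n.
apply: A0; split; first exact: (A_circ_ac_ramped T0 filF1 n axi).
by move=> w; rewrite /ramped_proc /ramped ramp0// mulr1 subrr.
Qed.

End Game.

Theorem mainTheorem8 (R : realType) (d : measure_display)
  (Omega : measurableType d) (P : probability Omega R) (T : \bar R)
  (F F1 F2 : \bar R -> set (set Omega)) (f g h : \bar R -> Omega -> R) :
  (0 < T)%E ->
  measure_is_complete P ->
  is_filtration T F -> is_filtration T F1 -> is_filtration T F2 ->
  (forall t, time T t -> F1 t `<=` F t) ->
  (forall t, time T t -> F2 t `<=` F t) ->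
            
  Lb P T f -> Lb P T g ->
            
  adapted T F f -> adapted T F g -> regular P T F f -> regular P T F g ->
            
  {ae P, forall w, forall t, time T t -> f t w >= h t w /\ h t w >= g t w} ->
            
  adapted T F h -> jointly_measurable T h ->
            
  right_continuous_filtration T F ->
  right_continuous_filtration T F1 -> right_continuous_filtration T F2 ->
  (forall N, P.-negligible N -> F1 0%E N) ->
  (forall N, P.-negligible N -> F2 0%E N) ->
  let W_lower := ereal_sup [set ereal_inf [set payoff P T f g h xi zeta
                                            | xi in A_circ_ac T F1]
                           | zeta in A_circ T F2] in
  let W_upper := ereal_inf [set ereal_sup [set payoff P T f g h xi zeta
                                            | zeta in A_circ T F2]
                           | xi in A_circ_ac T F1] in
  W_lower = W_upper /\
  exists zeta_star, A_circ T F2 zeta_star /\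
    ereal_inf [set payoff P T f g h xi zeta_star | xi in A_circ_ac T F1]
      = W_lower.
Proof.
move=> T0 _ filF filF1 filF2 F1F F2F Lf Lg _ _ _ rg fgh' ah _ rcF _ rcF2 _ _ W_lower W_upper.
have [Mf [bf iMf]] := Lb_bproc T0 Lf; have [Mg [bg iMg]] := Lb_bproc T0 Lg.
have [_ cf _] := Lf; have [_ cg _] := Lg.
have fgh : {ae P, forall w t, time T t -> f t w >= h t w /\ h t w >= g t w} by exact: fgh'.
have mh t : time T t -> measurable_fun setT (h t).
  by move=> Tt _ B mB; rewrite setTI; have [_ Fm _] := filF; apply: (Fm _ Tt); exact: ah.
have mh0 := mh _ (time0 T0); have mhT := mh _ (timeT T0).
pose N := payoffR P T f g h.
have NE xi zeta : A_circ_ac T F1 xi -> A_circ T F2 zeta ->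
    payoff P T f g h xi zeta = (N xi zeta)%:E.
  move=> Axi Az.
  exact: (payoffE T0 bf bg iMf iMg mh0 mhT fgh (A_circ_ac_lc filF1 Axi) (A_circ_rproc filF2 Az)).
have [B NB] : exists B, forall xi zeta, A_circ_ac T F1 xi -> A_circ T F2 zeta -> `|N xi zeta| <= B.
  exists (\int[P]_w (3 * (Mf w + Mg w))) => xi zeta Axi Az.
  have [rx _] := A_circ_ac_lc filF1 Axi.
  exact: (payoffR_le T0 bf bg iMf iMg mh0 mhT fgh rx (A_circ_rproc filF2 Az)).
have X0 := A_circ_ac_at_end T0 filF1; have [Y0 _] := A_circ_ac_at_end T0 filF2.
have W_le : (W_lower <= W_upper)%E.
  apply: ge_ereal_sup => _ [zeta Az <-]; apply: le_ereal_inf_tmp => _ [xi Axi <-].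
  apply: (@le_trans _ _ (payoff P T f g h xi zeta)).
    by apply: ereal_inf_lbound; exists xi.
  by apply: ereal_sup_ubound; exists zeta.
(* The uniform bound [B] and the strategy [at_end] of each player give finiteness, which allows a
   real [e] to be subtracted from the value. *)
have W_fin : W_upper \is a fin_num.
  rewrite fin_numElt; apply/andP; split.
    apply: (@lt_le_trans _ _ (- B)%:E); first exact: ltNyr.
    apply: le_ereal_inf_tmp => _ [xi Axi <-].
    apply: (@le_trans _ _ (payoff P T f g h xi (at_end T))).
      by rewrite NE// lee_fin; have := NB _ _ Axi Y0; rewrite ler_norml => /andP[].
    by apply: ereal_sup_ubound; exists (at_end T).
  apply: (@le_lt_trans _ _ B%:E); last exact: ltry.
  apply: (@le_trans _ _ (ereal_sup [set payoff P T f g h (at_end T) zeta | zeta in A_circ T F2])).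
    by apply: ereal_inf_lbound; exists (at_end T).
  apply: ge_ereal_sup => _ [zeta Az <-].
  by rewrite NE// lee_fin (le_trans (ler_norm _))// NB.
have [|zeta Az zetaW] := @minimax_strategy _ _ _ P T F F1 F2 f g h Mf Mg T0 filF filF1 filF2 F1F F2F
    rcF rcF2 bf bg cf cg iMf iMg rg mh0 mhT fgh (fine W_upper) _ (ex_intro _ _ Y0).
  move=> xi Axi e e0; apply: contrapT => no.
  have : (W_upper <= (fine W_upper - e)%:E)%E.
    apply: (@le_trans _ _ (ereal_sup [set payoff P T f g h xi zeta | zeta in A_circ T F2])).
      by apply: ereal_inf_lbound; exists xi.
    apply: ge_ereal_sup => _ [zeta Az <-]; rewrite NE// lee_fin leNgt; apply/negP => lt.
    by apply: no; exists zeta.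
  by rewrite -{1}(fineK W_fin) lee_fin; lra.
have W_inf : (W_upper <= ereal_inf [set payoff P T f g h xi zeta | xi in A_circ_ac T F1])%E.
  apply: le_ereal_inf_tmp => _ [xi Axi <-]; rewrite NE// -(fineK W_fin) lee_fin; exact: zetaW.
have inf_W : (ereal_inf [set payoff P T f g h xi zeta | xi in A_circ_ac T F1] <= W_lower)%E.
  by apply: ereal_sup_ubound; exists zeta.
have WE : W_lower = W_upper by apply/eqP; rewrite eq_le W_le (le_trans W_inf inf_W).
split => //; exists zeta; split => //; apply/eqP.
by rewrite eq_le inf_W WE W_inf.
Qed.
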